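(* Let $n\in\{0,1,2,\dots\}$ and $\nu_n=2n+\tfrac32$. As $\nu\downarrow\nu_n$, two of the zeros of $K_\nu$ converge to $-x_n$ and the others converge to the non-real zeros of $K_{\nu_n}$. That is, if $w_1,\dots,w_{2n}$ denote the non-real zeros of $K_{\nu_n}$ (none if $n=0$), then for each $\nu\in(\nu_n,\nu_n+2)$ the $2n+2$ zeros of $K_\nu$ can be enumerated as $z_1^{(\nu)},\dots,z_{2n+2}^{(\nu)}$ in such a way that $$\lim_{\nu\downarrow\nu_n}z_1^{(\nu)}=\lim_{\nu\downarrow\nu_n}z_2^{(\nu)}=-x_n\qquad\text{and}\qquad \lim_{\nu\downarrow\nu_n}z_{j+2}^{(\nu)}=w_j\quad (1\le j\le 2n).$$
   Context: For real $\nu$, $I_\nu$ and $K_\nu$ denote the modified Bessel functions of the first and second kind ($K_\nu$ is the Macdonald function). $K_\nu(z)$ is considered, by analytic continuation from $(0,\infty)$, as a holomorphic function of $z\in\mathbf{C}\setminus(-\infty,0]$ (principal branch). For $n=0,1,2,\dots$ put $\nu_n=2n+\frac32$. Zeros: for $\nu>\frac32$ not of the form $\nu_m$, the zeros of $K_\nu$ are its zeros in $\mathbf{C}\setminus(-\infty,0]$. It is known that when $\nu_n<\nu<\nu_{n+1}=\nu_n+2$ there are exactly $2(n+1)$ of them. For $\nu=\nu_n$ one has $$K_{\nu_n}(z)=\sqrt{\frac{\pi}{2z}}\,e^{-z}\sum_{k=0}^{2n+1}\frac{(\nu_n,k)}{(2z)^k},\qquad (\nu,0)=1,\quad (\nu,k)=\frac{(4\nu^2-1^2)(4\nu^2-3^2)\cdots(4\nu^2-(2k-1)^2)}{k!\,2^{2k}},$$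 so the zeros of $K_{\nu_n}$ are by convention the $2n+1$ roots of the polynomial $\sum_{k=0}^{2n+1}\frac{(\nu_n,2n+1-k)}{2^{2n+1-k}}z^k$. It is known that exactly one of these is real; it is negative and is also regarded as a zero of $K_{\nu_n}$. The other $2n$ roots are the non-real zeros of $K_{\nu_n}$. $x_n$ denotes the unique positive solution $x$ of the equation $K_{\nu_n}(x)=\pi I_{\nu_n}(x)$; the negative zero of $K_{\nu_n}$ is $-x_n$. *)

(* Defs.v *)
From Stdlib Require Export Arith Reals.
From Coquelicot Require Export Coquelicot.
Open Scope R_scope.

Definition cexp (z : C) : C :=
  (RtoC (exp (Re z)) * (cos (Im z), sin (Im z)))%C.

(* Principal argument, with values in (-PI, PI] for z <> 0. *)
Definition carg (z : C) : R :=
  if Rle_dec 0 (Im z) then acos (Re z / Cmod z) else - acos (Re z / Cmod z).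

Definition clog (z : C) : C := (ln (Cmod z), carg z).

Definition cpower (z : C) (a : R) : C := cexp (RtoC a * clog z)%C.

Definition slit_plane (z : C) : Prop := ~ (Im z = 0 /\ Re z <= 0).

(* Coquelicot's [Series] and [Lim] are real-valued; these are their
   componentwise versions. *)
Definition CSeries (a : nat -> C) : C :=
  (Series (fun k => Re (a k)), Series (fun k => Im (a k))).

Definition CLim (f : R -> C) (x : R) : C :=
  (real (Lim (fun t => Re (f t)) x), real (Lim (fun t => Im (f t)) x)).

(* 1 / Gamma(x) for every real x (zero at the poles 0, -1, -2, ... of Gamma),
   by Gauss's limit
   1 / Gamma(x) = lim_N  x (x + 1) ... (x + N) / (N! N^x). *)
Definition rgamma (x : R) : R :=
  real (Lim_seq (fun N =>
    prod_f_R0 (fun k => x + INR k) N / (INR (fact N) * Rpower (INR N) x))).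

(* I_nu(z) = sum_k (z/2)^(nu + 2k) / (k! Gamma(nu + k + 1)), with the factor
   (z/2)^nu (principal value) taken out of the sum. *)
Definition besselI (nu : R) (z : C) : C :=
  (cpower (z / 2) nu *
   CSeries (fun k =>
     RtoC (rgamma (nu + INR k + 1) / INR (fact k)) * (z / 2) ^ (2 * k)))%C.

Definition besselK_nonint (nu : R) (z : C) : C :=
  (RtoC (PI / 2 / sin (nu * PI)) * (besselI (- nu) z - besselI nu z))%C.

(* sin (nu PI) = 0 exactly when nu is an integer; K_nu(z) is then the limit of
   K_mu(z) as mu -> nu, mu <> nu.  The principal power in [besselI] makes
   K_nu holomorphic on [slit_plane]; values outside [slit_plane] are not
   meaningful. *)
Definition besselK (nu : R) (z : C) : C :=
  if Req_EM_T (sin (nu * PI)) 0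
  then CLim (fun mu => besselK_nonint mu z) nu
  else besselK_nonint nu z.

Definition besselK_zero (nu : R) (z : C) : Prop :=
  slit_plane z /\ besselK nu z = 0%C.

Definition nu_ (n : nat) : R := 2 * INR n + 3 / 2.

(* (4 nu^2 - 1^2) (4 nu^2 - 3^2) ... (4 nu^2 - (2k - 1)^2) *)
Fixpoint hankel_prod (nu : R) (k : nat) : R :=
  match k with
  | O => 1
  | S j => hankel_prod nu j * (4 * nu ^ 2 - (2 * INR k - 1) ^ 2)
  end.

(* The Hankel symbol, usually written (nu, k). *)
Definition hankel (nu : R) (k : nat) : R :=
  hankel_prod nu k / (INR (fact k) * 2 ^ (2 * k)).

(* The polynomial of degree 2n + 1 whose roots are, by convention, the zeros
   of K_{nu_n}; unlike [besselK_zero], these include a negative real one. *)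
Definition besselK_poly (n : nat) (z : C) : C :=
  sum_n (fun k =>
    (RtoC (hankel (nu_ n) (2 * n + 1 - k) / 2 ^ (2 * n + 1 - k)) * z ^ k)%C)
    (2 * n + 1).

Definition nonreal_zero (n : nat) (z : C) : Prop :=
  besselK_poly n z = 0%C /\ Im z <> 0.

(* w 0, ..., w (m - 1) lists every point satisfying P exactly once; in
   particular there are exactly m such points. *)
Definition enumerates (m : nat) (P : C -> Prop) (w : nat -> C) : Prop :=
  (forall i j, (i < m)%nat -> (j < m)%nat -> w i = w j -> i = j) /\
  (forall z, P z <-> exists i, (i < m)%nat /\ z = w i).

(* Main.v *)
Require Import Defs.
From Stdlib Require Import ZArith Lra Lia List.
From Stdlib Require Import Classical ClassicalEpsilon FunctionalExtensionality.

(** In the variable s = log z the function K_nu is entire, solves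
    f'' = (e^(2s) + nu^2) f, and is the solution, unique up to a factor, that is recessive as
    s -> +oo; so its zeros are simple and depend continuously on nu, also through integer nu.
    The zeros in the closed strip |Im s| <= pi stay in a bounded region (split f into a growing and
    a decaying component and follow them up the vertical lines), and
    Re K_nu(e^(t + i pi)) = cos(nu pi) K_nu(e^t) (with the imaginary part when nu = nu_n + 1)
    keeps them off the boundary for nu_n < nu < nu_n + 2.  Hence their number is constant there, and it is read off at nu_n: the
    2n zeros log w_j are inside the strip, and the two boundary zeros log x_n +- i pi move inside
    as nu increases.  Near each of these points there is exactly one zero, by Newton's iteration. *)

(** * Complex numbers and complex derivatives *)

(** No contour integral occurs. Holomorphy enters through the mean value inequality on segments and
    through the linear equation, whose solutions are governed by two numbers, their value and slope
    at s = 0. The variable s also separates what is entangled in z: -x_n lies on the cut of the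
    principal branch and is approached from both sides, whereas log x_n + i pi and log x_n - i pi
    are two distinct simple zeros of an entire function. The continuation formula K_nu(e^(i pi) x) =
    e^(-i nu pi) K_nu(x) - i pi I_nu(x) turns K = pi I into the equation of these boundary zeros.
    The obstacle is continuity in nu at integers, where the formula with 1/sin(nu pi) degenerates.
    Division by K_nu(1) removes the singular factor and leaves the slope at s = 0, which a Wronskian
    identity shows to be locally Lipschitz in nu. For this, recessiveness is encoded by inequalities
    on u'/u, which survive limits. Their only analytic input is I_(-nu)/I_nu -> 1 at infinity. *)

Lemma C_eq (x y : C) : Re x = Re y -> Im x = Im y -> x = y.
Proof. destruct x, y; unfold Re, Im; simpl; intros -> ->; reflexivity. Qed.

Lemma im_le_Cmod (z : C) : Rabs (Im z) <= Cmod z.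
Proof. eapply Rle_trans; [apply Rmax_r | apply Rmax_Cmod]. Qed.

Lemma Re_le_Cmod (z : C) : Re z <= Cmod z.
Proof. eapply Rle_trans; [apply Rle_abs | apply re_le_Cmod]. Qed.

Lemma Cmod_le_abs (z : C) : Cmod z <= Rabs (Re z) + Rabs (Im z).
Proof.
  replace z with (RtoC (Re z) + Ci * RtoC (Im z))%C at 1
    by (apply C_eq; destruct z; simpl; ring).
  eapply Rle_trans; [apply Cmod_triangle|].
  rewrite Cmod_mult, Cmod_Ci, !Cmod_R; lra.
Qed.

Lemma Cmod_sub_sym (x y : C) : Cmod (x - y) = Cmod (y - x).
Proof. rewrite <- Cmod_opp; f_equal; ring. Qed.

Lemma Cmod_sub_triangle (x y z : C) : Cmod (x - z) <= Cmod (x - y) + Cmod (y - z).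
Proof. replace (x - z)%C with ((x - y) + (y - z))%C by ring; apply Cmod_triangle. Qed.

Lemma Cmod_sub_le (x y : C) : Cmod (x - y) <= Cmod x + Cmod y.
Proof. unfold Cminus; rewrite <- (Cmod_opp y); apply Cmod_triangle. Qed.

Lemma Cmod_le_sub (x y : C) : Cmod x <= Cmod y + Cmod (x - y).
Proof. replace x with (y + (x - y))%C at 1 by ring; apply Cmod_triangle. Qed.

Lemma Cmod_small_0 (z : C) : (forall eps, 0 < eps -> Cmod z <= eps) -> z = 0%C.
Proof.
  intros H; apply Cmod_eq_0.
  destruct (Rle_lt_or_eq_dec 0 (Cmod z) (Cmod_ge_0 z)) as [Hp|]; [|congruence].
  specialize (H (Cmod z / 2)); lra.
Qed.

Lemma Re_cinner_le (x y : C) : Re x * Re y + Im x * Im y <= Cmod x * Cmod y.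
Proof.
  replace (Re x * Re y + Im x * Im y) with (Re (Cconj x * y))
    by (destruct x, y; simpl; ring).
  rewrite <- (Cmod_conj x), <- Cmod_mult; apply Re_le_Cmod.
Qed.

Lemma Re_RtoC_mul (a : R) (z : C) : Re (RtoC a * z) = a * Re z.
Proof. destruct z; simpl; ring. Qed.

Lemma Im_RtoC_mul (a : R) (z : C) : Im (RtoC a * z) = a * Im z.
Proof. destruct z; simpl; ring. Qed.

Lemma cexp_plus (x y : C) : cexp (x + y) = (cexp x * cexp y)%C.
Proof.
  destruct x as [a b], y as [c d]; unfold cexp, Re, Im; simpl.
  rewrite exp_plus, cos_plus, sin_plus.
  apply C_eq; simpl; ring.
Qed.

Lemma cexp_RtoC (t : R) : cexp (RtoC t) = RtoC (exp t).
Proof. unfold cexp, Re, Im; simpl; rewrite cos_0, sin_0; apply C_eq; simpl; ring. Qed.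

Lemma cexp_0 : cexp 0 = 1%C.
Proof. rewrite cexp_RtoC, exp_0; reflexivity. Qed.

Lemma Cmod_cexp (z : C) : Cmod (cexp z) = exp (Re z).
Proof.
  unfold cexp; rewrite Cmod_mult, Cmod_R, Rabs_pos_eq by (left; apply exp_pos).
  replace (Cmod (cos (Im z), sin (Im z))) with 1; [ring|].
  unfold Cmod; simpl.
  replace (cos (Im z) * (cos (Im z) * 1) + sin (Im z) * (sin (Im z) * 1)) with 1.
  - symmetry; apply sqrt_1.
  - pose proof (sin2_cos2 (Im z)); unfold Rsqr in *; lra.
Qed.

Lemma cexp_neq_0 (z : C) : cexp z <> 0%C.
Proof. apply Cmod_gt_0; rewrite Cmod_cexp; apply exp_pos. Qed.

Lemma cexp_conj (z : C) : cexp (Cconj z) = Cconj (cexp z).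
Proof.
  destruct z; unfold cexp, Re, Im; simpl; rewrite cos_neg, sin_neg; apply C_eq; simpl; ring.
Qed.

Lemma Re_cexp (z : C) : Re (cexp z) = exp (Re z) * cos (Im z).
Proof. unfold cexp; simpl; ring. Qed.

Lemma Im_cexp (z : C) : Im (cexp z) = exp (Re z) * sin (Im z).
Proof. unfold cexp; simpl; ring. Qed.

Lemma exp_le (x y : R) : x <= y -> exp x <= exp y.
Proof. intros [H| ->]; [left; apply exp_increasing; auto | right; auto]. Qed.

Lemma exp_pow (x : R) (k : nat) : exp x ^ k = exp (INR k * x).
Proof.
  induction k as [|k IH]; [simpl; rewrite Rmult_0_l, exp_0; auto|].
  rewrite <- tech_pow_Rmult, IH, <- exp_plus, S_INR; f_equal; ring.
Qed.

Lemma Cmod_cexp_le (z : C) : Cmod (cexp z) <= exp (Cmod z).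
Proof. rewrite Cmod_cexp; apply exp_le, Re_le_Cmod. Qed.

(** ** Real calculus *)

Lemma is_derive_eq (f : R -> R) (x l l' : R) : is_derive f x l -> l = l' -> is_derive f x l'.
Proof. intros H <-; exact H. Qed.

Lemma is_derive_continuity_pt (f : R -> R) (x l : R) : is_derive f x l -> continuity_pt f x.
Proof.
  intros H; apply derivable_continuous_pt; exists l; apply is_derive_Reals; exact H.
Qed.

Lemma mean_value (f df : R -> R) (a b : R) : a <= b ->
  (forall t, a <= t <= b -> is_derive f t (df t)) ->
  exists c, a <= c <= b /\ f b - f a = df c * (b - a).
Proof.
  intros Hab H.
  destruct (MVT_gen f a b df) as [c [Hc E]];
    rewrite ?Rmin_left, ?Rmax_right in * by lra.
  - intros x Hx; apply H; lra.
  - intros x Hx; eapply is_derive_continuity_pt, H; lra.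
  - exists c; split; [lra | exact E].
Qed.

Lemma derive_ge0_le (f df : R -> R) (a b : R) : a <= b ->
  (forall t, a <= t <= b -> is_derive f t (df t)) ->
  (forall t, a <= t <= b -> 0 <= df t) -> f a <= f b.
Proof.
  intros Hab H Hp; destruct (mean_value f df a b Hab H) as [c [Hc E]].
  specialize (Hp c Hc); nra.
Qed.

Lemma derive_le0_ge (f df : R -> R) (a b : R) : a <= b ->
  (forall t, a <= t <= b -> is_derive f t (df t)) ->
  (forall t, a <= t <= b -> df t <= 0) -> f b <= f a.
Proof.
  intros Hab H Hp; destruct (mean_value f df a b Hab H) as [c [Hc E]].
  specialize (Hp c Hc); nra.
Qed.

Lemma is_derive_plus_R (f g : R -> R) (x a b : R) :
  is_derive f x a -> is_derive g x b -> is_derive (fun t => f t + g t) x (a + b).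
Proof. intros; apply (is_derive_plus f g x a b); auto. Qed.

Lemma is_derive_minus_R (f g : R -> R) (x a b : R) :
  is_derive f x a -> is_derive g x b -> is_derive (fun t => f t - g t) x (a - b).
Proof. intros; apply (is_derive_minus f g x a b); auto. Qed.

Lemma is_derive_mult_R (f g : R -> R) (x a b : R) :
  is_derive f x a -> is_derive g x b -> is_derive (fun t => f t * g t) x (a * g x + f x * b).
Proof. intros; apply (is_derive_mult f g x a b); auto; intros; apply Rmult_comm. Qed.

Lemma is_derive_scal_R (f : R -> R) (x c a : R) :
  is_derive f x a -> is_derive (fun t => c * f t) x (c * a).
Proof. intros; apply (is_derive_scal f x c a); auto. Qed.

Lemma is_derive_const_R (c x : R) : is_derive (fun _ => c) x 0.
Proof. apply (is_derive_const c x). Qed.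

Lemma is_derive_id_R (x : R) : is_derive (fun t => t) x 1.
Proof. apply (is_derive_id x). Qed.

Lemma is_derive_exp_comp (f : R -> R) (x a : R) :
  is_derive f x a -> is_derive (fun t => exp (f t)) x (a * exp (f x)).
Proof. intros; apply (is_derive_comp exp f x (exp (f x)) a); auto; apply is_derive_exp. Qed.

Lemma is_derive_inv_R (f : R -> R) (x a : R) : f x <> 0 ->
  is_derive f x a -> is_derive (fun t => / f t) x (- a / f x ^ 2).
Proof. intros; apply is_derive_inv; auto. Qed.

Ltac der_solve :=
  lazymatch goal with
  | |- is_derive (fun _ => ?c) _ _ => apply is_derive_const_R
  | |- is_derive (fun t => t) _ _ => apply is_derive_id_R
  | |- is_derive (fun t => @?f t - @?g t) _ _ => apply (is_derive_minus_R f g); der_solve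
  | |- is_derive (fun t => @?f t + @?g t) _ _ => apply (is_derive_plus_R f g); der_solve
  | |- is_derive (fun t => @?f t * @?g t) _ _ => apply (is_derive_mult_R f g); der_solve
  | |- is_derive (fun t => exp (@?f t)) _ _ => apply (is_derive_exp_comp f); der_solve
  | |- _ => first
    [ eassumption
    | match goal with H : forall t, is_derive _ t _ |- _ => apply H end
    | match goal with H : forall t, _ -> is_derive _ t _ |- _ => apply H; lra end ]
  end.

Ltac eqR := match goal with |- @eq _ ?a ?b => change (@eq R a b) end; cbv beta.

Ltac der := eapply is_derive_eq; [der_solve | eqR].

(** ** Paths in the complex plane *)

Definition is_pderive (f : R -> C) (t : R) (l : C) : Prop :=
  is_derive (fun t => Re (f t)) t (Re l) /\ is_derive (fun t => Im (f t)) t (Im l).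

Lemma is_pderive_Cmod2 (f : R -> C) (t : R) (l : C) : is_pderive f t l ->
  is_derive (fun t => Cmod (f t) ^ 2) t (2 * (Re (f t) * Re l + Im (f t) * Im l)).
Proof.
  intros [H1 H2].
  apply is_derive_ext with (fun t => Re (f t) * Re (f t) + Im (f t) * Im (f t)).
  - intros u; eqR; rewrite Cmod2_alt; ring.
  - der; ring.
Qed.

(** A complex path has no exact mean value theorem, so the increment is projected onto the direction
    of its own error [w], where the real theorem applies; Cauchy-Schwarz then divides out |w|.
    Subtracting [c] makes the bound a first-order remainder estimate when [df] stays close to
    [c]. *)
Lemma path_mean_value (f df : R -> C) (c : C) (B : R) :
  (forall t, 0 <= t <= 1 -> is_pderive f t (df t)) ->
  (forall t, 0 <= t <= 1 -> Cmod (df t - c) <= B) ->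
  Cmod (f 1 - f 0 - c) <= B.
Proof.
  intros H HB; set (w := (f 1 - f 0 - c)%C).
  assert (HB0 : 0 <= B) by (eapply Rle_trans; [apply Cmod_ge_0 | apply (HB 0); lra]).
  destruct (mean_value
    (fun t => Re w * (Re (f t) - Re c * t) + Im w * (Im (f t) - Im c * t))
    (fun t => Re w * (Re (df t) - Re c) + Im w * (Im (df t) - Im c)) 0 1)
    as [x [Hx E]]; [lra| |].
  - intros t Ht; destruct (H t Ht) as [H1 H2]; der; cbv beta; ring.
  - pose proof (Re_cinner_le w (df x - c)) as H1.
    specialize (HB x Hx).
    assert (E2 : Cmod w ^ 2 = Re w * (Re (df x) - Re c) + Im w * (Im (df x) - Im c)).
    { rewrite Cmod2_alt.
      replace (Re w ^ 2 + Im w ^ 2) with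
       (Re w * (Re (f 1) - Re (f 0) - Re c) + Im w * (Im (f 1) - Im (f 0) - Im c)).
      - lra.
      - unfold w; destruct (f 1), (f 0), c; simpl; ring. }
    replace (Re (df x - c)) with (Re (df x) - Re c) in H1 by (destruct (df x), c; simpl; ring).
    replace (Im (df x - c)) with (Im (df x) - Im c) in H1 by (destruct (df x), c; simpl; ring).
    pose proof (Cmod_ge_0 w).
    destruct (Rle_lt_or_eq_dec 0 (Cmod w)) as [Hw|Hw]; [auto| |lra].
    apply Rmult_le_reg_l with (Cmod w); nra.
Qed.

Lemma cexp_path (z : C) (t : R) :
  is_pderive (fun t => cexp (RtoC t * z)) t (z * cexp (RtoC t * z)).
Proof.
  destruct z as [a b]; split; unfold cexp, Re, Im; simpl; auto_derive; auto; unfold Rminus; ring.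
Qed.

Lemma Cmod_cexp_sub1 (z : C) : Cmod (cexp z - 1) <= Cmod z * exp (Cmod z).
Proof.
  pose proof (path_mean_value (fun t => cexp (RtoC t * z))
     (fun t => z * cexp (RtoC t * z))%C 0 (Cmod z * exp (Cmod z))) as H.
  cbv beta in H; rewrite Cmult_1_l, Cmult_0_l, cexp_0 in H.
  replace (cexp z - 1)%C with (cexp z - 1 - 0)%C by ring.
  apply H; [intros; apply cexp_path|].
  intros t Ht; unfold Cminus; rewrite Copp_0, Cplus_0_r, Cmod_mult.
  apply Rmult_le_compat_l; [apply Cmod_ge_0|].
  eapply Rle_trans; [apply Cmod_cexp_le|apply exp_le].
  rewrite Cmod_mult, Cmod_R, Rabs_pos_eq by lra.
  pose proof (Cmod_ge_0 z); nra.
Qed.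

Lemma Cmod_cexp_sub2 (z : C) : Cmod (cexp z - 1 - z) <= Cmod z ^ 2 * exp (Cmod z).
Proof.
  pose proof (path_mean_value (fun t => cexp (RtoC t * z))
     (fun t => z * cexp (RtoC t * z))%C z (Cmod z ^ 2 * exp (Cmod z))) as H.
  cbv beta in H; rewrite Cmult_1_l, Cmult_0_l, cexp_0 in H.
  apply H; [intros; apply cexp_path|].
  intros t Ht; replace (z * cexp (RtoC t * z) - z)%C with (z * (cexp (RtoC t * z) - 1))%C by ring.
  rewrite Cmod_mult; simpl; rewrite Rmult_1_r, Rmult_assoc.
  apply Rmult_le_compat_l; [apply Cmod_ge_0|].
  eapply Rle_trans; [apply Cmod_cexp_sub1|].
  rewrite Cmod_mult, Cmod_R, Rabs_pos_eq by lra.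
  pose proof (Cmod_ge_0 z).
  apply Rmult_le_compat; try nra; [left; apply exp_pos | apply exp_le; nra].
Qed.

(** ** Complex derivatives *)

(** Multiplied-out form: h = 0 needs no exception, and the errors of several functions add up by the
    triangle inequality. *)
Definition is_cderive (f : C -> C) (s l : C) : Prop :=
  forall eps, 0 < eps -> exists d, 0 < d /\
    forall h, Cmod h < d -> Cmod (f (s + h) - f s - l * h)%C <= eps * Cmod h.

Lemma is_cderive_eq (f : C -> C) (s l l' : C) : is_cderive f s l -> l = l' -> is_cderive f s l'.
Proof. intros H <-; exact H. Qed.

Lemma is_cderive_const (c s : C) : is_cderive (fun _ => c) s 0.
Proof.
  intros eps He; exists 1; split; [lra|]; intros h _.
  replace (c - c - 0 * h)%C with (RtoC 0) by ring.
  rewrite Cmod_0; pose proof (Cmod_ge_0 h); nra.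
Qed.

Lemma is_cderive_id (s : C) : is_cderive (fun s => s) s 1.
Proof.
  intros eps He; exists 1; split; [lra|]; intros h _.
  replace (s + h - s - 1 * h)%C with (RtoC 0) by ring.
  rewrite Cmod_0; pose proof (Cmod_ge_0 h); nra.
Qed.

Lemma is_cderive_plus (f g : C -> C) (s a b : C) : is_cderive f s a -> is_cderive g s b ->
  is_cderive (fun s => f s + g s)%C s (a + b).
Proof.
  intros Hf Hg eps He.
  destruct (Hf (eps / 2)) as [d1 [P1 D1]]; [lra|].
  destruct (Hg (eps / 2)) as [d2 [P2 D2]]; [lra|].
  exists (Rmin d1 d2); split; [apply Rmin_pos; auto|]; intros h Hh.
  pose proof (D1 h (Rlt_le_trans _ _ _ Hh (Rmin_l _ _))).
  pose proof (D2 h (Rlt_le_trans _ _ _ Hh (Rmin_r _ _))).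
  replace (f (s + h) + g (s + h) - (f s + g s) - (a + b) * h)%C with
    ((f (s + h) - f s - a * h) + (g (s + h) - g s - b * h))%C by ring.
  eapply Rle_trans; [apply Cmod_triangle|lra].
Qed.

Lemma is_cderive_scal (c : C) (f : C -> C) (s a : C) : is_cderive f s a ->
  is_cderive (fun s => c * f s)%C s (c * a).
Proof.
  intros Hf eps He; pose proof (Cmod_ge_0 c).
  destruct (Hf (eps / (Cmod c + 1))) as [d [P D]]; [apply Rdiv_lt_0_compat; lra|].
  exists d; split; auto; intros h Hh; specialize (D h Hh).
  replace (c * f (s + h) - c * f s - c * a * h)%C with (c * (f (s + h) - f s - a * h))%C by ring.
  rewrite Cmod_mult.
  apply Rle_trans with (Cmod c * (eps / (Cmod c + 1) * Cmod h)).
  - apply Rmult_le_compat_l; auto.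
  - replace (Cmod c * (eps / (Cmod c + 1) * Cmod h))
      with (Cmod c / (Cmod c + 1) * (eps * Cmod h)) by (field; lra).
    pose proof (Cmod_ge_0 h).
    assert (Cmod c / (Cmod c + 1) <= 1) by (apply Rle_div_l; lra).
    assert (0 <= eps * Cmod h) by nra. nra.
Qed.

Lemma is_cderive_minus (f g : C -> C) (s a b : C) : is_cderive f s a -> is_cderive g s b ->
  is_cderive (fun s => f s - g s)%C s (a - b).
Proof.
  intros Hf Hg; apply (is_cderive_scal (-1)) in Hg.
  pose proof (is_cderive_plus _ _ _ _ _ Hf Hg) as H.
  intros eps He; destruct (H eps He) as [d [P D]]; exists d; split; auto.
  intros h Hh; specialize (D h Hh); simpl in D.
  match type of D with Cmod ?x <= _ => match goal with |- Cmod ?y <= _ =>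
    replace y with x by (cbv beta; ring) end end; auto.
Qed.

Lemma is_cderive_shift (f : C -> C) (s c l : C) : is_cderive f (s + c) l ->
  is_cderive (fun s => f (s + c)%C) s l.
Proof.
  intros H eps He; destruct (H eps He) as [d [P D]]; exists d; split; auto.
  intros h Hh; specialize (D h Hh).
  replace (s + h + c)%C with (s + c + h)%C by ring; auto.
Qed.

Lemma is_cderive_conj (f : C -> C) (s l : C) : is_cderive f (Cconj s) l ->
  is_cderive (fun s => Cconj (f (Cconj s))) s (Cconj l).
Proof.
  intros H eps He; destruct (H eps He) as [d [P D]]; exists d; split; auto.
  intros h Hh; specialize (D (Cconj h)); rewrite Cmod_conj in D; specialize (D Hh).
  rewrite <- Cmod_conj, Cplus_conj, !Cminus_conj, Cmult_conj, !Cconj_conj; auto.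
Qed.

Lemma is_cderive_lipschitz (f : C -> C) (s l : C) : is_cderive f s l ->
  exists d, 0 < d /\ forall h, Cmod h < d -> Cmod (f (s + h) - f s)%C <= (Cmod l + 1) * Cmod h.
Proof.
  intros H; destruct (H 1) as [d [P D]]; [lra|]; exists d; split; auto; intros h Hh.
  specialize (D h Hh).
  replace (f (s + h) - f s)%C with ((f (s + h) - f s - l * h) + l * h)%C by ring.
  eapply Rle_trans; [apply Cmod_triangle|]; rewrite Cmod_mult; lra.
Qed.

Lemma is_cderive_continuous (f : C -> C) (s l : C) : is_cderive f s l ->
  forall eps, 0 < eps -> exists d, 0 < d /\ forall u, Cmod (u - s) < d -> Cmod (f u - f s) < eps.
Proof.
  intros H eps He; destruct (is_cderive_lipschitz f s l H) as [d [P D]].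
  pose proof (Cmod_ge_0 l).
  exists (Rmin d (eps / (Cmod l + 1))); split.
  - apply Rmin_pos; auto; apply Rdiv_lt_0_compat; lra.
  - intros u Hu; specialize (D (u - s)%C (Rlt_le_trans _ _ _ Hu (Rmin_l _ _))).
    replace (s + (u - s))%C with u in D by ring.
    eapply Rle_lt_trans; [apply D|].
    pose proof (Rlt_le_trans _ _ _ Hu (Rmin_r _ _)) as Hu2.
    apply Rlt_div_r in Hu2; lra.
Qed.

Lemma is_cderive_comp (f g : C -> C) (s a b : C) : is_cderive g s b -> is_cderive f (g s) a ->
  is_cderive (fun s => f (g s)) s (a * b).
Proof.
  intros Hg Hf eps He; pose proof (Cmod_ge_0 a); pose proof (Cmod_ge_0 b).
  destruct (is_cderive_lipschitz g s b Hg) as [d1 [P1 D1]].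
  destruct (Hf (eps / (2 * (Cmod b + 1)))) as [d2 [P2 D2]]; [apply Rdiv_lt_0_compat; lra|].
  destruct (Hg (eps / (2 * (Cmod a + 1)))) as [d3 [P3 D3]]; [apply Rdiv_lt_0_compat; lra|].
  exists (Rmin (Rmin d1 d3) (d2 / (Cmod b + 1))); split.
  { repeat apply Rmin_pos; auto; apply Rdiv_lt_0_compat; lra. }
  intros h Hh.
  pose proof (Rlt_le_trans _ _ _ Hh (Rmin_r _ _)) as H2.
  pose proof (Rlt_le_trans _ _ _ Hh (Rmin_l _ _)) as H1.
  pose proof (D1 h (Rlt_le_trans _ _ _ H1 (Rmin_l _ _))) as E1.
  pose proof (D3 h (Rlt_le_trans _ _ _ H1 (Rmin_r _ _))) as E3.
  apply Rlt_div_r in H2; [|lra].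
  assert (E2 : Cmod (g (s + h) - g s)%C < d2) by lra.
  specialize (D2 _ E2).
  replace (g s + (g (s + h) - g s))%C with (g (s + h)%C) in D2 by ring.
  replace (f (g (s + h)%C) - f (g s) - a * b * h)%C with
   ((f (g (s + h)%C) - f (g s) - a * (g (s + h) - g s)) + a * (g (s + h) - g s - b * h))%C by ring.
  eapply Rle_trans; [apply Cmod_triangle|]; rewrite Cmod_mult.
  pose proof (Cmod_ge_0 h).
  assert (A1 : eps / (2 * (Cmod b + 1)) * Cmod (g (s + h) - g s)%C <= eps / 2 * Cmod h).
  { apply Rle_trans with (eps / (2 * (Cmod b + 1)) * ((Cmod b + 1) * Cmod h)).
    - apply Rmult_le_compat_l; auto; apply Rlt_le, Rdiv_lt_0_compat; lra.
    - right; field; lra. }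
  assert (A2 : Cmod a * Cmod (g (s + h) - g s - b * h)%C <= eps / 2 * Cmod h).
  { apply Rle_trans with ((Cmod a + 1) * (eps / (2 * (Cmod a + 1)) * Cmod h)).
    - apply Rmult_le_compat; auto; try lra; apply Cmod_ge_0.
    - right; field; lra. }
  lra.
Qed.

Lemma is_cderive_cexp (s : C) : is_cderive cexp s (cexp s).
Proof.
  intros eps He; set (M := Cmod (cexp s) * exp 1).
  assert (HM : 0 < M) by (unfold M; rewrite Cmod_cexp; apply Rmult_lt_0_compat; apply exp_pos).
  exists (Rmin 1 (eps / M)); split.
  { apply Rmin_pos; [lra|]; apply Rdiv_lt_0_compat; lra. }
  intros h Hh.
  pose proof (Rlt_le_trans _ _ _ Hh (Rmin_l _ _)) as H1.
  pose proof (Rlt_le_trans _ _ _ Hh (Rmin_r _ _)) as H2.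
  apply Rlt_div_r in H2; auto.
  rewrite cexp_plus.
  replace (cexp s * cexp h - cexp s - cexp s * h)%C with (cexp s * (cexp h - 1 - h))%C by ring.
  rewrite Cmod_mult; pose proof (Cmod_cexp_sub2 h); pose proof (Cmod_ge_0 h).
  assert (exp (Cmod h) <= exp 1) by (apply exp_le; lra).
  pose proof (Cmod_ge_0 (cexp s)).
  apply Rle_trans with (Cmod (cexp s) * (Cmod h ^ 2 * exp 1)).
  - apply Rmult_le_compat_l; auto; eapply Rle_trans; [eassumption|].
    apply Rmult_le_compat_l; auto; apply pow2_ge_0.
  - replace (Cmod (cexp s) * (Cmod h ^ 2 * exp 1)) with (Cmod h * M * Cmod h) by (unfold M; ring).
    apply Rmult_le_compat_r; lra.
Qed.

(** Restriction to a straight line is how real mean value theorems and real differential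
    inequalities reach holomorphic functions. *)
Lemma is_cderive_path (f : C -> C) (p q l : C) (t : R) : is_cderive f (p + RtoC t * q) l ->
  is_pderive (fun t => f (p + RtoC t * q)%C) t (l * q).
Proof.
  intros H.
  assert (K : forall eps : posreal, exists d : posreal, forall h : R, h <> 0 -> Rabs h < d ->
    Cmod ((f (p + RtoC (t + h) * q) - f (p + RtoC t * q)) / RtoC h - l * q)%C < eps).
  { intros [eps He]; simpl; pose proof (Cmod_ge_0 q).
    destruct (H (eps / (2 * (Cmod q + 1)))) as [d [P D]]; [apply Rdiv_lt_0_compat; lra|].
    assert (Hd : 0 < d / (Cmod q + 1)) by (apply Rdiv_lt_0_compat; lra).
    exists (mkposreal _ Hd); simpl; intros h Hh0 Hh.
    apply Rlt_div_r in Hh; [|lra].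
    assert (Hh' : RtoC h <> 0%C) by (intros E; injection E; auto).
    assert (Hp : 0 < Rabs h) by (apply Rabs_pos_lt; auto).
    specialize (D (RtoC h * q)%C); rewrite Cmod_mult, Cmod_R in D.
    assert (B : Rabs h * Cmod q < d) by nra.
    specialize (D B).
    replace (p + RtoC t * q + RtoC h * q)%C with (p + RtoC (t + h) * q)%C in D
      by (rewrite RtoC_plus; ring).
    replace ((f (p + RtoC (t + h) * q) - f (p + RtoC t * q)) / RtoC h - l * q)%C with
      ((f (p + RtoC (t + h) * q) - f (p + RtoC t * q) - l * (RtoC h * q)) / RtoC h)%C
      by (field; auto).
    rewrite Cmod_div, Cmod_R by auto.
    apply Rlt_div_l; auto.
    eapply Rle_lt_trans; [apply D|].
    replace (eps / (2 * (Cmod q + 1)) * (Rabs h * Cmod q)) with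
      (eps * Rabs h * (Cmod q / (2 * (Cmod q + 1)))) by (field; lra).
    rewrite <- (Rmult_1_r (eps * Rabs h)) at 2.
    apply Rmult_lt_compat_l; [nra|]; apply Rlt_div_l; lra. }
  assert (Q : forall (w : C) (h : R), h <> 0 -> (w / RtoC h)%C = (Re w / h, Im w / h)).
  { intros [a b] h Hh; unfold Cdiv, Cinv, Cmult, RtoC; simpl; f_equal; field; auto. }
  split; apply is_derive_Reals; intros eps He; destruct (K (mkposreal eps He)) as [d D];
    exists d; intros h Hh0 Hh; eapply Rle_lt_trans; [|apply (D h Hh0 Hh)| |apply (D h Hh0 Hh)];
    rewrite Q by auto.
  - eapply Rle_trans; [|apply re_le_Cmod]; right; f_equal.
  - eapply Rle_trans; [|apply im_le_Cmod]; right; f_equal.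
Qed.

Lemma complex_mean_value (f df : C -> C) (s h c : C) (B : R) :
  (forall u, is_cderive f u (df u)) ->
  (forall t, 0 <= t <= 1 -> Cmod (df (s + RtoC t * h)%C - c) <= B) ->
  Cmod (f (s + h) - f s - c * h)%C <= B * Cmod h.
Proof.
  intros H HB.
  pose proof (path_mean_value (fun t => f (s + RtoC t * h)%C)
    (fun t => df (s + RtoC t * h)%C * h)%C (c * h)%C (B * Cmod h)) as M.
  cbv beta in M.
  replace (s + RtoC 1 * h)%C with (s + h)%C in M by ring.
  replace (s + RtoC 0 * h)%C with s in M by ring.
  apply M.
  - intros t _; apply is_cderive_path, H.
  - intros t Ht.
    replace (df (s + RtoC t * h)%C * h - c * h)%C with ((df (s + RtoC t * h)%C - c) * h)%C by ring.
    rewrite Cmod_mult; apply Rmult_le_compat_r; [apply Cmod_ge_0 | auto].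
Qed.

(** The mean value inequality for [F i - F N] bounds difference quotients uniformly in i, because
    the derivatives are uniformly close on a disc containing the segment. A large i then transfers
    the estimate from [F N] to the limit [G]. *)
Lemma is_cderive_limit (F f : nat -> C -> C) (G g : C -> C) :
  (forall j s, is_cderive (F j) s (f j s)) ->
  (forall s eps, 0 < eps -> exists N, forall j, (N <= j)%nat -> Cmod (F j s - G s) <= eps) ->
  (forall T eps, 0 < eps -> exists N, forall j s, (N <= j)%nat -> Cmod s <= T ->
     Cmod (f j s - g s) <= eps) ->
  forall s, is_cderive G s (g s).
Proof.
  intros HF Hlim Hunif s eps He.
  destruct (Hunif (Cmod s + 1) (eps / 8)) as [N HN]; [lra|].
  destruct (HF N s (eps / 8)) as [d [P D]]; [lra|].
  exists (Rmin d 1); split; [apply Rmin_pos; lra|]; intros h Hh.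
  pose proof (Rlt_le_trans _ _ _ Hh (Rmin_l _ _)) as H1.
  pose proof (Rlt_le_trans _ _ _ Hh (Rmin_r _ _)) as H2.
  specialize (D h H1).
  destruct (Req_dec (Cmod h) 0) as [Z|Z].
  { apply Cmod_eq_0 in Z; subst h; rewrite Cplus_0_r.
    replace (G s - G s - g s * 0)%C with (RtoC 0) by ring.
    rewrite !Cmod_0; lra. }
  pose proof (Cmod_ge_0 h).
  (* The index i may depend on h, so the errors of [F i] at both endpoints can be made small
     relative to |h|; N was fixed before h. *)
  assert (Hp : 0 < eps / 8 * Cmod h) by nra.
  destruct (Hlim s _ Hp) as [N1 L1]; destruct (Hlim (s + h)%C _ Hp) as [N2 L2].
  set (i := max N (max N1 N2)).
  assert (Hi : (N <= i)%nat) by (unfold i; lia).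
  specialize (L1 i ltac:(unfold i; lia)); specialize (L2 i ltac:(unfold i; lia)).
  assert (HS : forall t, 0 <= t <= 1 -> Cmod (s + RtoC t * h) <= Cmod s + 1).
  { intros t Ht; eapply Rle_trans; [apply Cmod_triangle|]; rewrite Cmod_mult, Cmod_R, Rabs_pos_eq by lra.
    nra. }
  pose proof (complex_mean_value (fun u => F i u - F N u)%C (fun u => f i u - f N u)%C s h 0
    (eps / 4) (fun u => is_cderive_minus _ _ _ _ _ (HF i u) (HF N u))) as M; cbv beta in M.
  assert (M' := M ltac:(intros t Ht; unfold Cminus at 1; rewrite Copp_0, Cplus_0_r;
    eapply Rle_trans; [apply (Cmod_sub_triangle _ (g (s + RtoC t * h)%C))|];
    rewrite (Cmod_sub_sym (g _)); pose proof (HN i _ Hi (HS t Ht));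
    pose proof (HN N _ (le_n _) (HS t Ht)); lra)); clear M.
  pose proof (HN N s (le_n _) ltac:(lra)) as HNs.
  replace (G (s + h) - G s - g s * h)%C with
    ((F N (s + h) - F N s - f N s * h) + (F i (s + h) - F N (s + h) - (F i s - F N s) - 0 * h)
     - (F i (s + h) - G (s + h)) + (F i s - G s) + (f N s - g s) * h)%C by ring.
  eapply Rle_trans; [apply Cmod_triangle|]; rewrite Cmod_mult.
  eapply Rle_trans; [apply Rplus_le_compat_r, Cmod_triangle|].
  eapply Rle_trans; [apply Rplus_le_compat_r, Rplus_le_compat_r, Cmod_sub_le|].
  eapply Rle_trans; [do 3 apply Rplus_le_compat_r; apply Cmod_triangle|].
  assert (Cmod (f N s - g s) * Cmod h <= eps / 8 * Cmod h) by (apply Rmult_le_compat_r; auto).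
  lra.
Qed.

(** * The equation f'' = (e^(2s) + nu^2) f *)

(* The modified Bessel equation in the variable s = log z; its solutions are entire in s. *)
Definition is_bessel (nu : R) (f f1 : C -> C) : Prop := forall s,
  is_cderive f s (f1 s) /\
  is_cderive f1 s ((cexp (2 * s) + RtoC (nu ^ 2)) * f s)%C.

(** The quantity (E + D/c) exp(-c t) does not increase; c >= 1 allows D/c to be replaced by D. *)
Lemma gronwall (E dE : R -> R) (c D : R) : 1 <= c -> 0 <= D ->
  (forall t, 0 <= t <= 1 -> is_derive E t (dE t)) ->
  (forall t, 0 <= t <= 1 -> dE t <= c * E t + D) ->
  E 1 <= (E 0 + D) * exp c.
Proof.
  intros Hc HD HE Hb.
  assert (M : (E 1 + D / c) * exp (- c * 1) <= (E 0 + D / c) * exp (- c * 0)).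
  { apply (derive_le0_ge (fun t => (E t + D / c) * exp (- c * t))
      (fun t => (dE t - c * E t - D) * exp (- c * t))); [lra| |].
    - intros t Ht; der; field; lra.
    - intros t Ht; specialize (Hb t Ht); pose proof (exp_pos (- c * t)); nra. }
  rewrite Rmult_0_r, exp_0, !Rmult_1_r in M.
  apply Rmult_le_compat_r with (r := exp c) in M; [|left; apply exp_pos].
  rewrite Rmult_assoc, <- exp_plus in M.
  replace (- c + c) with 0 in M by ring; rewrite exp_0, Rmult_1_r in M.
  assert (0 <= D / c) by (apply Rdiv_le_0_compat; lra).
  assert (D / c <= D) by (apply Rle_div_l; nra).
  pose proof (exp_pos c); nra.
Qed.

(** The energy |f|^2 + |f1|^2 is differentiated along the ray from 0 to s, mixed products are
    absorbed into squares, and Gronwall applies. The forcing term [r] serves differences of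
    solutions of two orders. *)
Lemma linear_growth (f f1 Q r : C -> C) (T c rho : R) :
  0 <= c -> 1 <= T ->
  (forall s, is_cderive f s (f1 s) /\ is_cderive f1 s (Q s * f s + r s)%C) ->
  (forall s, Cmod s <= T -> Cmod (Q s) <= c) ->
  (forall s, Cmod s <= T -> Cmod (r s) <= rho) ->
  forall s, Cmod s <= T ->
  Cmod (f s) ^ 2 + Cmod (f1 s) ^ 2 <=
    (Cmod (f 0%C) ^ 2 + Cmod (f1 0%C) ^ 2 + T * rho ^ 2) * exp (T * (2 + c)).
Proof.
  intros Hc HT Hf HQ Hr s Hs.
  set (E := fun t => Cmod (f (0 + RtoC t * s)%C) ^ 2 + Cmod (f1 (0 + RtoC t * s)%C) ^ 2).
  assert (HE : E 1 <= (E 0 + T * rho ^ 2) * exp (T * (2 + c))).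
  { set (ip := fun x y : C => Re x * Re y + Im x * Im y).
    apply (gronwall E (fun t => let u := (0 + RtoC t * s)%C in
       2 * ip (f u) (f1 u * s)%C + 2 * ip (f1 u) ((Q u * f u + r u) * s)%C)).
    - nra.
    - pose proof (pow2_ge_0 rho); nra.
    - intros t Ht; cbv zeta; apply is_derive_plus_R.
      + apply (is_pderive_Cmod2 (fun t => f (0 + RtoC t * s)%C)), is_cderive_path, Hf.
      + apply (is_pderive_Cmod2 (fun t => f1 (0 + RtoC t * s)%C)), is_cderive_path, Hf.
    - intros t Ht; cbv zeta.
      assert (Hu : Cmod (0 + RtoC t * s)%C <= T).
      { rewrite Cplus_0_l, Cmod_mult, Cmod_R, Rabs_pos_eq by lra; pose proof (Cmod_ge_0 s); nra. }
      unfold E; set (u := (0 + RtoC t * s)%C) in *.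
      pose proof (Re_cinner_le (f u) (f1 u * s)%C) as G1.
      pose proof (Re_cinner_le (f1 u) ((Q u * f u + r u) * s)%C) as G2.
      fold (ip (f u) (f1 u * s)%C) in G1; fold (ip (f1 u) ((Q u * f u + r u) * s)%C) in G2.
      rewrite Cmod_mult in G1, G2.
      pose proof (Cmod_ge_0 (f u)); pose proof (Cmod_ge_0 (f1 u)); pose proof (Cmod_ge_0 s).
      assert (G3 : Cmod (Q u * f u + r u)%C <= c * Cmod (f u) + rho).
      { eapply Rle_trans; [apply Cmod_triangle|]; rewrite Cmod_mult.
        specialize (HQ u Hu); specialize (Hr u Hu); nra. }
      set (x := Cmod (f u)) in *; set (y := Cmod (f1 u)) in *; set (m := Cmod s) in *.
      assert (G4 : x * (y * m) <= T * (x * y)).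
      { replace (x * (y * m)) with (m * (x * y)) by ring.
        apply Rmult_le_compat_r; [apply Rmult_le_pos|]; assumption. }
      pose proof (Cmod_ge_0 (Q u * f u + r u)%C).
      assert (Hrho : 0 <= rho) by (eapply Rle_trans; [apply Cmod_ge_0 | apply (Hr u Hu)]).
      assert (G5 : Cmod (Q u * f u + r u) * m <= (c * x + rho) * T)
        by (apply Rmult_le_compat; auto).
      assert (G6 : y * (Cmod (Q u * f u + r u) * m) <= y * ((c * x + rho) * T))
        by (apply Rmult_le_compat_l; auto).
      assert (G7 : 0 <= T * (1 + c)) by nra.
      pose proof (Rmult_le_pos _ _ G7 (pow2_ge_0 (x - y))).
      assert (G8 : 0 <= T) by lra.
      pose proof (Rmult_le_pos _ _ G8 (pow2_ge_0 (y - rho))).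
      pose proof (Rmult_le_pos _ _ G8 (pow2_ge_0 x)).
      nra. }
  unfold E in HE; rewrite !Cplus_0_l, Cmult_1_l, Cmult_0_l in HE; exact HE.
Qed.

Lemma Cmod_coeff_le (nu N T : R) (s : C) : Rabs nu <= N -> Cmod s <= T ->
  Cmod (cexp (2 * s) + RtoC (nu ^ 2))%C <= exp (2 * T) + N ^ 2.
Proof.
  intros Hn Hs; eapply Rle_trans; [apply Cmod_triangle|].
  rewrite Cmod_R; apply Rplus_le_compat.
  - eapply Rle_trans; [apply Cmod_cexp_le|apply exp_le]; rewrite Cmod_mult, Cmod_R, Rabs_pos_eq; lra.
  - rewrite <- RPow_abs; apply pow_incr; split; [apply Rabs_pos | auto].
Qed.

Lemma bessel_growth (nu N T : R) (f f1 : C -> C) : Rabs nu <= N -> 1 <= T -> is_bessel nu f f1 ->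
  forall s, Cmod s <= T ->
  Cmod (f s) ^ 2 + Cmod (f1 s) ^ 2 <=
    (Cmod (f 0%C) ^ 2 + Cmod (f1 0%C) ^ 2) * exp (T * (2 + (exp (2 * T) + N ^ 2))).
Proof.
  intros Hn HT Hf s Hs.
  pose proof (linear_growth f f1 (fun s => cexp (2 * s) + RtoC (nu ^ 2))%C (fun _ => 0%C)
    T (exp (2 * T) + N ^ 2) 0) as H.
  rewrite (pow_i 2), Rmult_0_r, Rplus_0_r in H by lia; apply H; auto.
  - pose proof (exp_pos (2 * T)); pose proof (pow2_ge_0 N); lra.
  - intros u; split; [apply Hf|].
    eapply is_cderive_eq; [apply Hf | ring].
  - intros u Hu; apply Cmod_coeff_le; auto.
  - intros u _; rewrite Cmod_0; lra.
Qed.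

(** The difference f - g solves the equation of order nu with forcing (nu^2 - mu^2) g, and g is
    bounded through its initial values. K depends on T and N alone, so the estimate is uniform over
    bounded orders and data. *)
Lemma bessel_continuity (T N : R) : 1 <= T -> 0 <= N -> exists K, 0 < K /\
  forall (nu mu : R) (f f1 g g1 : C -> C),
  Rabs nu <= N -> Rabs mu <= N -> is_bessel nu f f1 -> is_bessel mu g g1 ->
  Cmod (g 0%C) ^ 2 + Cmod (g1 0%C) ^ 2 <= N ->
  forall s, Cmod s <= T ->
  Cmod (f s - g s)%C ^ 2 + Cmod (f1 s - g1 s)%C ^ 2 <=
  K * (Cmod (f 0%C - g 0%C)%C ^ 2 + Cmod (f1 0%C - g1 0%C)%C ^ 2 + (nu - mu) ^ 2).
Proof.
  intros HT HN.
  set (e := exp (T * (2 + (exp (2 * T) + N ^ 2)))).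
  assert (He : 0 < e) by apply exp_pos.
  exists ((1 + T * (4 * N ^ 2 * (N * e))) * e); split.
  { apply Rmult_lt_0_compat; auto.
    assert (0 <= N ^ 2 * (N * e)) by (apply Rmult_le_pos; [apply pow2_ge_0 | nra]). nra. }
  intros nu mu f f1 g g1 Hnu Hmu Hf Hg Hg0 s Hs.
  set (rho := Rabs (nu ^ 2 - mu ^ 2) * sqrt (N * e)).
  assert (Hrho : rho ^ 2 <= 4 * N ^ 2 * (N * e) * (nu - mu) ^ 2).
  { unfold rho; rewrite Rpow_mult_distr, pow2_abs, pow2_sqrt by nra.
    replace (nu ^ 2 - mu ^ 2) with ((nu + mu) * (nu - mu)) by ring.
    rewrite Rpow_mult_distr.
    replace (4 * N ^ 2 * (N * e) * (nu - mu) ^ 2)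
      with (4 * N ^ 2 * (nu - mu) ^ 2 * (N * e)) by ring.
    apply Rmult_le_compat_r; [nra|]; apply Rmult_le_compat_r; [apply pow2_ge_0|].
    apply Rabs_le_between in Hnu; apply Rabs_le_between in Hmu; nra. }
  pose proof (linear_growth (fun s => f s - g s)%C (fun s => f1 s - g1 s)%C
    (fun s => cexp (2 * s) + RtoC (nu ^ 2))%C (fun s => RtoC (nu ^ 2 - mu ^ 2) * g s)%C
    T (exp (2 * T) + N ^ 2) rho) as H.
  eapply Rle_trans; [apply H; auto|].
  - pose proof (exp_pos (2 * T)); pose proof (pow2_ge_0 N); lra.
  - intros u; destruct (Hf u), (Hg u); split; [apply is_cderive_minus; auto|].
    eapply is_cderive_eq; [apply is_cderive_minus; eassumption|].
    rewrite RtoC_minus; ring.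
  - intros u Hu; apply Cmod_coeff_le; auto.
  - intros u Hu; rewrite Cmod_mult, Cmod_R; apply Rmult_le_compat_l; [apply Rabs_pos|].
    rewrite <- (sqrt_pow2 (Cmod (g u))) by apply Cmod_ge_0; apply sqrt_le_1_alt.
    pose proof (bessel_growth mu N T g g1 Hmu HT Hg u Hu) as B; fold e in B.
    pose proof (pow2_ge_0 (Cmod (g1 u))); nra.
  - fold e.
    set (A := Cmod (f 0%C - g 0%C)%C ^ 2); set (B := Cmod (f1 0%C - g1 0%C)%C ^ 2).
    assert (0 <= A) by apply pow2_ge_0; assert (0 <= B) by apply pow2_ge_0.
    replace ((1 + T * (4 * N ^ 2 * (N * e))) * e * (A + B + (nu - mu) ^ 2))
      with ((1 + T * (4 * N ^ 2 * (N * e))) * (A + B + (nu - mu) ^ 2) * e) by ring.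
    apply Rmult_le_compat_r; [lra|].
    set (P := 4 * N ^ 2 * (N * e)) in *.
    assert (0 <= P) by (unfold P; assert (0 <= N ^ 2 * (N * e))
       by (apply Rmult_le_pos; [apply pow2_ge_0 | nra]); nra).
    pose proof (pow2_ge_0 (nu - mu)).
    assert (T * rho ^ 2 <= T * (P * (nu - mu) ^ 2)) by (apply Rmult_le_compat_l; lra).
    assert (0 <= T * P) by nra. nra.
Qed.

Lemma bessel_unique (nu : R) (f f1 g g1 : C -> C) : is_bessel nu f f1 -> is_bessel nu g g1 ->
  f 0%C = g 0%C -> f1 0%C = g1 0%C -> forall s, f s = g s /\ f1 s = g1 s.
Proof.
  intros Hf Hg E0 E1 s.
  set (N := Rabs nu + (Cmod (g 0%C) ^ 2 + Cmod (g1 0%C) ^ 2)).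
  assert (0 <= Cmod (g 0%C) ^ 2 + Cmod (g1 0%C) ^ 2) by
    (pose proof (pow2_ge_0 (Cmod (g 0%C))); pose proof (pow2_ge_0 (Cmod (g1 0%C))); lra).
  pose proof (Rabs_pos nu); pose proof (Cmod_ge_0 s).
  destruct (bessel_continuity (Cmod s + 1) N) as [K [HK H2]]; [lra|unfold N; lra|].
  specialize (H2 nu nu f f1 g g1).
  assert (H3 := H2 ltac:(unfold N; lra) ltac:(unfold N; lra) Hf Hg ltac:(unfold N; lra) s ltac:(lra)).
  rewrite E0, E1 in H3.
  replace (g 0%C - g 0%C)%C with (RtoC 0) in H3 by ring.
  replace (g1 0%C - g1 0%C)%C with (RtoC 0) in H3 by ring.
  rewrite Cmod_0 in H3; replace (nu - nu) with 0 in H3 by ring.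
  pose proof (Cmod_ge_0 (f s - g s)); pose proof (Cmod_ge_0 (f1 s - g1 s)).
  assert (A : Cmod (f s - g s) = 0) by nra. assert (B : Cmod (f1 s - g1 s) = 0) by nra.
  apply Cmod_eq_0 in A; apply Cmod_eq_0 in B; split.
  - replace (f s) with (f s - g s + g s)%C by ring; rewrite A; ring.
  - replace (f1 s) with (f1 s - g1 s + g1 s)%C by ring; rewrite B; ring.
Qed.

Lemma is_bessel_plus (nu : R) (f f1 g g1 : C -> C) : is_bessel nu f f1 -> is_bessel nu g g1 ->
  is_bessel nu (fun s => f s + g s)%C (fun s => f1 s + g1 s)%C.
Proof.
  intros Hf Hg s; destruct (Hf s), (Hg s); split; [apply is_cderive_plus; auto|].
  eapply is_cderive_eq; [apply is_cderive_plus; eassumption | ring].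
Qed.

Lemma is_bessel_scal (nu : R) (c : C) (f f1 : C -> C) : is_bessel nu f f1 ->
  is_bessel nu (fun s => c * f s)%C (fun s => c * f1 s)%C.
Proof.
  intros Hf s; destruct (Hf s); split; [apply is_cderive_scal; auto|].
  eapply is_cderive_eq; [apply is_cderive_scal; eassumption | ring].
Qed.

Lemma is_bessel_conj (nu : R) (f f1 : C -> C) : is_bessel nu f f1 ->
  is_bessel nu (fun s => Cconj (f (Cconj s))) (fun s => Cconj (f1 (Cconj s))).
Proof.
  intros Hf s; destruct (Hf (Cconj s)); split; [apply is_cderive_conj; auto|].
  eapply is_cderive_eq; [apply is_cderive_conj; eassumption|].
  rewrite Cmult_conj, Cplus_conj, <- cexp_conj, Cmult_conj, Cconj_conj.
  f_equal; f_equal; [f_equal; f_equal|]; apply C_eq; simpl; ring.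
Qed.

(** Reflection principle: the conjugate of f(conj s) solves the same equation with the same real
    initial values. *)
Lemma bessel_real (nu : R) (f f1 : C -> C) : is_bessel nu f f1 ->
  Im (f 0%C) = 0 -> Im (f1 0%C) = 0 ->
  forall s, f (Cconj s) = Cconj (f s) /\ f1 (Cconj s) = Cconj (f1 s).
Proof.
  intros Hf I0 I1 s.
  assert (Z : Cconj 0 = 0%C) by (apply C_eq; simpl; ring).
  destruct (bessel_unique nu _ _ _ _ Hf (is_bessel_conj _ _ _ Hf)) with (s := Cconj s) as [A B].
  - rewrite Z; apply C_eq; [rewrite re_conj | rewrite im_conj]; lra.
  - rewrite Z; apply C_eq; [rewrite re_conj | rewrite im_conj]; lra.
  - rewrite Cconj_conj in A, B; auto.
Qed.

(** ** Limits of solutions *)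

Definition Cconverges (u : nat -> C) (l : C) : Prop :=
  forall eps, 0 < eps -> exists N, forall j, (N <= j)%nat -> Cmod (u j - l)%C <= eps.

Lemma Ccauchy_converges (u : nat -> C) :
  (forall eps, 0 < eps -> exists N, forall i j, (N <= i)%nat -> (N <= j)%nat ->
     Cmod (u i - u j)%C <= eps) -> exists l, Cconverges u l.
Proof.
  intros H.
  assert (A : forall p : C -> R, (forall x y, Rabs (p x - p y) <= Cmod (x - y)%C) ->
    exists l, forall eps, 0 < eps -> exists N, forall j, (N <= j)%nat -> Rabs (p (u j) - l) <= eps).
  { intros p Hp; destruct (Rcomplete.R_complete (fun j => p (u j))) as [l Hl].
    - intros eps He; destruct (H (eps / 2)) as [N HN]; [lra|]; exists N; intros i j Hi Hj.
      unfold R_dist; eapply Rle_lt_trans; [apply Hp|]; specialize (HN i j Hi Hj); lra.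
    - exists l; intros eps He; destruct (Hl eps He) as [N HN]; exists N; intros j Hj.
      left; apply HN; auto. }
  destruct (A Re) as [a Ha].
  { intros x y; eapply Rle_trans; [|apply re_le_Cmod]; right; f_equal. }
  destruct (A Im) as [b Hb].
  { intros x y; eapply Rle_trans; [|apply im_le_Cmod]; right; f_equal. }
  exists (a, b); intros eps He.
  destruct (Ha (eps / 2)) as [N1 H1]; [lra|]; destruct (Hb (eps / 2)) as [N2 H2]; [lra|].
  exists (max N1 N2); intros j Hj; eapply Rle_trans; [apply Cmod_le_abs|].
  specialize (H1 j ltac:(lia)); specialize (H2 j ltac:(lia)).
  replace (Re (u j - (a, b))%C) with (Re (u j) - a) by reflexivity.
  replace (Im (u j - (a, b))%C) with (Im (u j) - b) by reflexivity; lra.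
Qed.

Lemma Cconverges_le (u : nat -> C) (l v : C) (B : R) (N : nat) : Cconverges u l ->
  (forall j, (N <= j)%nat -> Cmod (u j - v)%C <= B) -> Cmod (l - v)%C <= B.
Proof.
  intros Hu HB; apply le_epsilon; intros eps He; destruct (Hu eps He) as [M HM].
  specialize (HM (max N M) ltac:(lia)); specialize (HB (max N M) ltac:(lia)).
  eapply Rle_trans; [apply (Cmod_sub_triangle _ (u (max N M)))|].
  rewrite (Cmod_sub_sym l); lra.
Qed.

Lemma Cconverges_unique (u : nat -> C) (l m : C) : Cconverges u l -> Cconverges u m -> l = m.
Proof.
  intros Hl Hm; assert (Z : (l - m)%C = 0%C).
  { apply Cmod_small_0; intros eps He; destruct (Hm eps He) as [P HP].
    eapply Cconverges_le; eauto. }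
  replace l with (l - m + m)%C by ring; rewrite Z; ring.
Qed.

Lemma sq_sum_le (a b e : R) : 0 <= a -> 0 <= b -> 0 <= e -> a ^ 2 + b ^ 2 <= e ^ 2 -> a <= e /\ b <= e.
Proof. intros; split; nra. Qed.

(** Continuous dependence on order and data makes [f j] and [f1 j] uniformly Cauchy on discs. The
    theorem on derivatives of limits is then used twice, the derivative of [f1 j] being supplied by
    the equation. *)
Lemma bessel_limit (nu : nat -> R) (f f1 : nat -> C -> C) (nu0 : R) (a b : C) :
  (forall j, is_bessel (nu j) (f j) (f1 j)) ->
  (forall eps, 0 < eps -> exists N, forall j, (N <= j)%nat -> Rabs (nu j - nu0) <= eps) ->
  Cconverges (fun j => f j 0%C) a -> Cconverges (fun j => f1 j 0%C) b ->
  exists g g1, is_bessel nu0 g g1 /\ g 0%C = a /\ g1 0%C = b /\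
    (forall s, Cconverges (fun j => f j s) (g s) /\ Cconverges (fun j => f1 j s) (g1 s)).
Proof.
  intros Hf Hnu Ha Hb.
  destruct (Hnu 1) as [N0 HN0]; [lra|].
  destruct (Ha 1) as [Na HNa]; [lra|]. destruct (Hb 1) as [Nb HNb]; [lra|].
  set (M := max N0 (max Na Nb)).
  set (N := Rabs nu0 + 1 + ((Cmod a + 1) ^ 2 + (Cmod b + 1) ^ 2)).
  assert (HN : 0 <= N).
  { unfold N; pose proof (Rabs_pos nu0); pose proof (pow2_ge_0 (Cmod a + 1));
      pose proof (pow2_ge_0 (Cmod b + 1)); lra. }
  assert (HnuN : forall j, (M <= j)%nat -> Rabs (nu j) <= N).
  { intros j Hj; specialize (HN0 j ltac:(unfold M in *; lia)).
    pose proof (Rabs_triang nu0 (nu j - nu0)) as Tr.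
    replace (nu0 + (nu j - nu0)) with (nu j) in Tr by ring.
    pose proof (pow2_ge_0 (Cmod a + 1)); pose proof (pow2_ge_0 (Cmod b + 1)); unfold N; lra. }
  assert (HinitN : forall j, (M <= j)%nat -> Cmod (f j 0%C) ^ 2 + Cmod (f1 j 0%C) ^ 2 <= N).
  { intros j Hj; specialize (HNa j ltac:(unfold M in *; lia)).
    specialize (HNb j ltac:(unfold M in *; lia)).
    pose proof (Cmod_le_sub (f j 0%C) a); pose proof (Cmod_le_sub (f1 j 0%C) b).
    assert (Cmod (f j 0%C) ^ 2 <= (Cmod a + 1) ^ 2)
      by (apply pow_incr; split; [apply Cmod_ge_0 | lra]).
    assert (Cmod (f1 j 0%C) ^ 2 <= (Cmod b + 1) ^ 2)
      by (apply pow_incr; split; [apply Cmod_ge_0 | lra]).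
    pose proof (Rabs_pos nu0); unfold N; lra. }
  assert (Cau : forall T eps, 1 <= T -> 0 < eps -> exists P, forall i j s,
     (P <= i)%nat -> (P <= j)%nat -> Cmod s <= T ->
     Cmod (f i s - f j s)%C <= eps /\ Cmod (f1 i s - f1 j s)%C <= eps).
  { intros T eps HT He; destruct (bessel_continuity T N HT HN) as [K [HK H]].
    set (d := eps / (4 * (K + 1))).
    assert (Hd : 0 < d) by (apply Rdiv_lt_0_compat; lra).
    assert (Hdd : d * (4 * (K + 1)) = eps) by (unfold d; field; lra).
    destruct (Hnu d Hd) as [P1 HP1]; destruct (Ha d Hd) as [P2 HP2]; destruct (Hb d Hd) as [P3 HP3].
    exists (max M (max P1 (max P2 P3))); intros i j s Hi Hj Hs.
    pose proof (H (nu i) (nu j) _ _ _ _ (HnuN i ltac:(lia)) (HnuN j ltac:(lia)) (Hf i) (Hf j)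
      (HinitN j ltac:(lia)) s Hs) as B.
    assert (D : forall (u : nat -> C) l, Cmod (u i - l)%C <= d -> Cmod (u j - l)%C <= d ->
      Cmod (u i - u j)%C ^ 2 <= (2 * d) ^ 2).
    { intros u l h1 h2; apply pow_incr; split; [apply Cmod_ge_0|].
      eapply Rle_trans; [apply (Cmod_sub_triangle _ l)|]; rewrite (Cmod_sub_sym l); lra. }
    pose proof (D (fun j => f j 0%C) a (HP2 i ltac:(lia)) (HP2 j ltac:(lia))).
    pose proof (D (fun j => f1 j 0%C) b (HP3 i ltac:(lia)) (HP3 j ltac:(lia))).
    assert ((nu i - nu j) ^ 2 <= (2 * d) ^ 2).
    { specialize (HP1 i ltac:(lia)) as h1; specialize (HP1 j ltac:(lia)) as h2.
      apply Rabs_le_between in h1; apply Rabs_le_between in h2; nra. }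
    cbv beta in *.
    assert (Cmod (f i s - f j s)%C ^ 2 + Cmod (f1 i s - f1 j s)%C ^ 2 <= eps ^ 2).
    { eapply Rle_trans; [apply B|].
      apply Rle_trans with (K * (3 * (2 * d) ^ 2)); [apply Rmult_le_compat_l; lra|].
      rewrite <- Hdd; pose proof (pow2_ge_0 d); nra. }
    apply sq_sum_le; auto; try apply Cmod_ge_0; lra. }
  assert (E : forall s, exists l, Cconverges (fun j => f j s) (fst l) /\
     Cconverges (fun j => f1 j s) (snd l)).
  { intros s; pose proof (Cmod_ge_0 s).
    destruct (Ccauchy_converges (fun j => f j s)) as [l Hl].
    { intros eps He; destruct (Cau (Cmod s + 1) eps) as [P HP]; [lra|auto|].
      exists P; intros; apply HP; auto; lra. }
    destruct (Ccauchy_converges (fun j => f1 j s)) as [m Hm].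
    { intros eps He; destruct (Cau (Cmod s + 1) eps) as [P HP]; [lra|auto|].
      exists P; intros; apply HP; auto; lra. }
    exists (l, m); auto. }
  apply choice in E; destruct E as [G HG].
  set (g := fun s => fst (G s)); set (g1 := fun s => snd (G s)).
  assert (Unif : forall T eps, 1 <= T -> 0 < eps -> exists P, forall j s,
     (P <= j)%nat -> Cmod s <= T -> Cmod (f j s - g s)%C <= eps /\ Cmod (f1 j s - g1 s)%C <= eps).
  { intros T eps HT He; destruct (Cau T eps HT He) as [P HP]; exists P; intros j s Hj Hs.
    destruct (HG s) as [h h1]; rewrite !(Cmod_sub_sym (f j s)), (Cmod_sub_sym (f1 j s)).
    split; eapply Cconverges_le with (N := P); eauto; intros i Hi; apply HP; auto. }
  exists g, g1; split; [|split; [|split]].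
  - intros s; split.
    + apply (is_cderive_limit f f1 g g1).
      * intros j u; apply Hf.
      * intros u eps He; destruct (HG u) as [h _]; apply h; auto.
      * intros T eps He; destruct (Unif (Rmax 1 T) eps (Rmax_l _ _) He) as [P HP].
        exists P; intros j u Hj Hu; apply HP; auto.
        eapply Rle_trans; [eassumption | apply Rmax_r].
    + apply (is_cderive_limit f1 (fun j s => (cexp (2 * s) + RtoC (nu j ^ 2)) * f j s)%C g1
        (fun s => (cexp (2 * s) + RtoC (nu0 ^ 2)) * g s)%C).
      * intros j u; apply Hf.
      * intros u eps He; destruct (HG u) as [_ h]; apply h; auto.
      * intros T0 eps He; set (T := Rmax 1 T0).
        set (c := exp (2 * T) + N ^ 2).
        assert (Hc : 0 < c) by (pose proof (exp_pos (2 * T)); pose proof (pow2_ge_0 N); unfold c; lra).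
        set (e := exp (T * (2 + c))).
        (* The coefficient of the equation varies with j too, so uniform convergence of its product
           with [f j] requires a bound on the functions themselves. *)
        assert (HB : forall j s, (M <= j)%nat -> Cmod s <= T -> Cmod (f j s) <= N * e + 1).
        { intros j u Hj Hu.
          pose proof (bessel_growth (nu j) N T _ _ (HnuN j Hj) (Rmax_l _ _) (Hf j) u Hu) as B.
          fold c in B; fold e in B; specialize (HinitN j Hj).
          pose proof (pow2_ge_0 (Cmod (f1 j u))); pose proof (Cmod_ge_0 (f j u)).
          assert (0 < e) by apply exp_pos.
          pose proof (Rmult_le_compat_r e _ _ ltac:(lra) HinitN); nra. }
        assert (HNe : 0 < N * e + 1) by (assert (0 < e) by apply exp_pos; nra).
        set (d := Rmin 1 (eps / (2 * ((2 * N + 1) * (N * e + 1))))).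
        assert (Hd : 0 < d) by (apply Rmin_pos; [lra | apply Rdiv_lt_0_compat; nra]).
        assert (Hd2 : d * ((2 * N + 1) * (N * e + 1)) <= eps / 2).
        { apply Rle_trans with (eps / (2 * ((2 * N + 1) * (N * e + 1))) * ((2 * N + 1) * (N * e + 1))).
          - apply Rmult_le_compat_r; [nra | apply Rmin_r].
          - right; field; split; nra. }
        destruct (Hnu d Hd) as [P1 HP1].
        destruct (Unif T (eps / (2 * c)) (Rmax_l _ _)) as [P2 HP2]; [apply Rdiv_lt_0_compat; lra|].
        exists (max M (max P1 P2)); intros j u Hj Hu0.
        assert (Hu : Cmod u <= T) by (eapply Rle_trans; [eassumption | apply Rmax_r]).
        replace ((cexp (2 * u) + RtoC (nu j ^ 2)) * f j u - (cexp (2 * u) + RtoC (nu0 ^ 2)) * g u)%C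
          with ((cexp (2 * u) + RtoC (nu0 ^ 2)) * (f j u - g u) + RtoC (nu j ^ 2 - nu0 ^ 2) * f j u)%C
          by (rewrite RtoC_minus; ring).
        eapply Rle_trans; [apply Cmod_triangle|]; rewrite !Cmod_mult, Cmod_R.
        assert (A1 : Cmod (cexp (2 * u) + RtoC (nu0 ^ 2)) * Cmod (f j u - g u) <= c * (eps / (2 * c))).
        { apply Rmult_le_compat; try apply Cmod_ge_0.
          - apply Cmod_coeff_le; auto.
            pose proof (pow2_ge_0 (Cmod a + 1)); pose proof (pow2_ge_0 (Cmod b + 1)); unfold N; lra.
          - apply HP2; auto; lia. }
        replace (c * (eps / (2 * c))) with (eps / 2) in A1 by (field; lra).
        assert (A2 : Rabs (nu j ^ 2 - nu0 ^ 2) * Cmod (f j u) <= d * (2 * N + 1) * (N * e + 1)).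
        { apply Rmult_le_compat; [apply Rabs_pos | apply Cmod_ge_0 | | apply HB; auto; lia].
          replace (nu j ^ 2 - nu0 ^ 2) with ((nu j - nu0) * (nu j + nu0)) by ring.
          rewrite Rabs_mult; apply Rmult_le_compat; try apply Rabs_pos; [apply HP1; lia|].
          eapply Rle_trans; [apply Rabs_triang|]; specialize (HnuN j ltac:(lia)).
          assert (Rabs nu0 <= N); [|lra].
          pose proof (pow2_ge_0 (Cmod a + 1)); pose proof (pow2_ge_0 (Cmod b + 1)); unfold N; lra. }
        lra.
  - eapply Cconverges_unique; [apply (HG 0%C)|auto].
  - eapply Cconverges_unique; [apply (HG 0%C)|auto].
  - intros s; apply HG.
Qed.

(** * The reciprocal Gamma function *)

Definition gauss (N : nat) (x : R) : R :=
  prod_f_R0 (fun k => x + INR k) N / (INR (fact N) * Rpower (INR N) x).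

(* For x >= 0, [gauss N x] decreases and [gauss_low N x] increases to [rgamma x]. *)
Definition gauss_low (N : nat) (x : R) : R :=
  gauss N x * exp (x * (ln (INR N) - ln (INR N + 1 + x))).

Lemma ln_le_sub1 (y : R) : 0 < y -> ln y <= y - 1.
Proof. intros Hy; pose proof (exp_ineq1_le (ln y)); rewrite exp_ln in *; lra. Qed.

Lemma ln_ge_1_sub_inv (y : R) : 0 < y -> 1 - / y <= ln y.
Proof.
  intros Hy; pose proof (ln_le_sub1 (/ y) (Rinv_0_lt_compat _ Hy)); rewrite ln_Rinv in *; lra.
Qed.

Lemma INR_ge_1 (N : nat) : (1 <= N)%nat -> 1 <= INR N.
Proof. intros; apply (le_INR 1); auto. Qed.

Lemma gauss_succ (N : nat) (x : R) : (1 <= N)%nat ->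
  gauss (S N) x = gauss N x * ((1 + x / (INR N + 1)) * exp (x * (ln (INR N) - ln (INR N + 1)))).
Proof.
  intros HN; pose proof (INR_ge_1 N HN); unfold gauss, Rpower.
  replace (prod_f_R0 (fun k => x + INR k) (S N)) with
    (prod_f_R0 (fun k => x + INR k) N * (x + INR (S N))) by reflexivity.
  rewrite fact_simpl, mult_INR, S_INR, Rmult_minus_distr_l; unfold Rminus.
  rewrite exp_plus, exp_Ropp.
  pose proof (exp_pos (x * ln (INR N))); pose proof (exp_pos (x * ln (INR N + 1))).
  pose proof (INR_fact_lt_0 N).
  field; repeat split; lra.
Qed.

Lemma prod_pos (x : R) (N : nat) : 0 < x -> 0 < prod_f_R0 (fun k => x + INR k) N.
Proof.
  intros Hx; induction N as [|N IH]; [simpl; lra|].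
  change (prod_f_R0 (fun k => x + INR k) (S N)) with
    (prod_f_R0 (fun k => x + INR k) N * (x + INR (S N))).
  pose proof (pos_INR (S N)); apply Rmult_lt_0_compat; lra.
Qed.

Lemma prod_at_0 (N : nat) : prod_f_R0 (fun k => 0 + INR k) N = 0.
Proof. induction N as [|N IH]; [simpl; lra|]; cbn -[INR]; cbn in IH; rewrite IH; ring. Qed.

Lemma gauss_nonneg (N : nat) (x : R) : 0 <= x -> 0 <= gauss N x.
Proof.
  intros [Hx| <-]; unfold gauss; [left|right].
  - apply Rdiv_lt_0_compat; [apply prod_pos; auto|].
    apply Rmult_lt_0_compat; [apply INR_fact_lt_0 | apply exp_pos].
  - rewrite prod_at_0; unfold Rdiv; ring.
Qed.

(** The ratio of consecutive terms is (1 + x/(N+1)) (N/(N+1))^x. The first factor is at most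
    exp(x/(N+1)), the second at most its reciprocal, since ln((N+1)/N) >= 1/(N+1). *)
Lemma gauss_decr (N : nat) (x : R) : (1 <= N)%nat -> 0 <= x -> gauss (S N) x <= gauss N x.
Proof.
  intros HN Hx; rewrite gauss_succ by auto; pose proof (INR_ge_1 N HN).
  rewrite <- (Rmult_1_r (gauss N x)) at 2.
  apply Rmult_le_compat_l; [apply gauss_nonneg; auto|].
  apply Rle_trans with (exp (x / (INR N + 1)) * exp (- (x / (INR N + 1)))).
  2:{ rewrite <- exp_plus, Rplus_opp_r, exp_0; lra. }
  assert (0 <= x / (INR N + 1)) by (apply Rdiv_le_0_compat; lra).
  apply Rmult_le_compat; [lra | left; apply exp_pos | apply exp_ineq1_le | apply exp_le].
  pose proof (ln_ge_1_sub_inv ((INR N + 1) / INR N) ltac:(apply Rdiv_lt_0_compat; lra)) as L.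
  rewrite ln_div in L by lra.
  replace (1 - / ((INR N + 1) / INR N)) with (/ (INR N + 1)) in L by (field; lra).
  unfold Rdiv; nra.
Qed.

(** [gauss_low N x] is the Gauss quotient with N^x replaced by (N+1+x)^x. The new factor 1 + x/(N+1)
    of the product outweighs the growth of that power: its logarithm is at least x/(N+1+x), while
    ln((N+2+x)/(N+1+x)) <= 1/(N+1+x). *)
Lemma gauss_low_incr (N : nat) (x : R) : (1 <= N)%nat -> 0 <= x ->
  gauss_low N x <= gauss_low (S N) x.
Proof.
  intros HN Hx; unfold gauss_low; rewrite gauss_succ by auto; pose proof (INR_ge_1 N HN).
  rewrite S_INR, !Rmult_assoc; apply Rmult_le_compat_l; [apply gauss_nonneg; auto|].
  rewrite <- exp_plus.
  replace (1 + x / (INR N + 1)) with (exp (ln (1 + x / (INR N + 1)))) at 1.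
  2:{ apply exp_ln; assert (0 <= x / (INR N + 1)) by (apply Rdiv_le_0_compat; lra); lra. }
  rewrite <- exp_plus; apply exp_le.
  replace (1 + x / (INR N + 1)) with ((INR N + 1 + x) / (INR N + 1)) by (field; lra).
  pose proof (ln_ge_1_sub_inv ((INR N + 1 + x) / (INR N + 1)) ltac:(apply Rdiv_lt_0_compat; lra)) as L.
  replace (1 - / ((INR N + 1 + x) / (INR N + 1))) with (x * / (INR N + 1 + x)) in L by (field; lra).
  pose proof (ln_le_sub1 ((INR N + 1 + 1 + x) / (INR N + 1 + x)) ltac:(apply Rdiv_lt_0_compat; lra)) as U.
  rewrite (ln_div (INR N + 1 + 1 + x)) in U by lra.
  replace ((INR N + 1 + 1 + x) / (INR N + 1 + x) - 1) with (/ (INR N + 1 + x)) in U by (field; lra).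
  pose proof (Rmult_le_compat_l x _ _ Hx U); lra.
Qed.

Lemma gauss_low_le (N : nat) (x : R) : (1 <= N)%nat -> 0 <= x -> gauss_low N x <= gauss N x.
Proof.
  intros HN Hx; unfold gauss_low; pose proof (INR_ge_1 N HN).
  rewrite <- (Rmult_1_r (gauss N x)) at 2.
  apply Rmult_le_compat_l; [apply gauss_nonneg; auto|].
  apply Rle_trans with (exp 0); [apply exp_le | rewrite exp_0; lra].
  assert (ln (INR N) <= ln (INR N + 1 + x)) by (apply ln_le; lra). nra.
Qed.

Lemma rgamma_lim_nonneg (x : R) : 0 <= x -> is_lim_seq (fun N => gauss N x) (rgamma x).
Proof.
  intros Hx.
  assert (E : ex_finite_lim_seq (fun N => gauss (S N) x)).
  { apply ex_finite_lim_seq_decr with (M := 0).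
    - intros n; apply gauss_decr; auto; lia.
    - intros n; apply gauss_nonneg; auto. }
  destruct E as [l Hl]; apply (is_lim_seq_incr_1 (fun N => gauss N x)) in Hl.
  replace (rgamma x) with l; auto.
  change (rgamma x) with (real (Lim_seq (fun N => gauss N x))); symmetry; rewrite (is_lim_seq_unique (fun N => gauss N x) l); auto.
Qed.

(** For large N, gauss N x = x gauss N (x+1) N/(x+1+N), so convergence passes from x+1 to x together
    with the functional equation. Unit steps down from x >= 0, where monotonicity gives convergence,
    reach every real x. *)
Lemma rgamma_lim (x : R) : is_lim_seq (fun N => gauss N x) (rgamma x) /\
  rgamma x = x * rgamma (x + 1).
Proof.
  assert (Step : forall x, is_lim_seq (fun N => gauss N (x + 1)) (rgamma (x + 1)) ->
    is_lim_seq (fun N => gauss N x) (x * rgamma (x + 1))).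
  { clear x; intros x H.
    assert (L : is_lim_seq (fun N => INR N / (x + 1 + INR N)) 1).
    { apply is_lim_seq_ext_loc with (fun N => / (1 + (x + 1) * / INR N)).
      - destruct (nfloor_ex (Rabs (x + 1)) (Rabs_pos _)) as [M HM].
        exists (S (S M)); intros N HN.
        assert (INR (S (S M)) <= INR N) by (apply le_INR; auto).
        rewrite !S_INR in *; pose proof (Rabs_pos (x + 1)).
        assert (- (x + 1) <= Rabs (x + 1)) by (rewrite <- Rabs_Ropp; apply Rle_abs).
        field; lra.
      - replace (Finite 1) with (Rbar_inv (Finite (1 + (x + 1) * 0))) by (simpl; f_equal; field; lra).
        apply is_lim_seq_inv; [|simpl; intros E; injection E; lra].
        apply is_lim_seq_plus'; [apply is_lim_seq_const|].
        apply is_lim_seq_mult'; [apply is_lim_seq_const|].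
        replace (Finite 0) with (Rbar_inv p_infty) by reflexivity.
        apply is_lim_seq_inv; [apply is_lim_seq_INR | easy]. }
    replace (x * rgamma (x + 1)) with (x * rgamma (x + 1) * 1) by ring.
    apply is_lim_seq_ext_loc with (fun N => x * gauss N (x + 1) * (INR N / (x + 1 + INR N))).
    - destruct (nfloor_ex (Rabs (x + 1)) (Rabs_pos _)) as [M HM].
      exists (S (S M)); intros N HN.
      assert (INR (S (S M)) <= INR N) by (apply le_INR; auto).
      rewrite !S_INR in *; pose proof (Rabs_pos (x + 1)).
      assert (- (x + 1) <= Rabs (x + 1)) by (rewrite <- Rabs_Ropp; apply Rle_abs).
      assert (P : forall N, prod_f_R0 (fun k => x + INR k) N * (x + 1 + INR N) =
                 x * prod_f_R0 (fun k => x + 1 + INR k) N).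
      { clear; intros N; induction N as [|N IH]; [simpl; ring|].
        change (prod_f_R0 (fun k => x + INR k) (S N)) with
          (prod_f_R0 (fun k => x + INR k) N * (x + INR (S N))).
        change (prod_f_R0 (fun k => x + 1 + INR k) (S N)) with
          (prod_f_R0 (fun k => x + 1 + INR k) N * (x + 1 + INR (S N))).
        rewrite <- Rmult_assoc, <- IH, S_INR; ring. }
      unfold gauss; rewrite Rpower_plus, Rpower_1 by lra.
      pose proof (INR_fact_lt_0 N); pose proof (exp_pos (x * ln (INR N))).
      unfold Rpower.
      apply Rmult_eq_reg_r with (x + 1 + INR N); [|lra].
      replace (prod_f_R0 (fun k => x + INR k) N / (INR (fact N) * exp (x * ln (INR N))) * (x + 1 + INR N))
       with (prod_f_R0 (fun k => x + INR k) N * (x + 1 + INR N) / (INR (fact N) * exp (x * ln (INR N))))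
       by (field; split; lra).
      rewrite P; field; repeat split; lra.
    - apply is_lim_seq_mult'; auto; apply is_lim_seq_mult'; auto; apply is_lim_seq_const. }
  assert (Val : forall x l, is_lim_seq (fun N => gauss N x) (Finite l) -> rgamma x = l).
  { intros y l H; change (rgamma y) with (real (Lim_seq (fun N => gauss N y))).
    rewrite (is_lim_seq_unique (fun N => gauss N y) l); auto. }
  assert (Conv : forall m x, - INR m <= x -> is_lim_seq (fun N => gauss N x) (rgamma x)).
  { induction m as [|m IH]; intros y Hy; [apply rgamma_lim_nonneg; simpl in Hy; lra|].
    rewrite S_INR in Hy; specialize (Step y (IH (y + 1) ltac:(lra))).
    rewrite (Val _ _ Step); auto. }
  assert (All : forall x, is_lim_seq (fun N => gauss N x) (rgamma x)).
  { intros y; destruct (nfloor_ex (Rabs y) (Rabs_pos _)) as [M HM].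
    apply (Conv (S M)); rewrite S_INR.
    assert (- y <= Rabs y) by (rewrite <- Rabs_Ropp; apply Rle_abs); lra. }
  split; auto.
Qed.

Lemma rgamma_step (x : R) : rgamma x = x * rgamma (x + 1).
Proof. apply rgamma_lim. Qed.

Lemma rgamma_le_gauss (N : nat) (x : R) : (1 <= N)%nat -> 0 <= x -> rgamma x <= gauss N x.
Proof.
  intros HN Hx; destruct (rgamma_lim x) as [L _].
  refine (is_lim_seq_le_loc _ (fun _ => gauss N x) (rgamma x) (gauss N x) _ L (is_lim_seq_const _)).
  exists N; intros n Hn; induction Hn as [|n Hn IH]; [lra|].
  eapply Rle_trans; [apply gauss_decr; auto; lia | auto].
Qed.

Lemma gauss_low_le_rgamma (N : nat) (x : R) : (1 <= N)%nat -> 0 <= x -> gauss_low N x <= rgamma x.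
Proof.
  intros HN Hx; destruct (rgamma_lim x) as [L _].
  refine (is_lim_seq_le_loc (fun _ => gauss_low N x) _ (gauss_low N x) (rgamma x) _ (is_lim_seq_const _) L).
  exists N; intros n Hn.
  apply Rle_trans with (gauss_low n x); [|apply gauss_low_le; auto; lia].
  induction Hn as [|n Hn IH]; [lra|].
  eapply Rle_trans; [apply IH | apply gauss_low_incr; auto; lia].
Qed.

Lemma rgamma_pos (x : R) : 0 < x -> 0 < rgamma x.
Proof.
  intros Hx; eapply Rlt_le_trans; [|apply (gauss_low_le_rgamma 1); [lia | lra]].
  unfold gauss_low, gauss; apply Rmult_lt_0_compat; [|apply exp_pos].
  apply Rdiv_lt_0_compat; [apply prod_pos; auto|].
  apply Rmult_lt_0_compat; [apply INR_fact_lt_0 | apply exp_pos].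
Qed.

Lemma rgamma_shift (N : nat) (x : R) :
  rgamma x = prod_f_R0 (fun k => x + INR k) N * rgamma (x + INR N + 1).
Proof.
  induction N as [|N IH].
  - simpl; rewrite !Rplus_0_r; apply rgamma_step.
  - change (prod_f_R0 (fun k => x + INR k) (S N)) with
      (prod_f_R0 (fun k => x + INR k) N * (x + INR (S N))).
    rewrite IH, (rgamma_step (x + INR N + 1)), S_INR, Rmult_assoc.
    replace (x + (INR N + 1)) with (x + INR N + 1) by ring; reflexivity.
Qed.

Lemma rgamma_neq_0 (x : R) : (forall k, x + INR k <> 0) -> rgamma x <> 0.
Proof.
  intros H; destruct (nfloor_ex (Rabs x) (Rabs_pos _)) as [M HM].
  assert (- x <= Rabs x) by (rewrite <- Rabs_Ropp; apply Rle_abs).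
  rewrite (rgamma_shift M); apply Rmult_integral_contrapositive_currified.
  - clear - H; induction M as [|M IH]; [exact (H 0%nat)|].
    apply (Rmult_integral_contrapositive_currified _ _ IH (H (S M))).
  - pose proof (rgamma_pos (x + INR M + 1)); lra.
Qed.

Lemma gauss_continuous (N : nat) (x : R) : continuity_pt (gauss N) x.
Proof.
  apply continuity_pt_div.
  - induction N as [|N IH].
    + apply continuity_pt_plus; [apply continuity_pt_id | apply continuity_pt_const; easy].
    + apply (continuity_pt_mult _ (fun y => y + INR (S N))); [apply IH|].
      apply continuity_pt_plus; [apply continuity_pt_id | apply continuity_pt_const; easy].
  - apply (is_derive_continuity_pt _ _ (INR (fact N) * (ln (INR N) * exp (x * ln (INR N))))).
    unfold Rpower; der; ring.
  - pose proof (INR_fact_lt_0 N); pose proof (exp_pos (x * ln (INR N))); unfold Rpower; nra.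
Qed.

Lemma gauss_low_continuous (N : nat) (x : R) : 0 < x -> continuity_pt (gauss_low N) x.
Proof.
  intros Hx; apply continuity_pt_mult; [apply gauss_continuous|].
  pose proof (pos_INR N).
  eapply (is_derive_continuity_pt
    (fun x => exp (x * (ln (INR N) - ln (INR N + 1 + x))))); auto_derive; [lra | reflexivity].
Qed.

Lemma ln_ratio_lim (x : R) : 0 <= x ->
  is_lim_seq (fun N => exp (x * (ln (INR N) - ln (INR N + 1 + x)))) 1.
Proof.
  intros Hx.
  apply is_lim_seq_le_le_loc with (u := fun N => 1 - x * ((1 + x) * / INR N)) (w := fun _ => 1).
  - exists 1%nat; intros N HN; pose proof (INR_ge_1 N HN).
    pose proof (ln_le_sub1 ((INR N + 1 + x) / INR N) ltac:(apply Rdiv_lt_0_compat; lra)) as L.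
    rewrite ln_div in L by lra.
    replace ((INR N + 1 + x) / INR N - 1) with ((1 + x) * / INR N) in L by (field; lra).
    split.
    + eapply Rle_trans; [|apply exp_ineq1_le]; nra.
    + apply Rle_trans with (exp 0); [apply exp_le | rewrite exp_0; lra].
      assert (ln (INR N) <= ln (INR N + 1 + x)) by (apply ln_le; lra); nra.
  - replace (Finite 1) with (Finite (1 - x * ((1 + x) * 0))) by (f_equal; ring).
    apply is_lim_seq_minus'; [apply is_lim_seq_const|].
    do 2 (apply is_lim_seq_mult'; [apply is_lim_seq_const|]).
    replace (Finite 0) with (Rbar_inv p_infty) by reflexivity.
    apply is_lim_seq_inv; [apply is_lim_seq_INR | easy].
  - apply is_lim_seq_const.
Qed.

(** At one large N the two monotone bounds are continuous and both close to [rgamma x] at x, and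
    [rgamma] stays squeezed between them at neighbouring points. *)
Lemma rgamma_continuous (x : R) : 0 < x -> continuity_pt rgamma x.
Proof.
  intros Hx.
  assert (Hx0 : 0 <= x) by lra.
  assert (LL : is_lim_seq (fun N => gauss_low N x) (rgamma x)).
  { replace (rgamma x) with (rgamma x * 1) by ring.
    apply is_lim_seq_mult'; [apply rgamma_lim | apply ln_ratio_lim; auto]. }
  apply is_lim_seq_spec in LL; destruct (rgamma_lim x) as [LG _]; apply is_lim_seq_spec in LG.
  intros eps He.
  assert (He2 : 0 < eps / 2) by lra.
  destruct (LL (mkposreal _ He2)) as [N1 H1]; destruct (LG (mkposreal _ He2)) as [N2 H2].
  simpl in H1, H2; set (N := S (max N1 N2)).
  specialize (H1 N ltac:(unfold N; lia)); specialize (H2 N ltac:(unfold N; lia)).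
  destruct (gauss_continuous N x (eps / 2) He2) as [d1 [P1 D1]].
  destruct (gauss_low_continuous N x Hx (eps / 2) He2) as [d2 [P2 D2]].
  exists (Rmin x (Rmin d1 d2)); split; [repeat apply Rmin_pos; lra|].
  intros y [Hy1 Hy2].
  simpl in *; unfold Rdist in *.
  assert (Ha : Rabs (y - x) < x) by (eapply Rlt_le_trans; [exact Hy2 | apply Rmin_l]).
  assert (Hb : Rabs (y - x) < d1) by (eapply Rlt_le_trans; [exact Hy2|];
    eapply Rle_trans; [apply Rmin_r | apply Rmin_l]).
  assert (Hc : Rabs (y - x) < d2) by (eapply Rlt_le_trans; [exact Hy2|];
    eapply Rle_trans; [apply Rmin_r | apply Rmin_r]).
  specialize (D1 y (conj Hy1 Hb)); specialize (D2 y (conj Hy1 Hc)).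
  apply Rabs_lt_between in Ha.
  pose proof (rgamma_le_gauss N y ltac:(unfold N; lia) ltac:(lra)).
  pose proof (gauss_low_le_rgamma N y ltac:(unfold N; lia) ltac:(lra)).
  apply Rabs_lt_between in D1; apply Rabs_lt_between in D2;
  apply Rabs_lt_between in H1; apply Rabs_lt_between in H2.
  apply Rabs_lt_between; lra.
Qed.

(** By [rgamma_shift] the expression equals [rgamma x / gauss N x]. It takes the place of Stirling's
    formula for Gamma(x+N+1)/N!. *)
Lemma rgamma_asymptotic (x : R) : rgamma x <> 0 ->
  is_lim_seq (fun N => INR (fact N) * Rpower (INR N) x * rgamma (x + INR N + 1)) 1.
Proof.
  intros H; destruct (rgamma_lim x) as [L _].
  apply is_lim_seq_ext with (fun N => rgamma x * / gauss N x).
  - intros N; unfold gauss.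
    pose proof (INR_fact_lt_0 N); pose proof (exp_pos (x * ln (INR N))).
    assert (P : prod_f_R0 (fun k => x + INR k) N <> 0)
      by (intros E; apply H; rewrite (rgamma_shift N), E; ring).
    rewrite (rgamma_shift N x) at 1; unfold Rpower; field; repeat split; auto; lra.
  - replace (Finite 1) with (Finite (rgamma x * / rgamma x)) by (f_equal; field; auto).
    apply is_lim_seq_mult'; [apply is_lim_seq_const|].
    apply (is_lim_seq_inv _ (rgamma x)); auto; intros E; injection E; auto.
Qed.

Lemma rgamma_decr (nu : R) (k : nat) : 0 <= nu -> rgamma (nu + INR k + 1) <= rgamma (nu + 1).
Proof.
  intros Hnu; induction k as [|k IH]; [simpl; rewrite Rplus_0_r; lra|].
  eapply Rle_trans; [|apply IH]; pose proof (pos_INR k).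
  rewrite (rgamma_step (nu + INR k + 1)), S_INR.
  replace (nu + (INR k + 1) + 1) with (nu + INR k + 1 + 1) by ring.
  pose proof (rgamma_pos (nu + INR k + 1 + 1) ltac:(lra)); nra.
Qed.

(** Once k exceeds |nu|, the factor nu+k+1 of the functional equation is at least 1 and the absolute
    values decrease; finitely many earlier values remain. *)
Lemma rgamma_bounded (nu : R) : exists M, 0 < M /\ forall k, Rabs (rgamma (nu + INR k + 1)) <= M.
Proof.
  destruct (nfloor_ex (Rabs nu) (Rabs_pos _)) as [m Hm].
  assert (B : forall k, exists M, 0 < M /\ forall j, (j <= k)%nat -> Rabs (rgamma (nu + INR j + 1)) <= M).
  { induction k as [|k [M [HM IH]]].
    - exists (Rabs (rgamma (nu + INR 0 + 1)) + 1); split; [pose proof (Rabs_pos (rgamma (nu + INR 0 + 1))); lra|].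
      intros j Hj; replace j with 0%nat by lia; lra.
    - exists (M + Rabs (rgamma (nu + INR (S k) + 1))); split.
      + pose proof (Rabs_pos (rgamma (nu + INR (S k) + 1))); lra.
      + intros j Hj; destruct (Nat.eq_dec j (S k)) as [->|Hne]; [lra|].
        specialize (IH j ltac:(lia)); pose proof (Rabs_pos (rgamma (nu + INR (S k) + 1))); lra. }
  assert (Decr : forall k, (S m <= k)%nat ->
    Rabs (rgamma (nu + INR (S k) + 1)) <= Rabs (rgamma (nu + INR k + 1))).
  { intros k Hk; rewrite (rgamma_step (nu + INR k + 1)), S_INR.
    replace (nu + (INR k + 1) + 1) with (nu + INR k + 1 + 1) by ring.
    rewrite Rabs_mult; apply le_INR in Hk; rewrite S_INR in Hk.
    assert (- nu <= Rabs nu) by (rewrite <- Rabs_Ropp; apply Rle_abs).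
    rewrite (Rabs_pos_eq (nu + INR k + 1)) by lra.
    pose proof (Rabs_pos (rgamma (nu + INR k + 1 + 1))); nra. }
  destruct (B (S m)) as [M [HM HB]]; exists M; split; auto.
  intros k; destruct (le_lt_dec k (S m)) as [Hk|Hk]; [auto|].
  induction Hk as [|k Hk IH].
  - eapply Rle_trans; [apply (Decr (S m)); lia | apply HB; lia].
  - eapply Rle_trans; [apply (Decr k); lia | apply IH].
Qed.

(** * Series *)

Lemma ex_series_scal_R (c : R) (a : nat -> R) : ex_series a -> ex_series (fun k => c * a k).
Proof. apply (ex_series_scal (V := R_NormedModule) c a). Qed.

Lemma ex_series_plus_R (a b : nat -> R) : ex_series a -> ex_series b ->
  ex_series (fun k => a k + b k).
Proof. apply (ex_series_plus (V := R_NormedModule) a b). Qed.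

Lemma ex_series_exp (x : R) : ex_series (fun k => x ^ k / INR (fact k)).
Proof.
  apply ex_series_ext with (fun k => scal (pow_n x k) (/ INR (fact k))).
  - intros k; rewrite pow_n_pow; reflexivity.
  - exists (exp x); apply is_exp_Reals.
Qed.

Lemma ex_series_dominated (a b : nat -> R) : (forall k, Rabs (a k) <= b k) ->
  ex_series b -> ex_series a.
Proof. intros H Hb; apply (ex_series_le a b); auto. Qed.

Lemma ex_series_dominated_exp (a : nat -> R) (M x : R) :
  (forall k, Rabs (a k) <= M * (x ^ k / INR (fact k))) -> ex_series a.
Proof.
  intros H; eapply ex_series_dominated; [exact H|].
  apply ex_series_scal_R, ex_series_exp.
Qed.

Lemma Series_nonneg (a : nat -> R) : (forall k, 0 <= a k) -> ex_series a -> 0 <= Series a.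
Proof.
  intros H Ha; rewrite <- (Rmult_0_l (Series a)), <- Series_scal_l; apply Series_le; auto.
  intros k; rewrite Rmult_0_l; split; [lra | auto].
Qed.

Lemma Series_le' (a b : nat -> R) : (forall k, a k <= b k) -> ex_series a -> ex_series b ->
  Series a <= Series b.
Proof.
  intros H Ha Hb.
  assert (0 <= Series (fun k => b k - a k)).
  { apply Series_nonneg; [intros k; specialize (H k); lra|]; apply (ex_series_minus b a); auto. }
  rewrite Series_minus in H0; auto; lra.
Qed.

Lemma Series_pos (a : nat -> R) : (forall k, 0 < a k) -> ex_series a -> 0 < Series a.
Proof.
  intros H Ha; rewrite Series_incr_1 by auto.
  assert (0 <= Series (fun k => a (S k))); [|specialize (H 0%nat); lra].
  apply Series_nonneg; [intros k; left; auto|]; apply ex_series_incr_1 in Ha; exact Ha.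
Qed.

Lemma Re_sum_n (a : nat -> C) (n : nat) : Re (sum_n a n) = sum_n (fun k => Re (a k)) n.
Proof. induction n as [|n IH]; [rewrite !sum_O; auto|]; rewrite !sum_Sn, <- IH; reflexivity. Qed.

Lemma Im_sum_n (a : nat -> C) (n : nat) : Im (sum_n a n) = sum_n (fun k => Im (a k)) n.
Proof. induction n as [|n IH]; [rewrite !sum_O; auto|]; rewrite !sum_Sn, <- IH; reflexivity. Qed.

Lemma sum_n_SC (a : nat -> C) (n : nat) : sum_n a (S n) = (sum_n a n + a (S n))%C.
Proof. rewrite sum_Sn; reflexivity. Qed.

Lemma Cconverges_plus (u v : nat -> C) (l m : C) : Cconverges u l -> Cconverges v m ->
  Cconverges (fun j => u j + v j)%C (l + m)%C.
Proof.
  intros Hu Hv eps He; destruct (Hu (eps / 2)) as [N1 H1]; [lra|].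
  destruct (Hv (eps / 2)) as [N2 H2]; [lra|]; exists (max N1 N2); intros j Hj.
  specialize (H1 j ltac:(lia)); specialize (H2 j ltac:(lia)).
  replace (u j + v j - (l + m))%C with ((u j - l) + (v j - m))%C by ring.
  eapply Rle_trans; [apply Cmod_triangle | lra].
Qed.

Lemma Cconverges_scal (c : C) (u : nat -> C) (l : C) : Cconverges u l ->
  Cconverges (fun j => c * u j)%C (c * l)%C.
Proof.
  intros Hu eps He; pose proof (Cmod_ge_0 c).
  destruct (Hu (eps / (Cmod c + 1))) as [N H1]; [apply Rdiv_lt_0_compat; lra|].
  exists N; intros j Hj; specialize (H1 j Hj).
  replace (c * u j - c * l)%C with (c * (u j - l))%C by ring; rewrite Cmod_mult.
  apply Rle_trans with ((Cmod c + 1) * (eps / (Cmod c + 1))).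
  - apply Rmult_le_compat; auto; try lra; apply Cmod_ge_0.
  - right; field; lra.
Qed.

Lemma Cconverges_incr_1 (u : nat -> C) (l : C) : Cconverges u l -> Cconverges (fun j => u (S j)) l.
Proof. intros H eps He; destruct (H eps He) as [N HN]; exists N; intros; apply HN; lia. Qed.

Lemma Cconverges_ext (u v : nat -> C) (l : C) : (forall j, u j = v j) ->
  Cconverges u l -> Cconverges v l.
Proof. intros E H; replace v with u; auto; apply functional_extensionality; auto. Qed.

Lemma is_lim_seq_Cconverges (u : nat -> C) (a b : R) :
  is_lim_seq (fun j => Re (u j)) a -> is_lim_seq (fun j => Im (u j)) b -> Cconverges u (a, b).
Proof.
  intros Ha Hb eps He; apply is_lim_seq_spec in Ha; apply is_lim_seq_spec in Hb.
  assert (He2 : 0 < eps / 2) by lra.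
  destruct (Ha (mkposreal _ He2)) as [N1 H1]; destruct (Hb (mkposreal _ He2)) as [N2 H2].
  exists (max N1 N2); intros j Hj; eapply Rle_trans; [apply Cmod_le_abs|].
  specialize (H1 j ltac:(lia)); specialize (H2 j ltac:(lia)); simpl in H1, H2.
  replace (Re (u j - (a, b))%C) with (Re (u j) - a) by reflexivity.
  replace (Im (u j - (a, b))%C) with (Im (u j) - b) by reflexivity; lra.
Qed.

Lemma CSeries_converges (a : nat -> C) (b : nat -> R) : (forall k, Cmod (a k) <= b k) ->
  ex_series b -> Cconverges (sum_n a) (CSeries a).
Proof.
  intros H Hb; apply is_lim_seq_Cconverges.
  - apply is_lim_seq_ext with (sum_n (fun k => Re (a k))); [intros; symmetry; apply Re_sum_n|].
    apply (Series_correct (fun k => Re (a k))), ex_series_dominated with b; auto.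
    intros k; eapply Rle_trans; [apply re_le_Cmod | auto].
  - apply is_lim_seq_ext with (sum_n (fun k => Im (a k))); [intros; symmetry; apply Im_sum_n|].
    apply (Series_correct (fun k => Im (a k))), ex_series_dominated with b; auto.
    intros k; eapply Rle_trans; [apply im_le_Cmod | auto].
Qed.

Lemma CSeries_tail (a : nat -> C) (b : nat -> R) (n : nat) : (forall k, Cmod (a k) <= b k) ->
  ex_series b -> Cmod (sum_n a n - CSeries a)%C <= Series b - sum_n b n.
Proof.
  intros H Hb; rewrite Cmod_sub_sym.
  apply (Cconverges_le _ _ _ _ n (CSeries_converges a b H Hb)); intros m Hm.
  apply Rle_trans with (sum_n b m - sum_n b n).
  - induction Hm as [|m Hm IH].
    + replace (sum_n a n - sum_n a n)%C with (RtoC 0) by ring; rewrite Cmod_0; lra.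
    + rewrite sum_n_SC, (sum_Sn b).
      replace (sum_n a m + a (S m) - sum_n a n)%C with ((sum_n a m - sum_n a n) + a (S m))%C by ring.
      eapply Rle_trans; [apply Cmod_triangle|]; specialize (H (S m)).
      change (plus (sum_n b m) (b (S m))) with (sum_n b m + b (S m)); lra.
  - assert (sum_n b m <= Series b); [|lra].
    assert (Hp : forall k, 0 <= b k) by (intros k; eapply Rle_trans; [apply Cmod_ge_0 | apply H]).
    apply (is_lim_seq_incr_compare (sum_n b)); [apply Series_correct; auto|].
    intros k; rewrite sum_Sn; specialize (Hp (S k)).
    change (plus (sum_n b k) (b (S k))) with (sum_n b k + b (S k)); lra.
Qed.

(** Termwise differentiation of a series of exponentials, one dominating series per disc covering
    the terms and their derivatives. It is applied to I_nu and again to its derivative. *)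
Lemma CSeries_exp_derive (b m : nat -> R) (dom : R -> nat -> R) :
  (forall T, ex_series (dom T)) ->
  (forall T k s, Cmod s <= T -> Rabs (b k) * (1 + Rabs (m k)) * Cmod (cexp (RtoC (m k) * s)) <= dom T k) ->
  forall s, is_cderive (fun s => CSeries (fun k => RtoC (b k) * cexp (RtoC (m k) * s))%C) s
    (CSeries (fun k => RtoC (b k * m k) * cexp (RtoC (m k) * s))%C).
Proof.
  intros Hs Hd.
  assert (D1 : forall T k s, Cmod s <= T -> Cmod (RtoC (b k) * cexp (RtoC (m k) * s)) <= dom T k).
  { intros T k s Hsz; eapply Rle_trans; [|apply (Hd T k s Hsz)].
    rewrite Cmod_mult, Cmod_R; apply Rmult_le_compat_r; [apply Cmod_ge_0|].
    pose proof (Rabs_pos (b k)); pose proof (Rabs_pos (m k)); nra. }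
  assert (D2 : forall T k s, Cmod s <= T -> Cmod (RtoC (b k * m k) * cexp (RtoC (m k) * s)) <= dom T k).
  { intros T k s Hsz; eapply Rle_trans; [|apply (Hd T k s Hsz)].
    rewrite Cmod_mult, Cmod_R, Rabs_mult; apply Rmult_le_compat_r; [apply Cmod_ge_0|].
    pose proof (Rabs_pos (b k)); pose proof (Rabs_pos (m k)); nra. }
  apply (is_cderive_limit (fun n s => sum_n (fun k => RtoC (b k) * cexp (RtoC (m k) * s))%C n)
     (fun n s => sum_n (fun k => RtoC (b k * m k) * cexp (RtoC (m k) * s))%C n)).
  - assert (T : forall k s, is_cderive (fun s => RtoC (b k) * cexp (RtoC (m k) * s))%C s
        (RtoC (b k * m k) * cexp (RtoC (m k) * s))%C).
    { intros k s; eapply is_cderive_eq.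
      - apply is_cderive_scal, (is_cderive_comp cexp (fun s => RtoC (m k) * s)%C).
        + apply is_cderive_scal, is_cderive_id.
        + apply is_cderive_cexp.
      - rewrite RtoC_mult; ring. }
    intros n s; induction n as [|n IH].
    + rewrite sum_O; replace (fun s => sum_n _ 0) with (fun s => RtoC (b 0%nat) * cexp (RtoC (m 0%nat) * s))%C; auto.
      apply functional_extensionality; intros u; rewrite sum_O; auto.
    + rewrite sum_n_SC; eapply is_cderive_eq; [|reflexivity].
      replace (fun s => sum_n _ (S n)) with (fun s => sum_n (fun k => RtoC (b k) * cexp (RtoC (m k) * s)) n
         + RtoC (b (S n)) * cexp (RtoC (m (S n)) * s))%C.
      * apply is_cderive_plus; auto.
      * apply functional_extensionality; intros u; rewrite sum_n_SC; auto.
  - intros s; apply CSeries_converges with (dom (Cmod s)); auto; intros k; apply D1; lra.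
  - intros T eps He; assert (L : is_lim_seq (sum_n (dom T)) (Series (dom T))) by (apply (Series_correct (dom T)); auto).
    apply is_lim_seq_spec in L; destruct (L (mkposreal _ He)) as [N HN]; simpl in HN.
    exists N; intros n s Hn Hsz; eapply Rle_trans.
    + apply CSeries_tail with (b := dom T); auto; intros k; apply D2; auto.
    + specialize (HN n Hn); apply Rabs_lt_between in HN; lra.
Qed.

(** * The Bessel function I_nu(e^s) *)

(** The exponential is 2^(-(nu+2k)). With z = e^s, (z/2)^(nu+2k) becomes this constant times an
    exponential in s, so no branch of a power remains and the series is entire. *)
Definition bi_coef (nu : R) (k : nat) : R :=
  rgamma (nu + INR k + 1) / INR (fact k) * exp (- ((nu + 2 * INR k) * ln 2)).

Definition bi (nu : R) (s : C) : C :=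
  CSeries (fun k => RtoC (bi_coef nu k) * cexp (RtoC (nu + 2 * INR k) * s))%C.

Definition bi' (nu : R) (s : C) : C :=
  CSeries (fun k => RtoC (bi_coef nu k * (nu + 2 * INR k)) * cexp (RtoC (nu + 2 * INR k) * s))%C.

(** The 2 added to T pays for (1 + |nu+2k|)^2 <= exp(2 |nu+2k|), so that one series dominates I_nu
    and its first two derivatives on the disc of radius T. *)
Definition bi_dom (nu T : R) (k : nat) : R :=
  Rabs (bi_coef nu k) * exp ((Rabs nu + 2 * INR k) * (T + 2)).

Lemma ex_series_bi_dom (nu T : R) : ex_series (bi_dom nu T).
Proof.
  destruct (rgamma_bounded nu) as [M [HM HB]].
  apply ex_series_dominated_exp with
    (M * (exp (- (nu * ln 2)) * exp (Rabs nu * (T + 2)))) (exp (- (2 * ln 2)) * exp (2 * (T + 2))).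
  intros k; unfold bi_dom, bi_coef.
  rewrite Rabs_mult, Rabs_Rabsolu, (Rabs_pos_eq (exp _)) by (left; apply exp_pos).
  unfold Rdiv at 1; rewrite !Rabs_mult, (Rabs_pos_eq (exp _)) by (left; apply exp_pos).
  pose proof (INR_fact_lt_0 k) as Hf.
  rewrite (Rabs_pos_eq (/ _)) by (left; apply Rinv_0_lt_compat; auto).
  rewrite Rpow_mult_distr, !exp_pow.
  replace (- ((nu + 2 * INR k) * ln 2)) with (- (nu * ln 2) + INR k * - (2 * ln 2)) by ring.
  replace ((Rabs nu + 2 * INR k) * (T + 2)) with (Rabs nu * (T + 2) + INR k * (2 * (T + 2))) by ring.
  rewrite !exp_plus.
  set (A := exp (- (nu * ln 2)) * exp (INR k * - (2 * ln 2)) *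
     (exp (Rabs nu * (T + 2)) * exp (INR k * (2 * (T + 2))))).
  assert (HA : 0 < A) by (unfold A; repeat apply Rmult_lt_0_compat; apply exp_pos).
  apply Rle_trans with (M * (/ INR (fact k) * A)).
  - rewrite Rmult_assoc with (r3 := _ * _ : R).
    replace (Rabs (rgamma (nu + INR k + 1)) * / INR (fact k) *
      (exp (- (nu * ln 2)) * exp (INR k * - (2 * ln 2)) *
      (exp (Rabs nu * (T + 2)) * exp (INR k * (2 * (T + 2))))))
      with (Rabs (rgamma (nu + INR k + 1)) * (/ INR (fact k) * A)) by (unfold A; ring).
    apply Rmult_le_compat_r; auto.
    apply Rmult_le_pos; [left; apply Rinv_0_lt_compat; auto | lra].
  - right; unfold A, Rdiv; ring.
Qed.

Lemma one_plus_le_exp (x : R) : (1 + Rabs x) <= exp (Rabs x).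
Proof. apply exp_ineq1_le. Qed.

Lemma bi_term_dom (nu T : R) (k : nat) (s : C) : Cmod s <= T ->
  Rabs (bi_coef nu k) * (1 + Rabs (nu + 2 * INR k)) ^ 2 *
    Cmod (cexp (RtoC (nu + 2 * INR k) * s)) <= bi_dom nu T k.
Proof.
  intros Hs; unfold bi_dom; rewrite Rmult_assoc; apply Rmult_le_compat_l; [apply Rabs_pos|].
  set (m := nu + 2 * INR k).
  assert (Hm : Rabs m <= Rabs nu + 2 * INR k).
  { unfold m; eapply Rle_trans; [apply Rabs_triang|].
    rewrite (Rabs_pos_eq (2 * INR k)) by (pose proof (pos_INR k); lra); lra. }
  pose proof (Rabs_pos m); pose proof (Cmod_ge_0 s).
  apply Rle_trans with (exp (Rabs m) ^ 2 * exp (Rabs m * T)).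
  - apply Rmult_le_compat; [apply pow2_ge_0 | apply Cmod_ge_0 | |].
    + apply pow_incr; pose proof (one_plus_le_exp m); lra.
    + eapply Rle_trans; [apply Cmod_cexp_le|apply exp_le]; rewrite Cmod_mult, Cmod_R.
      apply Rmult_le_compat_l; auto.
  - replace (exp (Rabs m) ^ 2) with (exp (Rabs m + Rabs m)) by (rewrite exp_plus; ring).
    rewrite <- exp_plus; apply exp_le; nra.
Qed.

Lemma bi_term_dom1 (nu T : R) (k : nat) (s : C) : Cmod s <= T ->
  Rabs (bi_coef nu k) * (1 + Rabs (nu + 2 * INR k)) *
    Cmod (cexp (RtoC (nu + 2 * INR k) * s)) <= bi_dom nu T k.
Proof.
  intros Hs; eapply Rle_trans; [|apply (bi_term_dom nu T k s Hs)].
  apply Rmult_le_compat_r; [apply Cmod_ge_0|]; apply Rmult_le_compat_l; [apply Rabs_pos|].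
  pose proof (Rabs_pos (nu + 2 * INR k)); nra.
Qed.

Lemma bi_term_dom0 (nu T : R) (k : nat) (s : C) : Cmod s <= T ->
  Cmod (RtoC (bi_coef nu k) * cexp (RtoC (nu + 2 * INR k) * s)) <= bi_dom nu T k.
Proof.
  intros Hs; eapply Rle_trans; [|apply (bi_term_dom1 nu T k s Hs)].
  rewrite Cmod_mult, Cmod_R.
  apply Rmult_le_compat_r; [apply Cmod_ge_0|].
  pose proof (Rabs_pos (nu + 2 * INR k)); pose proof (Rabs_pos (bi_coef nu k)); nra.
Qed.

(** Bessel's equation at the level of coefficients: (nu+2k+2)^2 - nu^2 = 4 (k+1)(nu+k+1), and the
    rest is the functional equation of 1/Gamma. No division by nu+k+1, which may vanish, takes
    place. *)
Lemma bi_coef_succ (nu : R) (k : nat) :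
  bi_coef nu (S k) * ((nu + 2 * INR (S k)) ^ 2 - nu ^ 2) = bi_coef nu k.
Proof.
  unfold bi_coef; rewrite (rgamma_step (nu + INR k + 1)), fact_simpl, mult_INR.
  replace (- ((nu + 2 * INR (S k)) * ln 2)) with (- ((nu + 2 * INR k) * ln 2) + - (ln 2 + ln 2))
    by (rewrite S_INR; ring).
  rewrite exp_plus, (exp_Ropp (ln 2 + ln 2)), exp_plus, exp_ln by lra.
  rewrite S_INR; replace (nu + (INR k + 1) + 1) with (nu + INR k + 1 + 1) by ring.
  pose proof (INR_fact_lt_0 k); pose proof (pos_INR k); field; lra.
Qed.

Lemma bi_is_bessel (nu : R) : is_bessel nu (bi nu) (bi' nu).
Proof.
  intros s; split.
  - apply CSeries_exp_derive with (bi_dom nu); [apply ex_series_bi_dom|].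
    intros T k u Hu; apply bi_term_dom1; auto.
  - eapply is_cderive_eq.
    + unfold bi'; apply (CSeries_exp_derive (fun k => bi_coef nu k * (nu + 2 * INR k))
        (fun k => nu + 2 * INR k) (bi_dom nu)); [apply ex_series_bi_dom|].
      intros T k u Hu; eapply Rle_trans; [|apply (bi_term_dom nu T k u Hu)].
      apply Rmult_le_compat_r; [apply Cmod_ge_0|]; rewrite Rabs_mult.
      pose proof (Rabs_pos (nu + 2 * INR k)); pose proof (Rabs_pos (bi_coef nu k)); nra.
    + set (a := fun k => (RtoC (bi_coef nu k) * cexp (RtoC (nu + 2 * INR k) * s))%C).
      set (a2 := fun k => (RtoC (bi_coef nu k * (nu + 2 * INR k) * (nu + 2 * INR k)) *
                  cexp (RtoC (nu + 2 * INR k) * s))%C).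
      assert (Ha : Cconverges (sum_n a) (bi nu s)).
      { apply CSeries_converges with (bi_dom nu (Cmod s)); [|apply ex_series_bi_dom].
        intros k; apply bi_term_dom0; lra. }
      assert (Ha2 : Cconverges (sum_n a2) (CSeries a2)).
      { apply CSeries_converges with (bi_dom nu (Cmod s)); [|apply ex_series_bi_dom].
        intros k; unfold a2; rewrite Cmod_mult, Cmod_R, Rmult_assoc, Rabs_mult.
        eapply Rle_trans; [|apply (bi_term_dom nu (Cmod s) k s); lra].
        apply Rmult_le_compat_r; [apply Cmod_ge_0|]; apply Rmult_le_compat_l; [apply Rabs_pos|].
        rewrite Rabs_mult; pose proof (Rabs_pos (nu + 2 * INR k)); nra. }
      apply (Cconverges_unique _ _ _ (Cconverges_incr_1 _ _ Ha2)).
      (* The coefficient relation links index k+1 of the second derivative to index k of e^(2s)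
         I_nu, hence the comparison of partial sums up to n+1 and up to n. *)
      apply Cconverges_ext with
        (fun n => cexp (2 * s) * sum_n a n + RtoC (nu ^ 2) * sum_n a (S n))%C.
      * assert (T : forall k, a2 (S k) = (cexp (2 * s) * a k + RtoC (nu ^ 2) * a (S k))%C).
        { intros k; unfold a2, a.
          rewrite <- (bi_coef_succ nu k), S_INR.
          replace (RtoC (nu + 2 * (INR k + 1)) * s)%C with (2 * s + RtoC (nu + 2 * INR k) * s)%C
            by (rewrite !RtoC_plus, !RtoC_mult, RtoC_plus; ring).
          rewrite cexp_plus.
          set (c := bi_coef nu (S k)).
          replace (c * (nu + 2 * (INR k + 1)) * (nu + 2 * (INR k + 1))) with
            (c * ((nu + 2 * (INR k + 1)) ^ 2 - nu ^ 2) + nu ^ 2 * c) by ring.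
          rewrite RtoC_plus, (RtoC_mult (nu ^ 2)); ring. }
        intros n; induction n as [|n IH].
        -- rewrite !sum_n_SC, !sum_O, T.
           replace (a2 0%nat) with (RtoC (nu ^ 2) * a 0%nat)%C; [ring|].
           unfold a, a2; simpl INR; rewrite Rmult_0_r, Rplus_0_r, Rmult_assoc.
           rewrite (Rmult_comm (bi_coef nu 0)), RtoC_mult; simpl (nu ^ 2); rewrite Rmult_1_r; ring.
        -- rewrite (sum_n_SC a2), <- IH, T, (sum_n_SC a (S n)), (sum_n_SC a n); ring.
      * replace ((cexp (2 * s) + RtoC (nu ^ 2)) * bi nu s)%C with
          (cexp (2 * s) * bi nu s + RtoC (nu ^ 2) * bi nu s)%C by ring.
        apply Cconverges_plus; apply Cconverges_scal; auto; apply Cconverges_incr_1; auto.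
Qed.

(** * I_nu on the real line *)

Definition ri (nu t : R) : R := Series (fun k => bi_coef nu k * exp ((nu + 2 * INR k) * t)).

Definition ri' (nu t : R) : R :=
  Series (fun k => bi_coef nu k * (nu + 2 * INR k) * exp ((nu + 2 * INR k) * t)).

Lemma CSeries_RtoC (a : nat -> R) : CSeries (fun k => RtoC (a k)) = RtoC (Series a).
Proof.
  unfold CSeries, RtoC; f_equal; simpl.
  transitivity (Series (fun k => 0 * a k)); [|rewrite Series_scal_l; ring].
  apply Series_ext; intros; ring.
Qed.

Lemma bi_RtoC (nu t : R) : bi nu (RtoC t) = RtoC (ri nu t).
Proof.
  unfold bi, ri; rewrite <- CSeries_RtoC; f_equal; apply functional_extensionality; intros k.
  rewrite <- RtoC_mult, cexp_RtoC, <- RtoC_mult; reflexivity.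
Qed.

Lemma bi'_RtoC (nu t : R) : bi' nu (RtoC t) = RtoC (ri' nu t).
Proof.
  unfold bi', ri'; rewrite <- CSeries_RtoC; f_equal; apply functional_extensionality; intros k.
  rewrite <- RtoC_mult, cexp_RtoC, <- RtoC_mult; reflexivity.
Qed.

Lemma bessel_real_line (nu : R) (f f1 : C -> C) : is_bessel nu f f1 -> forall t,
  is_derive (fun t => Re (f (RtoC t))) t (Re (f1 (RtoC t))) /\
  is_derive (fun t => Re (f1 (RtoC t))) t ((exp (2 * t) + nu ^ 2) * Re (f (RtoC t))).
Proof.
  intros Hf t; destruct (Hf (RtoC t)) as [H0 H1].
  assert (E : forall t, (0 + RtoC t * 1)%C = RtoC t) by (intros; ring).
  rewrite <- E in H0, H1 at 1.
  apply is_cderive_path in H0; apply is_cderive_path in H1.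
  destruct H0 as [H0 _], H1 as [H1 _]; split.
  - eapply is_derive_ext; [|eapply is_derive_eq; [exact H0|]].
    + intros u; simpl; rewrite E; reflexivity.
    + eqR; rewrite ?E, Cmult_1_r; reflexivity.
  - eapply is_derive_ext; [|eapply is_derive_eq; [exact H1|]].
    + intros u; simpl; rewrite E; reflexivity.
    + eqR; rewrite ?E, Cmult_1_r, <- RtoC_mult, cexp_RtoC, <- RtoC_plus, Re_RtoC_mul; reflexivity.
Qed.

Lemma ri_derive (nu t : R) : is_derive (ri nu) t (ri' nu t).
Proof.
  destruct (bessel_real_line nu _ _ (bi_is_bessel nu) t) as [H _].
  rewrite bi'_RtoC in H; refine (is_derive_ext _ _ _ _ _ H); intros u; rewrite bi_RtoC; reflexivity.
Qed.

Lemma ri'_derive (nu t : R) : is_derive (ri' nu) t ((exp (2 * t) + nu ^ 2) * ri nu t).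
Proof.
  destruct (bessel_real_line nu _ _ (bi_is_bessel nu) t) as [_ H].
  rewrite bi_RtoC in H; refine (is_derive_ext _ _ _ _ _ H); intros u; rewrite bi'_RtoC; reflexivity.
Qed.

Lemma ri_term_dom (nu t : R) (k : nat) :
  Rabs (bi_coef nu k * (nu + 2 * INR k) * exp ((nu + 2 * INR k) * t)) <= bi_dom nu (Rabs t) k /\
  Rabs (bi_coef nu k * exp ((nu + 2 * INR k) * t)) <= bi_dom nu (Rabs t) k.
Proof.
  pose proof (bi_term_dom1 nu (Rabs t) k (RtoC t) ltac:(rewrite Cmod_R; lra)) as H.
  rewrite <- RtoC_mult, cexp_RtoC, Cmod_R in H.
  pose proof (Rabs_pos (bi_coef nu k)); pose proof (Rabs_pos (nu + 2 * INR k)).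
  pose proof (Rabs_pos (exp ((nu + 2 * INR k) * t))).
  rewrite !Rabs_mult; split; (eapply Rle_trans; [|exact H]); apply Rmult_le_compat_r; auto; nra.
Qed.

Lemma ex_series_ri (nu t : R) : ex_series (fun k => bi_coef nu k * exp ((nu + 2 * INR k) * t)).
Proof.
  apply ex_series_dominated with (bi_dom nu (Rabs t)); [|apply ex_series_bi_dom].
  intros k; apply ri_term_dom.
Qed.

Lemma ex_series_ri' (nu t : R) :
  ex_series (fun k => bi_coef nu k * (nu + 2 * INR k) * exp ((nu + 2 * INR k) * t)).
Proof.
  apply ex_series_dominated with (bi_dom nu (Rabs t)); [|apply ex_series_bi_dom].
  intros k; apply ri_term_dom.
Qed.

Lemma bi_coef_pos (nu : R) (k : nat) : 0 <= nu -> 0 < bi_coef nu k.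
Proof.
  intros Hnu; pose proof (pos_INR k); unfold bi_coef; apply Rmult_lt_0_compat; [|apply exp_pos].
  apply Rdiv_lt_0_compat; [apply rgamma_pos; lra | apply INR_fact_lt_0].
Qed.

Lemma ri_pos (nu t : R) : 0 <= nu -> 0 < ri nu t.
Proof.
  intros Hnu; apply Series_pos; [|apply ex_series_ri].
  intros k; apply Rmult_lt_0_compat; [apply bi_coef_pos; auto | apply exp_pos].
Qed.

Lemma ri'_ge (nu t : R) : 0 <= nu -> nu * ri nu t <= ri' nu t.
Proof.
  intros Hnu; unfold ri, ri'; rewrite <- Series_scal_l; apply Series_le'.
  - intros k; pose proof (bi_coef_pos nu k Hnu); pose proof (exp_pos ((nu + 2 * INR k) * t)).
    pose proof (pos_INR k).
    replace (bi_coef nu k * (nu + 2 * INR k) * exp ((nu + 2 * INR k) * t))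
      with ((nu + 2 * INR k) * (bi_coef nu k * exp ((nu + 2 * INR k) * t))) by ring.
    apply Rmult_le_compat_r; [nra | lra].
  - apply (ex_series_scal_R nu), ex_series_ri.
  - apply ex_series_ri'.
Qed.

(** Writing 1/Gamma(nu+k) = (nu+k)/Gamma(nu+k+1), the part with nu gives the first term; the part
    with k, collected in [a], becomes the second after an index shift. *)
Lemma ri_recurrence (nu t : R) : ri (nu - 1) t = 2 * nu * exp (- t) * ri nu t + ri (nu + 1) t.
Proof.
  set (a := fun k => rgamma (nu + INR k + 1) * INR k / INR (fact k) *
    exp ((nu - 1 + 2 * INR k) * (t - ln 2))).
  assert (E : forall k, bi_coef (nu - 1) k * exp ((nu - 1 + 2 * INR k) * t) =
    2 * nu * exp (- t) * (bi_coef nu k * exp ((nu + 2 * INR k) * t)) + a k).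
  { intros k; unfold bi_coef, a.
    replace (nu - 1 + INR k + 1) with (nu + INR k) by ring.
    rewrite (rgamma_step (nu + INR k)).
    replace ((nu - 1 + 2 * INR k) * (t - ln 2)) with
      (- ((nu - 1 + 2 * INR k) * ln 2) + (nu - 1 + 2 * INR k) * t) by ring.
    replace (- ((nu - 1 + 2 * INR k) * ln 2)) with (ln 2 + - ((nu + 2 * INR k) * ln 2)) by ring.
    replace ((nu - 1 + 2 * INR k) * t) with (- t + (nu + 2 * INR k) * t) by ring.
    rewrite !exp_plus, exp_ln by lra; pose proof (INR_fact_lt_0 k); field; lra. }
  assert (A0 : a 0%nat = 0) by (unfold a; simpl; unfold Rdiv; ring).
  assert (AS : forall k, a (S k) = bi_coef (nu + 1) k * exp ((nu + 1 + 2 * INR k) * t)).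
  { intros k; unfold a, bi_coef; rewrite fact_simpl, mult_INR, S_INR.
    replace (nu + (INR k + 1) + 1) with (nu + 1 + INR k + 1) by ring.
    replace ((nu - 1 + 2 * (INR k + 1)) * (t - ln 2)) with
      (- ((nu + 1 + 2 * INR k) * ln 2) + (nu + 1 + 2 * INR k) * t) by ring.
    rewrite exp_plus; pose proof (INR_fact_lt_0 k); pose proof (pos_INR k); field; lra. }
  assert (Xa : ex_series a).
  { apply ex_series_incr_1; eapply ex_series_ext; [intros k; symmetry; apply AS | apply ex_series_ri]. }
  unfold ri at 1; rewrite (Series_ext _ _ E), Series_plus; auto.
  - rewrite Series_scal_l, (Series_incr_1 a) by auto; rewrite A0, (Series_ext _ _ AS).
    unfold ri; ring.
  - apply (ex_series_scal_R (2 * nu * exp (- t))), ex_series_ri.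
Qed.

(** ** All I_nu(x) are equivalent as x tends to infinity *)

(* With these weights, p_k = w_k / sum w, the mean of k^2 / y is exactly 1 and its variance tends
   to 0; hence k concentrates around sqrt y, which gives I_nu / I_0 -> 1. *)
Definition weight (y : R) (k : nat) : R := y ^ k / INR (fact k) ^ 2.

Lemma weight_pos (y : R) (k : nat) : 0 < y -> 0 < weight y k.
Proof.
  intros; unfold weight; apply Rdiv_lt_0_compat; [apply pow_lt; auto|].
  apply pow_lt, INR_fact_lt_0.
Qed.

Lemma ex_series_weight (y : R) (i : nat) : 0 < y -> (i <= 4)%nat ->
  ex_series (fun k => INR k ^ i * weight y k).
Proof.
  intros Hy Hi; apply ex_series_dominated_exp with 1 (exp 1 ^ 4 * y); intros k.
  pose proof (weight_pos y k Hy) as Hw; pose proof (pos_INR k) as Hk.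
  rewrite Rabs_pos_eq by (apply Rmult_le_pos; [apply pow_le; auto | lra]).
  rewrite Rmult_1_l, Rpow_mult_distr; unfold Rdiv; rewrite Rmult_assoc.
  assert (1 <= INR (fact k)) by (apply INR_ge_1; pose proof (lt_O_fact k); lia).
  apply Rmult_le_compat; [apply pow_le; auto | lra | |].
  - apply Rle_trans with (exp (INR k) ^ 4).
    + apply Rle_trans with (exp (INR k) ^ i).
      * apply pow_incr; split; auto; pose proof (exp_ineq1_le (INR k)); lra.
      * apply Rle_pow; auto; pose proof (exp_ineq1_le (INR k)); lra.
    + rewrite <- !pow_mult, Nat.mul_comm, !pow_mult; apply pow_incr; split;
        [left; apply exp_pos|].
      rewrite exp_pow, Rmult_1_r; lra.
  - unfold weight; apply Rmult_le_compat_l; [apply pow_le; lra|].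
    apply Rinv_le_contravar; nra.
Qed.

Lemma ex_series_weight0 (y : R) : 0 < y -> ex_series (weight y).
Proof.
  intros Hy; eapply ex_series_ext; [|apply (ex_series_weight y 0 Hy); lia].
  intros k; simpl; ring.
Qed.

Lemma weight_succ (y : R) (k : nat) : INR (S k) ^ 2 * weight y (S k) = y * weight y k.
Proof.
  unfold weight; rewrite fact_simpl, mult_INR, S_INR; simpl pow.
  pose proof (INR_fact_lt_0 k); pose proof (pos_INR k); field; lra.
Qed.

(** The relation k^2 w_k = y w_(k-1) evaluates the second moment exactly and reduces the fourth to
    lower ones. The first moment is at most sqrt y times the mass because 2k <= sqrt y + k^2/sqrt
    y. *)
Lemma weight_variance (y : R) : 0 < y ->
  ex_series (fun k => (INR k ^ 2 / y - 1) ^ 2 * weight y k) /\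
  Series (fun k => (INR k ^ 2 / y - 1) ^ 2 * weight y k) <=
    (2 * sqrt y + 1) / y * Series (weight y).
Proof.
  intros Hy.
  pose proof (fun i H => ex_series_weight y i Hy H) as W; pose proof (ex_series_weight0 y Hy) as W0.
  set (S0 := Series (weight y)).
  assert (M2 : Series (fun k => INR k ^ 2 * weight y k) = y * S0).
  { rewrite Series_incr_1 by (apply W; lia); rewrite (Series_ext _ _ (weight_succ y)), Series_scal_l.
    unfold S0; simpl INR; ring. }
  assert (M1 : Series (fun k => INR k ^ 1 * weight y k) <= sqrt y * S0).
  { pose proof (sqrt_lt_R0 y Hy) as Hs; pose proof (sqrt_sqrt y ltac:(lra)) as Hss.
    apply Rle_trans with (Series (fun k => sqrt y / 2 * weight y k +
       / (2 * sqrt y) * (INR k ^ 2 * weight y k))).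
    - apply Series_le'; [|apply W; lia|].
      + intros k; rewrite <- Rmult_assoc, <- Rmult_plus_distr_r.
        apply Rmult_le_compat_r; [left; apply weight_pos; auto|].
        apply Rmult_le_reg_l with (2 * sqrt y); [lra|].
        replace (2 * sqrt y * (sqrt y / 2 + / (2 * sqrt y) * INR k ^ 2)) with
          (sqrt y ^ 2 + INR k ^ 2) by (field; lra).
        pose proof (pow2_ge_0 (sqrt y - INR k)); nra.
      + apply ex_series_plus_R;
          apply ex_series_scal_R; auto; apply W; lia.
    - rewrite Series_plus, !Series_scal_l, M2.
      + fold S0; right; rewrite <- Hss at 3; field; lra.
      + apply ex_series_scal_R; auto.
      + apply ex_series_scal_R; apply W; lia. }
  assert (M4 : Series (fun k => INR k ^ 4 * weight y k) =
     y * (Series (fun k => INR k ^ 2 * weight y k) +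
          2 * Series (fun k => INR k ^ 1 * weight y k) + S0)).
  { rewrite Series_incr_1 by (apply W; lia).
    rewrite (Series_ext _ (fun k => y * (INR k ^ 2 * weight y k +
      2 * (INR k ^ 1 * weight y k) + weight y k))).
    - rewrite Series_scal_l, !Series_plus, Series_scal_l; [unfold S0; simpl INR; ring|..];
        repeat (apply ex_series_plus_R);
        try apply ex_series_scal_R; auto; apply W; lia.
    - intros k; replace (INR (S k) ^ 4 * weight y (S k)) with
        (INR (S k) ^ 2 * (INR (S k) ^ 2 * weight y (S k))) by ring.
      rewrite weight_succ, S_INR; ring. }
  assert (E : forall k, (INR k ^ 2 / y - 1) ^ 2 * weight y k =
     / y ^ 2 * (INR k ^ 4 * weight y k) + - (2 / y) * (INR k ^ 2 * weight y k) + weight y k)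
    by (intros k; field; lra).
  assert (X4 : ex_series (fun k => / y ^ 2 * (INR k ^ 4 * weight y k)))
    by (apply ex_series_scal_R, W; lia).
  assert (X2 : ex_series (fun k => - (2 / y) * (INR k ^ 2 * weight y k)))
    by (apply ex_series_scal_R, W; lia).
  pose proof (ex_series_plus_R _ _ X4 X2) as X42.
  split.
  - eapply ex_series_ext; [intros k; symmetry; apply E|].
    apply ex_series_plus_R; auto.
  - rewrite (Series_ext _ _ E), Series_plus, Series_plus, !Series_scal_l by auto.
    rewrite M4, M2; fold S0.
    replace (/ y ^ 2 * (y * (y * S0 + 2 * Series (fun k => INR k ^ 1 * weight y k) + S0)) +
      - (2 / y) * (y * S0) + S0) with
      (/ y * (2 * Series (fun k => INR k ^ 1 * weight y k) + S0)) by (field; lra).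
    replace ((2 * sqrt y + 1) / y * S0) with (/ y * (2 * (sqrt y * S0) + S0)) by (field; lra).
    apply Rmult_le_compat_l; [left; apply Rinv_0_lt_compat; auto | lra].
Qed.

(** exp(nu u) lies between 1 and exp(2u). With u = ln(k/sqrt y) this compares (k/sqrt y)^nu - 1 with
    k^2/y - 1, whose mean square is known; hence the restriction of the base case to orders between
    0 and 2. *)
Lemma exp_sub1_le (nu u : R) : 0 <= nu <= 2 -> Rabs (exp (nu * u) - 1) <= Rabs (exp (2 * u) - 1).
Proof.
  intros Hnu; rewrite <- exp_0; destruct (Rle_dec 0 u) as [Hu|Hu].
  - pose proof (exp_le 0 (nu * u) ltac:(nra)); pose proof (exp_le (nu * u) (2 * u) ltac:(nra)).
    rewrite !Rabs_pos_eq by lra; lra.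
  - pose proof (exp_le (nu * u) 0 ltac:(nra)); pose proof (exp_le (2 * u) (nu * u) ltac:(nra)).
    rewrite !Rabs_left1 by lra; lra.
Qed.

Lemma prefix_bounded (u : nat -> R) (N : nat) : exists K, 0 <= K /\ forall k, (k < N)%nat -> Rabs (u k) <= K.
Proof.
  induction N as [|N [K [HK H]]]; [exists 0; split; [lra | lia]|].
  pose proof (Rabs_pos (u N)).
  exists (K + Rabs (u N)); split; [lra|]; intros k Hk.
  destruct (Nat.eq_dec k N) as [->|]; [lra|]; specialize (H k ltac:(lia)); lra.
Qed.

Lemma ln_0 : ln 0 = 0.
Proof. unfold ln; destruct (Rlt_dec 0 0) as [h|h]; [destruct (Rlt_irrefl _ h) | auto]. Qed.

(** The asymptotics k!/Gamma(k+1-nu) ~ k^nu, where K covers the finitely many k for which they are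
    not yet accurate. *)
Lemma rgamma_power (nu eps : R) : 0 < eps -> rgamma (- nu) <> 0 -> exists K, 0 <= K /\
  forall k, Rabs (INR (fact k) * rgamma (- nu + INR k + 1) - Rpower (INR k) nu) <=
    eps * Rpower (INR k) nu + K.
Proof.
  intros He H; pose proof (rgamma_asymptotic _ H) as L; apply is_lim_seq_spec in L.
  destruct (L (mkposreal eps He)) as [N HN]; simpl in HN.
  destruct (prefix_bounded (fun k => INR (fact k) * rgamma (- nu + INR k + 1) - Rpower (INR k) nu) N)
    as [K [HK HP]].
  exists K; split; auto; intros k; pose proof (exp_pos (nu * ln (INR k))) as Hp.
  fold (Rpower (INR k) nu) in Hp.
  destruct (le_lt_dec N k) as [Hk|Hk]; [|specialize (HP k Hk); nra].
  specialize (HN k Hk); rewrite Rpower_Ropp in HN.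
  replace (INR (fact k) * rgamma (- nu + INR k + 1) - Rpower (INR k) nu) with
   (Rpower (INR k) nu * (INR (fact k) * / Rpower (INR k) nu * rgamma (- nu + INR k + 1) - 1))
   by (field; lra).
  rewrite Rabs_mult, Rabs_pos_eq by lra; nra.
Qed.

Definition weight_sum (t : R) : R := Series (weight (exp (2 * (t - ln 2)))).

Lemma weight_sum_pos (t : R) : 0 < weight_sum t.
Proof.
  apply Series_pos; [intros k; apply weight_pos, exp_pos | apply ex_series_weight0, exp_pos].
Qed.

Lemma ri_neg_term (nu t : R) (k : nat) : bi_coef (- nu) k * exp ((- nu + 2 * INR k) * t) =
  exp (- nu * (t - ln 2)) * (INR (fact k) * rgamma (- nu + INR k + 1)) *
    weight (exp (2 * (t - ln 2))) k.
Proof.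
  unfold bi_coef, weight.
  rewrite exp_pow; pose proof (INR_fact_lt_0 k).
  replace (exp (- nu * (t - ln 2)) * (INR (fact k) * rgamma (- nu + INR k + 1)) *
    (exp (INR k * (2 * (t - ln 2))) / INR (fact k) ^ 2)) with
    (rgamma (- nu + INR k + 1) / INR (fact k) *
      (exp (- nu * (t - ln 2)) * exp (INR k * (2 * (t - ln 2))))) by (field; lra).
  rewrite Rmult_assoc, <- !exp_plus; f_equal; f_equal; ring.
Qed.

(** Relative to the weights, the k-th coefficient of I_(-nu) differs from 1 by at most 2 eps + K
    e^(-nu tau) + Z^2/eps with Z = k^2/y - 1. Averaging, with eps^2 as bound for the mean of Z^2,
    gives 4 eps. *)
Lemma ri_neg_equiv (nu eps : R) : 0 < nu < 2 -> rgamma (- nu) <> 0 -> 0 < eps <= 1 ->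
  exists T, forall t, T <= t -> Rabs (ri (- nu) t - weight_sum t) <= 4 * eps * weight_sum t.
Proof.
  intros Hnu Hg He; destruct (rgamma_power nu eps ltac:(lra) Hg) as [K [HK Hc]].
  (* The first threshold makes the variance at most eps^2, the second makes K e^(-nu tau) at most
     eps. *)
  exists (ln 2 + Rmax (4 / eps ^ 2) (K / (eps * nu))); intros t Ht; set (tau := t - ln 2).
  assert (Ht1 : 4 / eps ^ 2 <= tau) by (pose proof (Rmax_l (4 / eps ^ 2) (K / (eps * nu))); unfold tau; lra).
  assert (Ht2 : K / (eps * nu) <= tau) by (pose proof (Rmax_r (4 / eps ^ 2) (K / (eps * nu))); unfold tau; lra).
  assert (He2 : 0 < eps ^ 2 <= 1) by nra.
  assert (Htau : 4 <= tau).
  { eapply Rle_trans; [|exact Ht1]; apply Rmult_le_reg_r with (eps ^ 2); [lra|].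
    unfold Rdiv; rewrite Rmult_assoc, Rinv_l by lra; lra. }
  set (X := exp tau); set (y := exp (2 * tau)).
  assert (HX : 1 + tau <= X) by apply exp_ineq1_le.
  assert (Hy : y = X ^ 2) by (unfold y, X; replace (2 * tau) with (tau + tau) by ring; rewrite exp_plus; ring).
  assert (Hsy : sqrt y = X) by (rewrite Hy; apply sqrt_pow2; lra).
  assert (Hyp : 0 < y) by (apply exp_pos).
  assert (HD : K * exp (- nu * tau) <= eps).
  { replace (- nu * tau) with (- (nu * tau)) by ring; rewrite exp_Ropp.
    apply Rle_div_l; [apply exp_pos|]; apply Rle_div_l in Ht2; [|nra].
    pose proof (exp_ineq1_le (nu * tau)); nra. }
  assert (HV : (2 * sqrt y + 1) / y <= eps ^ 2).
  { rewrite Hsy, Hy; apply Rle_div_l; [nra|]; apply Rle_div_l in Ht1; [|lra].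
    assert (4 <= X * eps ^ 2) by nra.
    assert (4 * X <= X * eps ^ 2 * X) by (apply Rmult_le_compat_r; lra). nra. }
  destruct (weight_variance y Hyp) as [XV V].
  pose proof (ex_series_weight0 y Hyp) as X0.
  unfold weight_sum; fold tau; fold y; set (S0 := Series (weight y)).
  assert (HS0 : 0 < S0) by (apply Series_pos; auto; intros; apply weight_pos; auto).
  unfold ri; rewrite (Series_ext _ _ (ri_neg_term nu t)); fold tau; fold y.
  set (c := fun k => INR (fact k) * rgamma (- nu + INR k + 1)).
  assert (Xc : ex_series (fun k => exp (- nu * tau) * c k * weight y k)).
  { eapply ex_series_ext; [intros k; apply (ri_neg_term nu t k)|apply ex_series_ri]. }
  rewrite <- (Series_minus _ (weight y)) by auto.
  set (B := fun k => (2 * eps + K * exp (- nu * tau)) * weight y k +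
     / eps * ((INR k ^ 2 / y - 1) ^ 2 * weight y k)).
  assert (XB1 : ex_series (fun k => (2 * eps + K * exp (- nu * tau)) * weight y k))
    by (apply ex_series_scal_R; auto).
  assert (XB2 : ex_series (fun k => / eps * ((INR k ^ 2 / y - 1) ^ 2 * weight y k)))
    by (apply ex_series_scal_R; auto).
  assert (XB : ex_series B) by (apply ex_series_plus_R; auto).
  assert (HB : forall k, Rabs (exp (- nu * tau) * c k * weight y k - weight y k) <= B k).
  { intros k; pose proof (weight_pos y k Hyp) as Hw.
    replace (exp (- nu * tau) * c k * weight y k - weight y k) with
      ((exp (- nu * tau) * c k - 1) * weight y k) by ring.
    unfold B; rewrite Rabs_mult, (Rabs_pos_eq (weight y k)), <- Rmult_assoc, <- Rmult_plus_distr_r by lra.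
    apply Rmult_le_compat_r; [lra|].
    set (Z := INR k ^ 2 / y - 1).
    assert (H1 : Rabs (exp (- nu * tau) * Rpower (INR k) nu - 1) <= Rabs Z).
    { unfold Z; destruct k as [|k].
      (* Index 0 is separate: [ln 0] is 0 by convention, so [Rpower 0 nu] is 1 and k^2/y = exp(2 (ln
         k - tau)) fails. *)
      - unfold Rpower; simpl INR; rewrite ln_0, Rmult_0_r, exp_0, Rmult_1_r.
        replace (0 ^ 2 / y - 1) with (- (1)) by (field; lra); rewrite Rabs_Ropp, Rabs_R1.
        pose proof (exp_pos (- nu * tau)); pose proof (exp_le (- nu * tau) 0 ltac:(nra)).
        rewrite exp_0 in *; rewrite Rabs_left1; lra.
      - unfold Rpower; rewrite <- exp_plus.
        replace (- nu * tau + nu * ln (INR (S k))) with (nu * (ln (INR (S k)) - tau)) by ring.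
        replace (INR (S k) ^ 2 / y) with (exp (2 * (ln (INR (S k)) - tau))).
        + apply exp_sub1_le; lra.
        + assert (0 < INR (S k)) by (apply lt_0_INR; lia).
          replace (2 * (ln (INR (S k)) - tau)) with (ln (INR (S k)) + ln (INR (S k)) + - (2 * tau)) by ring.
          rewrite !exp_plus, exp_Ropp, exp_ln by auto; unfold y; field; pose proof (exp_pos (2 * tau)); lra. }
    assert (H2 : Rabs (exp (- nu * tau) * c k - exp (- nu * tau) * Rpower (INR k) nu) <=
       eps * (exp (- nu * tau) * Rpower (INR k) nu) + K * exp (- nu * tau)).
    { rewrite <- Rmult_minus_distr_l, Rabs_mult, Rabs_pos_eq by (left; apply exp_pos).
      specialize (Hc k); fold (c k) in Hc; pose proof (exp_pos (- nu * tau)); nra. }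
    assert (H3 : Rabs Z <= (eps + Z ^ 2 / eps) / 2).
    { apply Rmult_le_reg_l with (2 * eps); [lra|].
      replace (2 * eps * ((eps + Z ^ 2 / eps) / 2)) with (eps ^ 2 + Z ^ 2) by (field; lra).
      rewrite <- (pow2_abs Z); pose proof (pow2_ge_0 (Rabs Z - eps)); nra. }
    set (p := exp (- nu * tau) * Rpower (INR k) nu) in *.
    pose proof (Rabs_triang (exp (- nu * tau) * c k - p) (p - 1)) as Tr.
    replace (exp (- nu * tau) * c k - p + (p - 1)) with (exp (- nu * tau) * c k - 1) in Tr by ring.
    assert (Hp : p <= 1 + Rabs Z) by (apply Rabs_le_between in H1; lra).
    assert (eps * p <= eps * (1 + Rabs Z)) by (apply Rmult_le_compat_l; lra).
    assert (eps * Rabs Z <= Rabs Z) by (pose proof (Rabs_pos Z); nra).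
    replace (/ eps * Z ^ 2) with (Z ^ 2 / eps) by (unfold Rdiv; ring). lra. }
  eapply Rle_trans; [apply Series_Rabs|].
  { eapply ex_series_dominated; [|exact XB]; intros k; rewrite Rabs_Rabsolu; exact (HB k). }
  eapply Rle_trans; [apply Series_le; [intros k; split; [apply Rabs_pos | apply HB] | auto]|].
  unfold B; rewrite Series_plus, !Series_scal_l by auto; fold S0.
  assert (V2 : Series (fun k => (INR k ^ 2 / y - 1) ^ 2 * weight y k) <= eps ^ 2 * S0)
    by (eapply Rle_trans; [exact V | apply Rmult_le_compat_r; [left; auto | auto]]).
  apply Rmult_le_compat_l with (r := / eps) in V2; [|left; apply Rinv_0_lt_compat; lra].
  replace (/ eps * (eps ^ 2 * S0)) with (eps * S0) in V2 by (field; lra).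
  nra.
Qed.

Definition ratio (nu t : R) : R := ri nu t / weight_sum t.

Lemma ratio_neg_lim (nu : R) : 0 < nu < 2 -> rgamma (- nu) <> 0 ->
  is_lim (ratio (- nu)) p_infty 1.
Proof.
  intros Hnu Hg; apply is_lim_spec; intros [eps He]; simpl.
  set (e := Rmin 1 (eps / 8)).
  assert (He' : 0 < e <= 1) by (split; [apply Rmin_pos; lra | apply Rmin_l]).
  destruct (ri_neg_equiv nu e Hnu Hg He') as [T HT].
  exists T; intros t Ht; specialize (HT t ltac:(lra)); pose proof (weight_sum_pos t) as Hw.
  unfold ratio.
  replace (ri (- nu) t / weight_sum t - 1) with ((ri (- nu) t - weight_sum t) / weight_sum t)
    by (field; lra).
  unfold Rdiv; rewrite Rabs_mult, Rabs_inv, (Rabs_pos_eq (weight_sum t)) by lra.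
  apply Rlt_div_l; auto; pose proof (Rmin_r 1 (eps / 8)); fold e in H; nra.
Qed.

Lemma exp_neg_lim : is_lim (fun t => exp (- t)) p_infty 0.
Proof.
  apply is_lim_comp with m_infty; [apply is_lim_exp_m | | exists 0; easy].
  replace m_infty with (Rbar_opp p_infty) by reflexivity; apply is_lim_opp, is_lim_id.
Qed.

Lemma ratio_shift (nu : R) :
  is_lim (ratio nu) p_infty 1 -> is_lim (fun t => 2 * nu * exp (- t) * ratio nu t) p_infty 0.
Proof.
  intros H; replace (Finite 0) with (Rbar_mult (Finite (2 * nu * 0)) (Finite 1)).
  - apply is_lim_mult; auto; [|exact I].
    apply (is_lim_scal_l (fun t => exp (- t)) (2 * nu) p_infty 0), exp_neg_lim.
  - simpl; f_equal; ring.
Qed.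

Lemma ratio_up (nu : R) : is_lim (ratio (nu - 1)) p_infty 1 -> is_lim (ratio nu) p_infty 1 ->
  is_lim (ratio (nu + 1)) p_infty 1.
Proof.
  intros H1 H2; apply is_lim_ext with (fun t => ratio (nu - 1) t - 2 * nu * exp (- t) * ratio nu t).
  - intros t; unfold ratio; rewrite (ri_recurrence nu); field; pose proof (weight_sum_pos t); lra.
  - replace (Finite 1) with (Finite (1 - 0)) by (f_equal; ring).
    apply is_lim_minus'; auto; apply ratio_shift; auto.
Qed.

Lemma ratio_down (nu : R) : is_lim (ratio (nu + 1)) p_infty 1 -> is_lim (ratio nu) p_infty 1 ->
  is_lim (ratio (nu - 1)) p_infty 1.
Proof.
  intros H1 H2; apply is_lim_ext with (fun t => 2 * nu * exp (- t) * ratio nu t + ratio (nu + 1) t).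
  - intros t; unfold ratio; rewrite (ri_recurrence nu); field; pose proof (weight_sum_pos t); lra.
  - replace (Finite 1) with (Finite (0 + 1)) by (f_equal; ring).
    apply is_lim_plus'; auto; apply ratio_shift; auto.
Qed.

(** The recurrence is of second order, so two neighbouring orders are carried along: a in (-2,-1)
    and a+1 in (-1,0) start the induction, and unit steps in both directions reach every
    non-integer. *)
Lemma ratio_lim (nu : R) : (forall z : Z, nu <> IZR z) -> is_lim (ratio nu) p_infty 1.
Proof.
  intros Hnu.
  set (a := nu - IZR (Int_part nu) - 2).
  assert (Ha : -2 < a < -1).
  { destruct (base_Int_part nu); specialize (Hnu (Int_part nu)); unfold a; split; lra. }
  assert (Base : forall b, -2 < b < 0 -> (forall z : Z, b <> IZR z) -> is_lim (ratio b) p_infty 1).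
  { intros b Hb Hbz; replace b with (- - b) by ring; apply ratio_neg_lim; [lra|].
    rewrite Ropp_involutive; apply rgamma_neq_0; intros k E.
    apply (Hbz (- Z.of_nat k)%Z); rewrite opp_IZR, <- INR_IZR_INZ; lra. }
  assert (Haz : forall z : Z, a <> IZR z).
  { intros z E; apply (Hnu (z + Int_part nu + 2)%Z); rewrite !plus_IZR; unfold a in E; lra. }
  assert (Ha1z : forall z : Z, a + 1 <> IZR z).
  { intros z E; apply (Haz (z - 1)%Z); rewrite minus_IZR; lra. }
  assert (Up : forall n, is_lim (ratio (a + INR n)) p_infty 1 /\ is_lim (ratio (a + INR n + 1)) p_infty 1).
  { induction n as [|n [IH1 IH2]].
    - simpl; rewrite Rplus_0_r; split; apply Base; auto; lra.
    - rewrite S_INR; replace (a + (INR n + 1)) with (a + INR n + 1) by ring; split; auto.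
      apply ratio_up; auto; replace (a + INR n + 1 - 1) with (a + INR n) by ring; auto. }
  assert (Down : forall n, is_lim (ratio (a - INR n)) p_infty 1 /\ is_lim (ratio (a - INR n + 1)) p_infty 1).
  { induction n as [|n [IH1 IH2]].
    - simpl; rewrite Rminus_0_r; split; apply Base; auto; lra.
    - rewrite S_INR; replace (a - (INR n + 1)) with (a - INR n - 1) by ring; split.
      + apply ratio_down; auto.
      + replace (a - INR n - 1 + 1) with (a - INR n) by ring; auto. }
  destruct (Z.le_gt_cases 0 (Int_part nu + 2)) as [Hz|Hz].
  - destruct (Up (Z.to_nat (Int_part nu + 2))) as [L _].
    rewrite INR_IZR_INZ, Z2Nat.id in L by lia; rewrite plus_IZR in L.
    assert (E : nu = a + (IZR (Int_part nu) + 2)) by (unfold a; lra).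
    rewrite <- E in L; exact L.
  - destruct (Down (Z.to_nat (- (Int_part nu + 2)))) as [L _].
    rewrite INR_IZR_INZ, Z2Nat.id in L by lia; rewrite opp_IZR, plus_IZR in L.
    assert (E : nu = a - - (IZR (Int_part nu) + 2)) by (unfold a; lra).
    rewrite <- E in L; exact L.
Qed.

(** Hence I_(-nu) - I_nu is of smaller order than I_nu, the fact by which K_nu is recognized as
    recessive. *)
Lemma ri_quotient_lim (nu : R) : 0 <= nu -> (forall z : Z, nu <> IZR z) ->
  is_lim (fun t => ri (- nu) t / ri nu t) p_infty 1.
Proof.
  intros Hnu Hz.
  apply is_lim_ext with (fun t => ratio (- nu) t / ratio nu t).
  - intros t; unfold ratio; pose proof (weight_sum_pos t); pose proof (ri_pos nu t Hnu).
    field; split; lra.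
  - replace (Finite 1) with (Rbar_div (Finite 1) (Finite 1)) by (simpl; f_equal; field).
    apply is_lim_div; [| |simpl; intros E; injection E; lra | simpl; auto].
    + apply ratio_lim; intros z E; apply (Hz (- z)%Z); rewrite opp_IZR; lra.
    + apply ratio_lim; auto.
Qed.

(** * The recessive solution on the real line *)

Definition real_bessel (nu : R) (u u1 : R -> R) : Prop := forall t,
  is_derive u t (u1 t) /\ is_derive u1 t ((exp (2 * t) + nu ^ 2) * u t).

(* For u(t) = K_nu(e^t) the last three conditions say that
   max (nu, e^t + 1/2) <= - u' / u <= e^t + nu.  They survive limits in nu, and they
   determine u up to a factor. *)
Definition recessive (nu : R) (u u1 : R -> R) : Prop :=
  real_bessel nu u u1 /\ forall t, 0 < u t /\
    u1 t + nu * u t <= 0 /\ u1 t + (exp t + / 2) * u t <= 0 /\ 0 <= u1 t + (exp t + nu) * u t.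

Lemma wronskian_derive (nu mu : R) (u u1 v v1 : R -> R) (t : R) :
  real_bessel nu u u1 -> real_bessel mu v v1 ->
  is_derive (fun t => u1 t * v t - u t * v1 t) t ((nu ^ 2 - mu ^ 2) * (u t * v t)).
Proof. intros Hu Hv; destruct (Hu t), (Hv t); der; ring. Qed.

Lemma wronskian_constant (nu : R) (u u1 v v1 : R -> R) (t : R) :
  real_bessel nu u u1 -> real_bessel nu v v1 ->
  u1 t * v t - u t * v1 t = u1 0 * v 0 - u 0 * v1 0.
Proof.
  intros Hu Hv.
  assert (D : forall t, is_derive (fun t => u1 t * v t - u t * v1 t) t 0).
  { intros x; eapply is_derive_eq; [apply (wronskian_derive nu nu); auto | eqR; ring]. }
  destruct (Rle_dec 0 t).
  - apply Rle_antisym.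
    + apply (derive_le0_ge (fun t => u1 t * v t - u t * v1 t) (fun _ => 0) 0 t); auto; intros; lra.
    + apply (derive_ge0_le (fun t => u1 t * v t - u t * v1 t) (fun _ => 0) 0 t); auto; intros; lra.
  - apply Rle_antisym.
    + apply (derive_ge0_le (fun t => u1 t * v t - u t * v1 t) (fun _ => 0) t 0); auto; intros; lra.
    + apply (derive_le0_ge (fun t => u1 t * v t - u t * v1 t) (fun _ => 0) t 0); auto; intros; lra.
Qed.

(** Riccati comparison with a = sigma e^t + b. The last hypothesis says a^2 <= e^(2t) + nu^2 + a',
    which makes (u' + a u) exp(-A), A' = a, nondecreasing. If u' + a u were positive at t0, it would
    grow like exp(A), forcing u' >= 1 eventually, against the boundedness of u. *)
Lemma recessive_lower (nu sigma b kappa t0 : R) (u u1 : R -> R) :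
  real_bessel nu u u1 -> (forall t, 0 < u t) -> (forall t, t0 <= t -> u t <= kappa) ->
  0 < b -> 0 <= sigma ->
  (forall t, (sigma * exp t + b) ^ 2 <= exp (2 * t) + nu ^ 2 + sigma * exp t) ->
  u1 t0 + (sigma * exp t0 + b) * u t0 <= 0.
Proof.
  intros Hu Hpos Hbd Hb Hs Ha.
  destruct (Rle_dec (u1 t0 + (sigma * exp t0 + b) * u t0) 0) as [|Hn]; auto; exfalso.
  set (a := fun t => sigma * exp t + b).
  set (gam := fun t => u1 t + a t * u t).
  set (m := fun t => exp (sigma * exp t + b * t)).
  assert (Hm : forall t, 0 < m t) by (intros; apply exp_pos).
  assert (Hgam : forall t, t0 <= t -> gam t0 * exp (- (sigma * exp t0 + b * t0)) <=
            gam t * exp (- (sigma * exp t + b * t))).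
  { intros t Ht.
    apply (derive_ge0_le (fun t => gam t * exp (0 - (sigma * exp t + b * t)))
      (fun t => (exp (2 * t) + nu ^ 2 + sigma * exp t - (sigma * exp t + b) ^ 2) * u t *
         exp (0 - (sigma * exp t + b * t)))) in Ht.
    - replace (- (sigma * exp t0 + b * t0)) with (0 - (sigma * exp t0 + b * t0)) by ring.
      replace (- (sigma * exp t + b * t)) with (0 - (sigma * exp t + b * t)) by ring; auto.
    - intros x Hx; destruct (Hu x); unfold gam, a; der; ring.
    - intros x Hx; apply Rmult_le_pos; [|left; apply exp_pos].
      apply Rmult_le_pos; [specialize (Ha x); lra | left; auto]. }
  set (c := gam t0 * exp (- (sigma * exp t0 + b * t0))).
  assert (Hc : 0 < c).
  { unfold c; apply Rmult_lt_0_compat; [unfold gam, a; lra | apply exp_pos]. }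
  assert (Hg2 : forall t, t0 <= t -> c * m t <= gam t).
  { intros t Ht; specialize (Hgam t Ht); fold c in Hgam.
    apply Rmult_le_compat_r with (r := m t) in Hgam; [|left; auto].
    unfold m in Hgam at 2; rewrite Rmult_assoc, <- exp_plus in Hgam.
    replace (- (sigma * exp t + b * t) + (sigma * exp t + b * t)) with 0 in Hgam by ring.
    rewrite exp_0 in Hgam; lra. }
  assert (Hk : 0 < kappa) by (specialize (Hpos t0); specialize (Hbd t0 ltac:(lra)); lra).
  set (T := Rmax t0 ((((b + 1) * kappa + 1) / c) / b)).
  assert (HT : t0 <= T) by apply Rmax_l.
  assert (Hd : forall t, T <= t -> 1 <= u1 t).
  { intros t Ht; specialize (Hg2 t ltac:(lra)); specialize (Hbd t ltac:(lra)).
    assert (Hbt : ((b + 1) * kappa + 1) / c <= b * t).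
    { apply Rle_trans with (b * T); [|nra].
      rewrite (Rmult_comm b T).
      apply (proj1 (Rle_div_l (((b + 1) * kappa + 1) / c) T b Hb)), Rmax_r. }
    apply (proj1 (Rle_div_l _ _ _ Hc)) in Hbt.
    pose proof (exp_ineq1_le (b * t)) as E1; pose proof (exp_ineq1_le (sigma * exp t)) as E2.
    unfold m in Hg2; rewrite exp_plus in Hg2; unfold gam, a in Hg2.
    pose proof (exp_pos t) as Et; pose proof (Rmult_le_pos _ _ Hs (Rlt_le _ _ Et)) as Es.
    set (q := sigma * exp t) in *.
    assert (G1 : (b + 1) * kappa + 1 <= c * exp (b * t)) by nra.
    assert (G2 : (1 + q) * ((b + 1) * kappa + 1) <= exp q * (c * exp (b * t)))
      by (apply Rmult_le_compat; nra).
    assert (G3 : (q + b) * u t <= (q + b) * kappa) by (apply Rmult_le_compat_l; lra).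
    assert (0 <= q * kappa) by nra. assert (0 <= b * kappa) by nra.
    assert (0 <= q * (b * kappa)) by nra. nra. }
  assert (G : u T + (kappa + 1) <= u (T + (kappa + 1))).
  { pose proof (derive_ge0_le (fun t => u t - t) (fun t => u1 t - 1) T (T + (kappa + 1))
      ltac:(lra)) as M; cbv beta in M.
    assert (M' := M ltac:(intros x Hx; destruct (Hu x); der; ring)
      ltac:(intros x Hx; specialize (Hd x ltac:(lra)); lra)); lra. }
  specialize (Hpos T); specialize (Hbd (T + (kappa + 1)) ltac:(lra)); lra.
Qed.

(** For a = e^t + nu the sign is opposite: e^(2t) + nu^2 + a' - a^2 = (1 - 2 nu) e^t <= 0. A
    negative value of u' + a u would persist and keep u' below a negative constant, so the positive
    u would reach zero. *)
Lemma recessive_upper (nu t0 : R) (u u1 : R -> R) : / 2 <= nu ->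
  real_bessel nu u u1 -> (forall t, 0 < u t) -> 0 <= u1 t0 + (exp t0 + nu) * u t0.
Proof.
  intros Hnu Hu Hpos.
  destruct (Rle_dec 0 (u1 t0 + (exp t0 + nu) * u t0)) as [|Hn]; auto; exfalso.
  set (gam := fun t => u1 t + (exp t + nu) * u t).
  assert (Hgam : forall t, t0 <= t -> gam t <= gam t0).
  { intros t Ht.
    assert (M : gam t * exp (0 - (exp t + nu * t)) <= gam t0 * exp (0 - (exp t0 + nu * t0))).
    { apply (derive_le0_ge (fun t => gam t * exp (0 - (exp t + nu * t)))
      (fun t => (exp (2 * t) - exp t * exp t + (1 - 2 * nu) * exp t) * u t * exp (0 - (exp t + nu * t)))); auto.
      - intros x Hx; destruct (Hu x); unfold gam; der; ring.
      - intros x Hx; replace (2 * x) with (x + x) by ring; rewrite (exp_plus x x).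
        pose proof (exp_pos x); pose proof (exp_pos (0 - (exp x + nu * x))); specialize (Hpos x).
        assert ((1 - 2 * nu) * exp x <= 0) by nra.
        assert (0 <= u x * exp (0 - (exp x + nu * x))) by nra. nra. }
    assert (E : exp (0 - (exp t + nu * t)) <= exp (0 - (exp t0 + nu * t0))).
    { apply exp_le; pose proof (exp_le t0 t Ht); nra. }
    pose proof (exp_pos (0 - (exp t + nu * t))).
    assert (gam t0 < 0) by (unfold gam; lra).
    destruct (Rle_dec (gam t) (gam t0)); auto.
    exfalso; nra. }
  assert (Hg0 : gam t0 < 0) by (unfold gam; lra).
  (* The time after which the line through u(t0) with slope [gam t0] reaches zero. *)
  set (d := u t0 / (- gam t0)).
  assert (Hd : 0 < d) by (apply Rdiv_lt_0_compat; [auto | lra]).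
  assert (G : u (t0 + d) - gam t0 * (t0 + d) <= u t0 - gam t0 * t0).
  { apply (derive_le0_ge (fun t => u t - gam t0 * t) (fun t => u1 t - gam t0)); [lra| |].
    - intros x Hx; destruct (Hu x); der; ring.
    - intros x Hx; specialize (Hgam x ltac:(lra)); unfold gam at 1 in Hgam.
      specialize (Hpos x); pose proof (exp_pos x).
      assert (0 <= (exp x + nu) * u x) by nra. lra. }
  assert (d * gam t0 = - u t0) by (unfold d; field; lra).
  specialize (Hpos (t0 + d)); nra.
Qed.

Lemma is_lim_0_le (f : R -> R) (x t : R) : is_lim f p_infty 0 ->
  (forall t', t <= t' -> x <= f t') -> x <= 0.
Proof.
  intros H Hx; apply is_lim_spec in H; apply le_epsilon; intros eps He.
  destruct (H (mkposreal eps He)) as [M HM]; simpl in HM.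
  pose proof (Rmax_l t (M + 1)); pose proof (Rmax_r t (M + 1)).
  specialize (HM (Rmax t (M + 1)) ltac:(lra)); specialize (Hx _ H0).
  apply Rabs_lt_between in HM; lra.
Qed.

(** Reduction of order: the Wronskian gives (u/I_nu)' = -w/I_nu^2, so u/I_nu decreases strictly to
    its limit 0 and u is positive. What remains is the boundedness that [recessive_lower] asks
    for. *)
Lemma recessive_of_ratio (nu w : R) (u u1 : R -> R) : / 2 <= nu -> 0 < w ->
  real_bessel nu u u1 -> (forall t, u1 t * ri nu t - u t * ri' nu t = - w) ->
  is_lim (fun t => u t / ri nu t) p_infty 0 -> recessive nu u u1.
Proof.
  intros Hnu Hw Hu Hwr Hlim.
  pose proof (fun t => ri_pos nu t ltac:(lra)) as HV.
  pose proof (ri_derive nu) as DV.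
  assert (DI : forall t, is_derive (fun t => / ri nu t) t (- ri' nu t / ri nu t ^ 2)).
  { intros t; apply is_derive_inv_R; auto; specialize (HV t); lra. }
  assert (DQ : forall t, is_derive (fun t => u t * / ri nu t) t (- w * / ri nu t ^ 2)).
  { intros t; destruct (Hu t); specialize (HV t).
    eapply is_derive_eq; [apply (is_derive_mult_R u (fun t => / ri nu t)); eauto|eqR].
    rewrite <- (Hwr t); field; lra. }
  assert (DQle : forall t t', t <= t' -> u t' * / ri nu t' <= u t * / ri nu t).
  { intros t t' Ht.
    apply (derive_le0_ge (fun t => u t * / ri nu t) (fun t => - w * / ri nu t ^ 2)); auto.
    intros x _; assert (0 < / ri nu x ^ 2) by (apply Rinv_0_lt_compat, pow_lt, HV); nra. }
  assert (Hn : forall t, 0 <= u t * / ri nu t).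
  { intros t; apply Ropp_le_cancel; rewrite Ropp_0.
    apply is_lim_0_le with (f := fun t => - (u t / ri nu t)) (t := t).
    - replace (Finite 0) with (Rbar_opp 0) by (simpl; f_equal; ring); apply is_lim_opp; auto.
    - intros t' Ht'; specialize (DQle t t' Ht'); unfold Rdiv; lra. }
  assert (Hpos : forall t, 0 < u t).
  { intros t.
    destruct (mean_value (fun t => u t * / ri nu t) (fun t => - w * / ri nu t ^ 2) t (t + 1))
      as [x [_ E]]; [lra | auto|].
    specialize (Hn (t + 1)).
    assert (0 < / ri nu x ^ 2) by (apply Rinv_0_lt_compat, pow_lt, HV).
    assert (Q : 0 < u t * / ri nu t) by nra.
    specialize (HV t); apply Rmult_lt_compat_r with (r := ri nu t) in Q; auto.
    rewrite Rmult_assoc, Rinv_l in Q by lra; lra. }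
  assert (Hvi : forall t t', t <= t' -> ri nu t <= ri nu t').
  { intros t t' Ht; apply (derive_ge0_le (ri nu) (ri' nu)); auto.
    intros x _; pose proof (ri'_ge nu x ltac:(lra)); specialize (HV x); nra. }
  assert (Hbd : forall t, u t <= w / (2 * nu) * / ri nu t).
  (* As I_nu' >= nu I_nu, the function w/(2 nu I_nu^2) falls at least as fast as u/I_nu, so [g] is
     nondecreasing. It lies below u/I_nu, which tends to 0; hence g <= 0. *)
  { intros t; set (g := fun t => u t * / ri nu t - w / (2 * nu) * (/ ri nu t * / ri nu t)).
    assert (G : g t <= 0).
    { apply is_lim_0_le with (f := fun t => u t / ri nu t) (t := t); auto.
      intros t' Ht'; apply Rle_trans with (g t').
      - apply (derive_ge0_le g (fun t => w / nu * (ri' nu t - nu * ri nu t) * / ri nu t ^ 3)); auto.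
        + intros x _; unfold g; specialize (HV x).
          eapply is_derive_eq; [apply is_derive_minus_R; [apply DQ|];
            apply (is_derive_scal_R (fun t => / ri nu t * / ri nu t)),
              (is_derive_mult_R (fun t => / ri nu t) (fun t => / ri nu t)); apply DI|eqR].
          field; lra.
        + intros x _; pose proof (ri'_ge nu x ltac:(lra)).
          apply Rmult_le_pos; [|left; apply Rinv_0_lt_compat, pow_lt, HV].
          apply Rmult_le_pos; [apply Rdiv_le_0_compat; lra | lra].
      - unfold g, Rdiv.
        assert (0 < / ri nu t') by (apply Rinv_0_lt_compat, HV).
        assert (0 < w * / (2 * nu)) by (apply Rmult_lt_0_compat; auto; apply Rinv_0_lt_compat; lra).
        assert (0 <= w * / (2 * nu) * (/ ri nu t' * / ri nu t')) by (apply Rmult_le_pos; nra). lra. }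
    unfold g in G; specialize (HV t).
    apply Rmult_le_compat_r with (r := ri nu t) in G; [|lra].
    rewrite Rmult_minus_distr_r, !Rmult_assoc, Rinv_l in G by lra; lra. }
  split; auto; intros t.
  assert (Hk : forall t', t <= t' -> u t' <= w / (2 * nu) * / ri nu t).
  { intros t' Ht'; eapply Rle_trans; [apply Hbd|]; apply Rmult_le_compat_l.
    - apply Rdiv_le_0_compat; lra.
    - apply Rinv_le_contravar; auto. }
  split; [auto|split; [|split]].
  (* Two comparison slopes: the constant nu, and e^t + 1/2, for which (e^t + 1/2)^2 = e^(2t) + e^t +
     1/4 and nu >= 1/2 are used. *)
  - pose proof (recessive_lower nu 0 nu _ t u u1 Hu Hpos Hk ltac:(lra) ltac:(lra)) as L.
    rewrite Rmult_0_l, Rplus_0_l in L; apply L.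
    intros x; rewrite Rmult_0_l; pose proof (exp_pos (2 * x)); lra.
  - pose proof (recessive_lower nu 1 (/ 2) _ t u u1 Hu Hpos Hk ltac:(lra) ltac:(lra)) as L.
    rewrite Rmult_1_l in L; apply L.
    intros x; rewrite Rmult_1_l; replace (2 * x) with (x + x) by ring; rewrite exp_plus; nra.
  - apply recessive_upper; auto.
Qed.

Lemma recessive_decay (nu t : R) (u u1 : R -> R) : recessive nu u u1 -> 0 <= t ->
  u t <= u 0 * exp (- (nu * t)).
Proof.
  intros [Hu Hr] Ht.
  assert (M : u t * exp (nu * t) <= u 0 * exp (nu * 0)).
  { apply (derive_le0_ge (fun t => u t * exp (nu * t)) (fun t => (u1 t + nu * u t) * exp (nu * t))); auto.
    - intros x _; destruct (Hu x); der; ring.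
    - intros x _; destruct (Hr x) as [_ [H _]]; pose proof (exp_pos (nu * x)); nra. }
  rewrite Rmult_0_r, exp_0, Rmult_1_r in M.
  rewrite exp_Ropp; pose proof (exp_pos (nu * t)).
  apply Rmult_le_reg_r with (exp (nu * t)); auto; rewrite Rmult_assoc, Rinv_l; lra.
Qed.

Lemma scaled_exp_neg_lim (K : R) : is_lim (fun t => K * exp (- t)) p_infty 0.
Proof.
  replace (Finite 0) with (Rbar_mult K 0) by (simpl; f_equal; ring).
  apply is_lim_scal_l, exp_neg_lim.
Qed.

(** The Wronskian of u and v is u'(0) - v'(0) at 0, tends to 0 at infinity, and has derivative (nu^2
    - mu^2) u v of constant sign. Since (u v)' <= -2 u v, the integral of u v over t >= 0 is at most
    1/2. *)
Lemma recessive_slope_lipschitz (nu mu : R) (u u1 v v1 : R -> R) : 1 <= nu <= mu ->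
  recessive nu u u1 -> recessive mu v v1 -> u 0 = 1 -> v 0 = 1 ->
  0 <= u1 0 - v1 0 <= (mu ^ 2 - nu ^ 2) / 2.
Proof.
  intros Hnu Hu Hv Hu0 Hv0.
  set (om := fun t => u1 t * v t - u t * v1 t).
  pose proof (fun t => wronskian_derive nu mu u u1 v v1 t (proj1 Hu) (proj1 Hv)) as D.
  assert (Hp : forall t, 0 < u t * v t) by
    (intros t; apply Rmult_lt_0_compat; [apply Hu | apply Hv]).
  assert (HM : 0 <= mu ^ 2 - nu ^ 2) by nra.
  assert (Hsmall : forall t, 0 <= t -> u t * v t * exp t <= exp (- t)).
  { intros t Ht.
    pose proof (recessive_decay nu t u u1 Hu Ht) as A; rewrite Hu0, Rmult_1_l in A.
    pose proof (recessive_decay mu t v v1 Hv Ht) as B; rewrite Hv0, Rmult_1_l in B.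
    assert (A' : exp (- (nu * t)) <= exp (- t)) by (apply exp_le; nra).
    assert (B' : exp (- (mu * t)) <= exp (- t)) by (apply exp_le; nra).
    apply Rle_trans with (exp (- t) * exp (- t) * exp t).
    - apply Rmult_le_compat_r; [left; apply exp_pos|].
      destruct Hu as [_ Hu], Hv as [_ Hv]; destruct (Hu t), (Hv t).
      apply Rmult_le_compat; lra.
    - rewrite Rmult_assoc, <- exp_plus, Rplus_opp_l, exp_0; lra. }
  assert (Hom : forall t, 0 <= t -> Rabs (om t) <= (2 + nu + mu) * exp (- t)).
  { intros t Ht; specialize (Hsmall t Ht); specialize (Hp t).
    destruct Hu as [_ Hu], Hv as [_ Hv].
    destruct (Hu t) as [u0 [ua [_ ub]]]; destruct (Hv t) as [v0 [va [_ vb]]].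
    pose proof (exp_ineq1_le t).
    assert (E1 : - ((exp t + nu) * (u t * v t)) <= u1 t * v t <= 0) by nra.
    assert (E2 : - ((exp t + mu) * (u t * v t)) <= u t * v1 t <= 0) by nra.
    assert (E3 : (nu + mu) * (u t * v t) <= (nu + mu) * (u t * v t * exp t)).
    { apply Rmult_le_compat_l; [lra|]; nra. }
    assert (E4 : (nu + mu) * (u t * v t * exp t) <= (nu + mu) * exp (- t))
      by (apply Rmult_le_compat_l; lra).
    unfold om; apply Rabs_le; nra. }
  assert (Hom0 : om 0 = u1 0 - v1 0) by (unfold om; rewrite Hu0, Hv0; ring).
  rewrite <- Hom0; split.
  - apply Ropp_le_cancel; rewrite Ropp_0.
    apply is_lim_0_le with (f := fun t => (2 + nu + mu) * exp (- t)) (t := 0).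
    + apply scaled_exp_neg_lim.
    + intros t Ht; specialize (Hom t Ht); apply Rabs_le_between in Hom.
      assert (om t <= om 0); [|lra].
      apply (derive_le0_ge om (fun t => (nu ^ 2 - mu ^ 2) * (u t * v t))); auto.
      intros x _; specialize (Hp x); nra.
  - apply Rminus_le.
    (* In place of the integral: g' is (mu^2 - nu^2)/2 times the nonnegative -(u v)' - 2 u v. *)
    set (g := fun t => om t - (mu ^ 2 - nu ^ 2) / 2 * (u t * v t)).
    replace (om 0 - (mu ^ 2 - nu ^ 2) / 2) with (g 0) by (unfold g; rewrite Hu0, Hv0; ring).
    apply is_lim_0_le with (f := fun t => (2 + nu + mu) * exp (- t)) (t := 0).
    + apply scaled_exp_neg_lim.
    + intros t Ht; specialize (Hom t Ht); apply Rabs_le_between in Hom.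
      apply Rle_trans with (g t).
      * apply (derive_ge0_le g (fun t => (nu ^ 2 - mu ^ 2) * (u t * v t) -
          (mu ^ 2 - nu ^ 2) / 2 * (u1 t * v t + u t * v1 t))); auto.
        -- intros x _; destruct (proj1 Hu x), (proj1 Hv x).
           apply is_derive_minus_R; [apply D|]; apply is_derive_scal_R; der; ring.
        -- intros x _; destruct Hu as [_ Hu], Hv as [_ Hv].
           destruct (Hu x) as [u0 [ua _]]; destruct (Hv x) as [v0 [va _]].
           assert (u1 x <= - u x) by nra. assert (v1 x <= - v x) by nra.
           assert (u1 x * v x <= - (u x * v x)) by nra.
           assert (u x * v1 x <= - (u x * v x)) by nra.
           assert (0 <= (mu ^ 2 - nu ^ 2) * (- (u1 x * v x + u x * v1 x) - 2 * (u x * v x)))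
             by (apply Rmult_le_pos; lra). lra.
      * unfold g; specialize (Hp t).
        assert (0 <= (mu ^ 2 - nu ^ 2) / 2 * (u t * v t)) by (apply Rmult_le_pos; lra). lra.
Qed.

(** * Macdonald's function for non-integer order *)

Lemma is_bessel_opp (nu : R) (f f1 : C -> C) : is_bessel (- nu) f f1 -> is_bessel nu f f1.
Proof. intros H s; specialize (H s); replace ((- nu) ^ 2) with (nu ^ 2) in H by ring; exact H. Qed.

Lemma ri_near_minus_infty (nu : R) : exists K, 0 <= K /\ forall t, t <= 0 ->
  Rabs (ri nu t - bi_coef nu 0 * exp (nu * t)) <= K * exp ((nu + 2) * t) /\
  Rabs (ri' nu t - nu * bi_coef nu 0 * exp (nu * t)) <= K * exp ((nu + 2) * t).
Proof.
  pose proof (ex_series_bi_dom nu 0) as X; apply ex_series_incr_1 in X.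
  set (K := Series (fun k => bi_dom nu 0 (S k))).
  assert (HK : 0 <= K).
  { apply Series_nonneg; auto; intros k; unfold bi_dom.
    apply Rmult_le_pos; [apply Rabs_pos | left; apply exp_pos]. }
  exists K; split; auto; intros t Ht.
  assert (Hexp : forall k, exp ((nu + 2 * INR (S k)) * t) <= exp ((nu + 2) * t)).
  { intros k; apply exp_le; rewrite S_INR; pose proof (pos_INR k); nra. }
  assert (Hdom : forall k, Rabs (bi_coef nu (S k) * exp ((nu + 2 * INR (S k)) * t)) <=
      exp ((nu + 2) * t) * bi_dom nu 0 (S k) /\
     Rabs (bi_coef nu (S k) * (nu + 2 * INR (S k)) * exp ((nu + 2 * INR (S k)) * t)) <=
      exp ((nu + 2) * t) * bi_dom nu 0 (S k)).
  { intros k; destruct (ri_term_dom nu 0 (S k)) as [A B].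
    rewrite Rmult_0_r, exp_0, Rabs_R0, Rmult_1_r in A, B.
    rewrite !(Rabs_mult _ (exp _)), !(Rabs_pos_eq (exp _)) by (left; apply exp_pos).
    rewrite !(Rmult_comm (Rabs _)); pose proof (exp_pos ((nu + 2 * INR (S k)) * t)).
    split; apply Rmult_le_compat; auto; try apply Rabs_pos; lra. }
  assert (XB : ex_series (fun k => exp ((nu + 2) * t) * bi_dom nu 0 (S k)))
    by (apply ex_series_scal_R; auto).
  assert (Tail : forall a : nat -> R, (forall k, Rabs (a (S k)) <= exp ((nu + 2) * t) * bi_dom nu 0 (S k)) ->
     ex_series a -> Rabs (Series a - a 0%nat) <= K * exp ((nu + 2) * t)).
  { intros a Ha Xa; rewrite (Series_incr_1 a) by auto.
    replace (a 0%nat + Series (fun k => a (S k)) - a 0%nat) with (Series (fun k => a (S k))) by ring.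
    eapply Rle_trans; [apply Series_Rabs|].
    - apply ex_series_dominated with (fun k => exp ((nu + 2) * t) * bi_dom nu 0 (S k)); auto.
      intros k; rewrite Rabs_Rabsolu; auto.
    - unfold K; rewrite Rmult_comm, <- Series_scal_l; apply Series_le; auto.
      intros k; split; [apply Rabs_pos | auto]. }
  split.
  - pose proof (Tail _ (fun k => proj1 (Hdom k)) (ex_series_ri nu t)) as H; cbv beta in H.
    simpl INR in H; rewrite Rmult_0_r, Rplus_0_r in H; exact H.
  - pose proof (Tail _ (fun k => proj2 (Hdom k)) (ex_series_ri' nu t)) as H; cbv beta in H.
    simpl INR in H; rewrite Rmult_0_r, Rplus_0_r, (Rmult_comm (bi_coef nu 0) nu) in H; exact H.
Qed.

Lemma ri_real_bessel (nu : R) : real_bessel nu (ri nu) (ri' nu).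
Proof. intros t; split; [apply ri_derive | apply ri'_derive]. Qed.

Lemma ri_neg_real_bessel (nu : R) : real_bessel nu (ri (- nu)) (ri' (- nu)).
Proof.
  intros t; destruct (ri_real_bessel (- nu) t) as [A B].
  replace ((- nu) ^ 2) with (nu ^ 2) in B by ring; auto.
Qed.

Lemma bi_coef_0_mul (nu : R) : bi_coef nu 0 * bi_coef (- nu) 0 = rgamma (1 + nu) * rgamma (1 - nu).
Proof.
  unfold bi_coef; simpl INR; simpl fact; rewrite Rmult_0_r, !Rplus_0_r; simpl INR.
  replace (nu + 1) with (1 + nu) by ring; replace (- nu + 1) with (1 - nu) by ring.
  replace (rgamma (1 + nu) / 1 * exp (- (nu * ln 2)) * (rgamma (1 - nu) / 1 * exp (- (- nu * ln 2))))
    with (rgamma (1 + nu) * rgamma (1 - nu) * (exp (- (nu * ln 2)) * exp (- (- nu * ln 2)))) by field.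
  rewrite <- exp_plus; replace (- (nu * ln 2) + - (- nu * ln 2)) with 0 by ring.
  rewrite exp_0; ring.
Qed.

(** The Wronskian is independent of t, so it is read off as t -> -oo from the leading terms of the
    two series, whose relative errors are O(e^(2t)). *)
Lemma ri_wronskian (nu t : R) : ri' (- nu) t * ri nu t - ri (- nu) t * ri' nu t =
  - (2 * nu * (rgamma (1 + nu) * rgamma (1 - nu))).
Proof.
  set (W := ri' (- nu) t * ri nu t - ri (- nu) t * ri' nu t).
  rewrite <- bi_coef_0_mul; set (b := bi_coef nu 0); set (c := bi_coef (- nu) 0).
  destruct (ri_near_minus_infty nu) as [K [HK Hb]]; destruct (ri_near_minus_infty (- nu)) as [L [HL Hc]].
  fold b in Hb; fold c in Hc.
  set (P := 2 * (Rabs b + Rabs nu * Rabs b + K) * L + 2 * K * (Rabs c + Rabs nu * Rabs c)).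
  assert (HP : 0 <= P).
  { unfold P; pose proof (Rabs_pos b); pose proof (Rabs_pos c); pose proof (Rabs_pos nu).
    assert (0 <= Rabs nu * Rabs b) by nra. assert (0 <= Rabs nu * Rabs c) by nra.
    assert (0 <= (Rabs b + Rabs nu * Rabs b + K) * L) by (apply Rmult_le_pos; lra).
    assert (0 <= K * (Rabs c + Rabs nu * Rabs c)) by (apply Rmult_le_pos; lra). lra. }
  assert (B : forall x, x <= 0 -> Rabs (W + 2 * nu * (b * c)) <= P * exp (2 * x)).
  { intros x Hx.
    assert (EW : W = ri' (- nu) x * ri nu x - ri (- nu) x * ri' nu x).
    { unfold W; rewrite (wronskian_constant nu _ _ _ _ t (ri_neg_real_bessel nu) (ri_real_bessel nu)).
      symmetry; apply (wronskian_constant nu _ _ _ _ x (ri_neg_real_bessel nu) (ri_real_bessel nu)). }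
    destruct (Hb x Hx) as [b0 b1]; destruct (Hc x Hx) as [c0 c1].
    set (e := exp (2 * x)).
    assert (He : 0 < e <= 1).
    { split; [apply exp_pos|]; rewrite <- exp_0; apply exp_le; lra. }
    assert (E1 : exp ((nu + 2) * x) = exp (nu * x) * e)
      by (unfold e; rewrite <- exp_plus; f_equal; ring).
    assert (E2 : exp ((- nu + 2) * x) = / exp (nu * x) * e)
      by (unfold e; rewrite <- exp_Ropp, <- exp_plus; f_equal; ring).
    assert (E3 : exp (- nu * x) = / exp (nu * x)) by (rewrite <- exp_Ropp; f_equal; ring).
    rewrite E1 in b0, b1; rewrite E2, E3 in c0, c1; set (X := exp (nu * x)) in *.
    assert (HX : 0 < X) by apply exp_pos.
    (* Remainders rescaled by X = e^(nu x) or its inverse, so that these factors cancel in the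
       products and all four remainders are O(e^(2x)). *)
    set (p := (ri nu x - b * X) / X) in *. set (p1 := (ri' nu x - nu * b * X) / X) in *.
    set (q := (ri (- nu) x - c * / X) * X) in *. set (q1 := (ri' (- nu) x - - nu * c * / X) * X) in *.
    assert (Bp : Rabs p <= K * e /\ Rabs p1 <= K * e).
    { unfold p, p1, Rdiv; rewrite !Rabs_mult, Rabs_inv, (Rabs_pos_eq X) by lra.
      split; apply Rle_div_l; auto; nra. }
    assert (Bq : Rabs q <= L * e /\ Rabs q1 <= L * e).
    { unfold q, q1; rewrite !Rabs_mult, (Rabs_pos_eq X) by lra.
      split; (eapply Rle_trans; [apply Rmult_le_compat_r; [lra | eassumption]|]); right; field; lra. }
    assert (E : W + 2 * nu * (b * c) = (b + p) * q1 - q * (nu * b + p1) - nu * c * p - c * p1).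
    { rewrite EW; unfold p, p1, q, q1; field; lra. }
    rewrite E; destruct Bp as [Bp Bp1], Bq as [Bq Bq1].
    pose proof (Rabs_pos b); pose proof (Rabs_pos c); pose proof (Rabs_pos nu).
    assert (T1 : Rabs ((b + p) * q1) <= (Rabs b + K) * (L * e)).
    { rewrite Rabs_mult; apply Rmult_le_compat; try apply Rabs_pos; auto.
      eapply Rle_trans; [apply Rabs_triang|]; nra. }
    assert (T2 : Rabs (q * (nu * b + p1)) <= (L * e) * (Rabs nu * Rabs b + K)).
    { rewrite Rabs_mult; apply Rmult_le_compat; try apply Rabs_pos; auto.
      eapply Rle_trans; [apply Rabs_triang|]; rewrite Rabs_mult; nra. }
    assert (T3 : Rabs (nu * c * p) <= Rabs nu * Rabs c * (K * e)).
    { rewrite !Rabs_mult; apply Rmult_le_compat_l; auto; nra. }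
    assert (T4 : Rabs (c * p1) <= Rabs c * (K * e)).
    { rewrite Rabs_mult; apply Rmult_le_compat_l; auto. }
    unfold Rminus; eapply Rle_trans; [apply Rabs_triang|].
    eapply Rle_trans; [apply Rplus_le_compat_r, Rabs_triang|].
    eapply Rle_trans; [do 2 apply Rplus_le_compat_r; apply Rabs_triang|].
    rewrite !Rabs_Ropp; unfold P.
    assert (0 <= L * e) by nra. assert (0 <= K * e) by nra.
    assert (0 <= Rabs nu * Rabs c * (K * e)) by (apply Rmult_le_pos; nra).
    assert (0 <= Rabs c * (K * e)) by nra.
    assert (0 <= Rabs b * (L * e)) by nra.
    assert (0 <= Rabs nu * Rabs b * (L * e)) by (apply Rmult_le_pos; nra). nra. }
  assert (Z : Rabs (W + 2 * nu * (b * c)) <= 0).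
  { apply is_lim_0_le with (f := fun t => P * exp (- t)) (t := 0); [apply scaled_exp_neg_lim|].
    intros x Hx; eapply Rle_trans; [apply (B (- x)); lra|].
    apply Rmult_le_compat_l; auto; apply exp_le; lra. }
  pose proof (Rabs_pos (W + 2 * nu * (b * c))).
  assert (Rabs (W + 2 * nu * (b * c)) = 0) by lra.
  destruct (Req_dec (W + 2 * nu * (b * c)) 0) as [|Hne]; [lra|].
  apply Rabs_no_R0 in Hne; lra.
Qed.

(** Each step nu -> nu + 1 changes the sign of both factors, by sin(x + pi) = -sin x and the
    functional equation, so the product keeps its sign on (0,1). This does duty for the reflection
    formula. *)
Lemma sin_rgamma_pos (nu : R) : 0 < nu -> (forall z : Z, nu <> IZR z) ->
  0 < sin (nu * PI) * rgamma (1 - nu).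
Proof.
  assert (Ind : forall m nu, INR m < nu < INR m + 1 -> 0 < sin (nu * PI) * rgamma (1 - nu)).
  { clear; induction m as [|m IH]; intros nu Hnu.
    - simpl in Hnu; pose proof PI_RGT_0; apply Rmult_lt_0_compat; [apply sin_gt_0; nra|].
      apply rgamma_pos; lra.
    - rewrite S_INR in Hnu; specialize (IH (nu - 1) ltac:(lra)); pose proof (pos_INR m).
      rewrite (rgamma_step (1 - nu)); replace (1 - nu + 1) with (1 - (nu - 1)) by ring.
      replace (nu * PI) with ((nu - 1) * PI + PI) by ring; rewrite neg_sin; nra. }
  intros Hnu Hz.
  destruct (nfloor_ex nu ltac:(lra)) as [m Hm]; apply (Ind m); split; [|lra].
  destruct (Rle_lt_or_eq_dec _ _ (proj1 Hm)); auto.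
  exfalso; apply (Hz (Z.of_nat m)); rewrite <- INR_IZR_INZ; auto.
Qed.

Lemma sin_nonint (nu : R) : sin (nu * PI) <> 0 <-> (forall z : Z, nu <> IZR z).
Proof.
  pose proof PI_RGT_0 as Hpi; split.
  - intros H z E; apply H, sin_eq_0_1; exists z; rewrite E; ring.
  - intros H E; apply sin_eq_0_0 in E; destruct E as [z E].
    apply (H z); apply Rmult_eq_reg_r with PI; lra.
Qed.

Lemma nonint_near (z : Z) (y : R) : Rabs (y - IZR z) < 1 -> y <> IZR z -> forall k : Z, y <> IZR k.
Proof.
  intros H Hne k E; rewrite E, <- minus_IZR in H; apply Rabs_lt_between in H.
  destruct H as [H1 H2]; change (- (1)) with (-1) in H1.
  apply lt_IZR in H1; apply lt_IZR in H2; apply Hne; rewrite E; f_equal; lia.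
Qed.

Definition kn (nu : R) (s : C) : C := (RtoC (PI / 2 / sin (nu * PI)) * (bi (- nu) s - bi nu s))%C.

Definition kn' (nu : R) (s : C) : C := (RtoC (PI / 2 / sin (nu * PI)) * (bi' (- nu) s - bi' nu s))%C.

Lemma kn_is_bessel (nu : R) : is_bessel nu (kn nu) (kn' nu).
Proof.
  apply (is_bessel_scal nu _ (fun s => bi (- nu) s - bi nu s)%C (fun s => bi' (- nu) s - bi' nu s)%C).
  replace (fun s => (bi (- nu) s - bi nu s)%C) with (fun s => (bi (- nu) s + -1 * bi nu s)%C)
    by (apply functional_extensionality; intros; ring).
  replace (fun s => (bi' (- nu) s - bi' nu s)%C) with (fun s => (bi' (- nu) s + -1 * bi' nu s)%C)
    by (apply functional_extensionality; intros; ring).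
  apply is_bessel_plus; [apply is_bessel_opp|apply is_bessel_scal]; apply bi_is_bessel.
Qed.

Definition rk (nu t : R) : R := PI / 2 / sin (nu * PI) * (ri (- nu) t - ri nu t).

Definition rk' (nu t : R) : R := PI / 2 / sin (nu * PI) * (ri' (- nu) t - ri' nu t).

Lemma kn_RtoC (nu t : R) : kn nu (RtoC t) = RtoC (rk nu t).
Proof. unfold kn, rk; rewrite !bi_RtoC, <- RtoC_minus, <- RtoC_mult; reflexivity. Qed.

Lemma kn'_RtoC (nu t : R) : kn' nu (RtoC t) = RtoC (rk' nu t).
Proof. unfold kn', rk'; rewrite !bi'_RtoC, <- RtoC_minus, <- RtoC_mult; reflexivity. Qed.

(** By the reflection formula this is 1. The form isolates the quotient of [rgamma (1 - nu)] and the
    sine, whose sign and whose limits at positive integers are found by unit steps in nu. *)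
Definition k_wronskian (nu : R) : R := PI * nu * rgamma (1 + nu) * (rgamma (1 - nu) / sin (nu * PI)).

Lemma rk_wronskian (nu t : R) : sin (nu * PI) <> 0 ->
  rk' nu t * ri nu t - rk nu t * ri' nu t = - k_wronskian nu.
Proof.
  intros Hs; pose proof (ri_wronskian nu t) as W; unfold rk, rk', k_wronskian.
  replace (PI / 2 / sin (nu * PI) * (ri' (- nu) t - ri' nu t) * ri nu t -
    PI / 2 / sin (nu * PI) * (ri (- nu) t - ri nu t) * ri' nu t) with
    (PI / 2 / sin (nu * PI) * (ri' (- nu) t * ri nu t - ri (- nu) t * ri' nu t)) by ring.
  rewrite W; field; auto.
Qed.

Lemma rk_recessive (nu : R) : 1 <= nu -> (forall z : Z, nu <> IZR z) -> recessive nu (rk nu) (rk' nu).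
Proof.
  intros Hnu Hz; pose proof (proj2 (sin_nonint nu) Hz) as Hs.
  apply recessive_of_ratio with (k_wronskian nu); [lra| | | |].
  - pose proof (sin_rgamma_pos nu ltac:(lra) Hz) as P; pose proof (rgamma_pos (1 + nu) ltac:(lra)).
    unfold k_wronskian; pose proof PI_RGT_0.
    apply Rmult_lt_0_compat; [apply Rmult_lt_0_compat; nra|].
    assert (0 < sin (nu * PI) ^ 2) by (pose proof (pow2_gt_0 _ Hs); lra).
    replace (rgamma (1 - nu) / sin (nu * PI)) with (sin (nu * PI) * rgamma (1 - nu) / sin (nu * PI) ^ 2)
      by (field; auto).
    apply Rdiv_lt_0_compat; auto.
  - intros t; destruct (bessel_real_line nu _ _ (kn_is_bessel nu) t) as [A B].
    rewrite kn'_RtoC in A; rewrite kn_RtoC in B; split.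
    + refine (is_derive_ext _ _ _ _ _ A); intros x; rewrite kn_RtoC; reflexivity.
    + refine (is_derive_ext _ _ _ _ _ B); intros x; rewrite kn'_RtoC; reflexivity.
  - intros t; apply rk_wronskian; auto.
  - apply is_lim_ext with (fun t => PI / 2 / sin (nu * PI) * (ri (- nu) t / ri nu t - 1)).
    + intros t; unfold rk; pose proof (ri_pos nu t ltac:(lra)); field; split; auto; lra.
    + replace (Finite 0) with (Rbar_mult (PI / 2 / sin (nu * PI)) (Finite (1 - 1)))
        by (simpl; f_equal; ring).
      apply is_lim_scal_l, is_lim_minus'; [apply ri_quotient_lim; auto; lra | apply is_lim_const].
Qed.

(** * Macdonald's function normalized at z = 1 *)

(** A function paired with its derivative. The value 1 at s = 0, that is z = 1, eliminates the
    factor 1/sin(nu pi), singular at integer orders; real initial values make the solution real on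
    the real line. *)
Definition normalized (nu : R) (p : (C -> C) * (C -> C)) : Prop :=
  is_bessel nu (fst p) (snd p) /\ fst p 0%C = 1%C /\ Im (snd p 0%C) = 0 /\
  recessive nu (fun t => Re (fst p (RtoC t))) (fun t => Re (snd p (RtoC t))).

Lemma recessive_scal (nu c : R) (u u1 : R -> R) : 0 < c -> recessive nu u u1 ->
  recessive nu (fun t => c * u t) (fun t => c * u1 t).
Proof.
  intros Hc [Hu Hr]; split.
  - intros t; destruct (Hu t); split; [apply is_derive_scal_R; auto|].
    eapply is_derive_eq; [apply is_derive_scal_R; eassumption | eqR; ring].
  - intros t; destruct (Hr t) as [h0 [h1 [h2 h3]]]; repeat split; nra.
Qed.

Lemma normalized_nonint (nu : R) : 1 <= nu -> (forall z : Z, nu <> IZR z) ->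
  normalized nu (fun s => RtoC (/ rk nu 0) * kn nu s, fun s => RtoC (/ rk nu 0) * kn' nu s)%C.
Proof.
  intros Hnu Hz; pose proof (rk_recessive nu Hnu Hz) as Hr.
  assert (Hg : 0 < rk nu 0) by apply Hr.
  split; [|split; [|split]]; cbn [fst snd].
  - apply is_bessel_scal, kn_is_bessel.
  - rewrite kn_RtoC, <- RtoC_mult; f_equal; field; lra.
  - rewrite kn'_RtoC, <- RtoC_mult; reflexivity.
  - replace (fun t => Re (RtoC (/ rk nu 0) * kn nu (RtoC t))) with (fun t => / rk nu 0 * rk nu t)
      by (apply functional_extensionality; intros; rewrite kn_RtoC, Re_RtoC_mul; reflexivity).
    replace (fun t => Re (RtoC (/ rk nu 0) * kn' nu (RtoC t))) with (fun t => / rk nu 0 * rk' nu t)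
      by (apply functional_extensionality; intros; rewrite kn'_RtoC, Re_RtoC_mul; reflexivity).
    apply recessive_scal; auto; apply Rinv_0_lt_compat; auto.
Qed.

(** For nu = mu this is uniqueness of the normalized solution, which later identifies the chosen
    [kt] with the explicit formula. *)
Lemma normalized_slope_lipschitz (nu mu : R) (p q : (C -> C) * (C -> C)) : 1 <= nu -> 1 <= mu ->
  normalized nu p -> normalized mu q ->
  Rabs (Re (snd p 0%C) - Re (snd q 0%C)) <= Rabs (nu ^ 2 - mu ^ 2) / 2.
Proof.
  intros Hnu Hmu [_ [p0 [_ Rp]]] [_ [q0 [_ Rq]]].
  assert (P0 : Re (fst p (RtoC 0)) = 1) by (rewrite p0; reflexivity).
  assert (Q0 : Re (fst q (RtoC 0)) = 1) by (rewrite q0; reflexivity).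
  destruct (Rle_dec nu mu) as [H|H].
  - pose proof (recessive_slope_lipschitz nu mu _ _ _ _ (conj Hnu H) Rp Rq P0 Q0) as L.
    cbv beta in L; rewrite (Rabs_left1 (nu ^ 2 - mu ^ 2)) by nra.
    rewrite Rabs_pos_eq by lra; lra.
  - assert (H' : mu <= nu) by lra.
    pose proof (recessive_slope_lipschitz mu nu _ _ _ _ (conj Hmu H') Rq Rp Q0 P0) as L.
    cbv beta in L; rewrite (Rabs_pos_eq (nu ^ 2 - mu ^ 2)) by nra.
    rewrite Rabs_left1 by lra; lra.
Qed.

Lemma normalized_slope_bound (nu : R) (p : (C -> C) * (C -> C)) : 1 <= nu -> normalized nu p ->
  - (1 + nu) <= Re (snd p 0%C) <= 0.
Proof.
  intros Hnu [_ [p0 [_ [_ Rp]]]]; destruct (Rp 0) as [_ [A [_ B]]].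
  rewrite p0, exp_0 in *; simpl Re in *; lra.
Qed.

Lemma Re_sub_le (x y : C) : Rabs (Re x - Re y) <= Cmod (x - y)%C.
Proof. eapply Rle_trans; [|apply re_le_Cmod]; right; f_equal. Qed.

Lemma Cconverges_Re_le (u v : nat -> C) (a b : R) (l m : C) : Cconverges u l -> Cconverges v m ->
  (forall j, 0 <= a * Re (u j) + b * Re (v j)) -> 0 <= a * Re l + b * Re m.
Proof.
  intros Hu Hv H; apply le_epsilon; intros eps He.
  pose proof (Rabs_pos a); pose proof (Rabs_pos b).
  set (d := eps / (Rabs a + Rabs b + 1)).
  assert (Hd : 0 < d) by (apply Rdiv_lt_0_compat; lra).
  assert (Hdd : d * (Rabs a + Rabs b + 1) = eps) by (unfold d; field; lra).
  destruct (Hu d Hd) as [N HN]; destruct (Hv d Hd) as [M HM].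
  specialize (HN (max N M) ltac:(lia)); specialize (HM (max N M) ltac:(lia)).
  specialize (H (max N M)); pose proof (Re_sub_le (u (max N M)) l); pose proof (Re_sub_le (v (max N M)) m).
  set (x := Re (u (max N M))) in *; set (y := Re (v (max N M))) in *.
  pose proof (Rle_abs (a * (x - Re l))) as A; pose proof (Rle_abs (b * (y - Re m))) as B.
  rewrite Rabs_mult in A, B.
  assert (Rabs a * Rabs (x - Re l) <= Rabs a * d) by (apply Rmult_le_compat_l; lra).
  assert (Rabs b * Rabs (y - Re m) <= Rabs b * d) by (apply Rmult_le_compat_l; lra). nra.
Qed.

Lemma Cconverges_const (l : C) : Cconverges (fun _ => l) l.
Proof.
  intros eps He; exists 0%nat; intros; replace (l - l)%C with (RtoC 0) by ring; rewrite Cmod_0; lra.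
Qed.

(** The slopes at 0 are Cauchy by the Lipschitz bound, so [bessel_limit] gives a solution and the
    inequalities of [recessive] pass to the limit. Only strict positivity is lost and has to be
    recovered. *)
Lemma normalized_limit (nu : nat -> R) (nu0 : R) (p : nat -> (C -> C) * (C -> C)) :
  (forall j, 1 <= nu0 <= nu j) -> (forall j, normalized (nu j) (p j)) ->
  (forall eps, 0 < eps -> exists N, forall j, (N <= j)%nat -> Rabs (nu j - nu0) <= eps) ->
  exists q, normalized nu0 q.
Proof.
  intros Hnu Hp Hlim.
  destruct (Ccauchy_converges (fun j => snd (p j) 0%C)) as [b Hb].
  { intros eps He; destruct (Hlim (Rmin 1 (eps / (2 * (nu0 + 1))))) as [N HN].
    { apply Rmin_pos; [lra | apply Rdiv_lt_0_compat; [lra|]; specialize (Hnu 0%nat); lra]. }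
    exists N; intros i j Hi Hj.
    pose proof (normalized_slope_lipschitz (nu i) (nu j) (p i) (p j)
      ltac:(specialize (Hnu i); lra) ltac:(specialize (Hnu j); lra) (Hp i) (Hp j)) as L.
    assert (E : Cmod (snd (p i) 0%C - snd (p j) 0%C)%C = Rabs (Re (snd (p i) 0%C) - Re (snd (p j) 0%C))).
    { destruct (Hp i) as [_ [_ [Ii _]]], (Hp j) as [_ [_ [Ij _]]].
      rewrite <- Cmod_R; f_equal; apply C_eq; [reflexivity|].
      replace (Im (snd (p i) 0%C - snd (p j) 0%C)%C) with (Im (snd (p i) 0%C) - Im (snd (p j) 0%C))
        by reflexivity; rewrite Ii, Ij; simpl; ring. }
    rewrite E; eapply Rle_trans; [apply L|].
    pose proof (HN i Hi) as A; pose proof (HN j Hj) as B.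
    pose proof (Rmin_l 1 (eps / (2 * (nu0 + 1)))) as M1; pose proof (Rmin_r 1 (eps / (2 * (nu0 + 1)))) as M2.
    set (d := Rmin 1 (eps / (2 * (nu0 + 1)))) in *.
    pose proof (Hnu i); pose proof (Hnu j).
    assert (D : d * (2 * (nu0 + 1)) <= eps) by (apply (proj2 (Rle_div_r d eps (2 * (nu0 + 1)) ltac:(lra)) M2)).
    rewrite Rabs_pos_eq in A by lra; rewrite Rabs_pos_eq in B by lra.
    apply Rle_trans with ((2 * (nu0 + 1)) * d); [|lra].
    replace (nu i ^ 2 - nu j ^ 2) with ((nu i + nu j) * (nu i - nu j)) by ring.
    rewrite Rabs_mult, (Rabs_pos_eq (nu i + nu j)) by lra.
    assert (Rabs (nu i - nu j) <= d) by (apply Rabs_le; lra).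
    assert ((nu i + nu j) * Rabs (nu i - nu j) <= (2 * nu0 + 2) * d).
    { apply Rmult_le_compat; try lra; apply Rabs_pos. }
    pose proof (Rabs_pos (nu i - nu j)).
    assert (0 <= (nu i + nu j) * Rabs (nu i - nu j)) by (apply Rmult_le_pos; lra).
    lra. }
  assert (Ha : Cconverges (fun j => fst (p j) 0%C) 1).
  { apply Cconverges_ext with (fun _ => 1%C); [|apply Cconverges_const].
    intros j; symmetry; apply (Hp j). }
  destruct (bessel_limit nu (fun j => fst (p j)) (fun j => snd (p j)) nu0 1 b (fun j => proj1 (Hp j))
    Hlim Ha Hb) as [g [g1 [Hg [g0 [g10 HL]]]]].
  assert (HRe : forall t, (0 <= Re (g (RtoC t))) /\
    Re (g1 (RtoC t)) + nu0 * Re (g (RtoC t)) <= 0 /\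
    Re (g1 (RtoC t)) + (exp t + / 2) * Re (g (RtoC t)) <= 0 /\
    (forall eps, 0 < eps -> 0 <= Re (g1 (RtoC t)) + (exp t + nu0 + eps) * Re (g (RtoC t)))).
  { intros t; destruct (HL (RtoC t)) as [L L1]; split; [|split; [|split]].
    - pose proof (Cconverges_Re_le _ _ 1 0 _ _ L L1) as X; cbv beta in X.
      assert (0 <= 1 * Re (g (RtoC t)) + 0 * Re (g1 (RtoC t))); [apply X|lra].
      intros j; destruct (Hp j) as [_ [_ [_ [_ R]]]]; destruct (R t); lra.
    - pose proof (Cconverges_Re_le _ _ (- nu0) (- (1)) _ _ L L1) as X; cbv beta in X.
      assert (0 <= - nu0 * Re (g (RtoC t)) + - (1) * Re (g1 (RtoC t))); [apply X|lra].
      intros j; destruct (Hp j) as [_ [_ [_ [_ R]]]]; destruct (R t) as [r0 [r1 _]]; specialize (Hnu j); nra.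
    - pose proof (Cconverges_Re_le _ _ (- (exp t + / 2)) (- (1)) _ _ L L1) as X; cbv beta in X.
      assert (0 <= - (exp t + / 2) * Re (g (RtoC t)) + - (1) * Re (g1 (RtoC t))); [apply X|lra].
      intros j; destruct (Hp j) as [_ [_ [_ [_ R]]]]; destruct (R t) as [r0 [_ [r1 _]]]; lra.
    (* The upper bound contains the order nu j >= nu0, so it passes to the limit first with eps
       added and finitely many terms dropped; [HRe'] then removes eps. *)
    - intros eps He; destruct (Hlim eps He) as [N HN].
      pose proof (Cconverges_Re_le (fun j => fst (p (j + N)%nat) (RtoC t)) (fun j => snd (p (j + N)%nat) (RtoC t))
         (exp t + nu0 + eps) 1 (g (RtoC t)) (g1 (RtoC t))) as X.
      assert (Sh : forall u l, Cconverges u l -> Cconverges (fun j => u (j + N)%nat) l).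
      { intros u l H e h; destruct (H e h) as [P HP]; exists P; intros; apply HP; lia. }
      specialize (X (Sh _ _ L) (Sh _ _ L1)).
      assert (0 <= (exp t + nu0 + eps) * Re (g (RtoC t)) + 1 * Re (g1 (RtoC t))); [apply X|lra].
      intros j; destruct (Hp (j + N)%nat) as [_ [_ [_ [_ R]]]]; destruct (R t) as [r0 [_ [_ r1]]].
      specialize (HN (j + N)%nat ltac:(lia)); apply Rabs_le_between in HN; nra. }
  assert (HRe' : forall t, 0 <= Re (g1 (RtoC t)) + (exp t + nu0) * Re (g (RtoC t))).
  { intros t; apply le_epsilon; intros eps He.
    destruct (HRe t) as [h0 [_ [_ h]]].
    specialize (h (eps / (Re (g (RtoC t)) + 1)) ltac:(apply Rdiv_lt_0_compat; lra)).
    assert (eps / (Re (g (RtoC t)) + 1) * Re (g (RtoC t)) <= eps).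
    { apply Rle_trans with (eps / (Re (g (RtoC t)) + 1) * (Re (g (RtoC t)) + 1)).
      - apply Rmult_le_compat_l; [apply Rdiv_le_0_compat; lra | lra].
      - right; field; lra. }
    lra. }
  pose proof (bessel_real_line nu0 g g1 Hg) as D.
  assert (g0' : Re (g (RtoC 0)) = 1) by (rewrite g0; reflexivity).
  exists (g, g1); split; [|split; [|split]]; simpl; auto.
  - rewrite g10.
    assert (Im b = 0); auto.
    apply Rle_antisym.
    + apply le_epsilon; intros eps He; destruct (Hb eps He) as [N HN]; specialize (HN N (le_n _)).
      destruct (Hp N) as [_ [_ [I0 _]]].
      pose proof (im_le_Cmod (snd (p N) 0%C - b)%C) as X.
      replace (Im (snd (p N) 0%C - b)%C) with (Im (snd (p N) 0%C) - Im b) in X by reflexivity.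
      rewrite I0 in X; assert (X' : Rabs (0 - Im b) <= eps) by lra; apply Rabs_le_between in X'; lra.
    + apply le_epsilon; intros eps He; destruct (Hb eps He) as [N HN]; specialize (HN N (le_n _)).
      destruct (Hp N) as [_ [_ [I0 _]]].
      pose proof (im_le_Cmod (snd (p N) 0%C - b)%C) as X.
      replace (Im (snd (p N) 0%C - b)%C) with (Im (snd (p N) 0%C) - Im b) in X by reflexivity.
      rewrite I0 in X; assert (X' : Rabs (0 - Im b) <= eps) by lra; apply Rabs_le_between in X'; lra.
  - split; [exact D|].
    intros t; destruct (HRe t) as [h0 [h1 [h2 _]]]; repeat split; auto.
    specialize (Hnu 0%nat).
    (* Positivity is propagated from the value 1 at t = 0: for t <= 0 the function is nonincreasing,
       for t > 0 multiplication by exp(e^t + nu0 t) makes it nondecreasing. *)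
    destruct (Rle_dec t 0) as [Ht|Ht].
    + assert (M : Re (g (RtoC 0)) <= Re (g (RtoC t))); [|lra].
      apply (derive_le0_ge (fun t => Re (g (RtoC t))) (fun t => Re (g1 (RtoC t)))); auto.
      * intros x _; apply D.
      * intros x _; destruct (HRe x) as [k0 [k1 _]]; nra.
    + assert (M : Re (g (RtoC 0)) * exp (exp 0 + nu0 * 0) <= Re (g (RtoC t)) * exp (exp t + nu0 * t)).
      { apply (derive_ge0_le (fun t => Re (g (RtoC t)) * exp (exp t + nu0 * t))
         (fun t => (Re (g1 (RtoC t)) + (exp t + nu0) * Re (g (RtoC t))) * exp (exp t + nu0 * t))); [lra| |].
        - intros x _; destruct (D x) as [D1 _]; der; ring.
        - intros x _; apply Rmult_le_pos; [apply HRe' | left; apply exp_pos]. }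
      rewrite g0' in M; pose proof (exp_pos (exp 0 + nu0 * 0)); pose proof (exp_pos (exp t + nu0 * t)).
      destruct (Rle_lt_or_eq_dec _ _ h0) as [|Z]; auto.
      rewrite <- Z in M; lra.
Qed.

(** Non-integer orders use the explicit formula, integers the limit from above along nu + 1/(j+2).
    The condition 1 <= nu stands under the existential so that choice yields a function of every
    real order. *)
Lemma normalized_exists (nu : R) : exists p, 1 <= nu -> normalized nu p.
Proof.
  destruct (Rle_dec 1 nu) as [Hnu|Hnu]; [|exists (fun s => s, fun s => s); lra].
  destruct (classic (forall z : Z, nu <> IZR z)) as [Hz|Hz].
  { eexists; intros _; apply normalized_nonint; auto. }
  apply not_all_not_ex in Hz; destruct Hz as [z Hz].
  assert (Hpos : forall j, 0 < / (INR j + 2) <= / 2).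
  { intros j; pose proof (pos_INR j); split; [apply Rinv_0_lt_compat; lra|].
    apply Rinv_le_contravar; lra. }
  destruct (normalized_limit (fun j => nu + / (INR j + 2)) nu
    (fun j => (fun s => RtoC (/ rk (nu + / (INR j + 2)) 0) * kn (nu + / (INR j + 2)) s,
               fun s => RtoC (/ rk (nu + / (INR j + 2)) 0) * kn' (nu + / (INR j + 2)) s)%C)) as [q Hq].
  - intros j; specialize (Hpos j); lra.
  - intros j; apply normalized_nonint; [specialize (Hpos j); lra|].
    specialize (Hpos j); apply (nonint_near z); [rewrite Rabs_pos_eq; lra | lra].
  - intros eps He; destruct (nfloor_ex (/ eps)) as [N HN]; [left; apply Rinv_0_lt_compat; auto|].
    exists N; intros j Hj; apply le_INR in Hj.
    replace (nu + / (INR j + 2) - nu) with (/ (INR j + 2)) by ring.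
    specialize (Hpos j); rewrite Rabs_pos_eq by lra.
    rewrite <- (Rinv_inv eps); apply Rinv_le_contravar; [apply Rinv_0_lt_compat; auto | lra].
  - exists q; auto.
Qed.

(* [kt nu s] is K_nu(e^s) / K_nu(1), for nu >= 1. *)
Definition kt_pair (nu : R) : (C -> C) * (C -> C) :=
  proj1_sig (constructive_indefinite_description _ (normalized_exists nu)).

Definition kt (nu : R) : C -> C := fst (kt_pair nu).

Definition kt' (nu : R) : C -> C := snd (kt_pair nu).

Lemma kt_normalized (nu : R) : 1 <= nu -> normalized nu (kt_pair nu).
Proof. exact (proj2_sig (constructive_indefinite_description _ (normalized_exists nu))). Qed.

Lemma kt_is_bessel (nu : R) : 1 <= nu -> is_bessel nu (kt nu) (kt' nu).
Proof. intros H; apply (kt_normalized nu H). Qed.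

Lemma kt_0 (nu : R) : 1 <= nu -> kt nu 0%C = 1%C.
Proof. intros H; apply (kt_normalized nu H). Qed.

Lemma kt_recessive (nu : R) : 1 <= nu ->
  recessive nu (fun t => Re (kt nu (RtoC t))) (fun t => Re (kt' nu (RtoC t))).
Proof. intros H; apply (kt_normalized nu H). Qed.

Lemma kt_conj (nu : R) (s : C) : 1 <= nu ->
  kt nu (Cconj s) = Cconj (kt nu s) /\ kt' nu (Cconj s) = Cconj (kt' nu s).
Proof.
  intros H; destruct (kt_normalized nu H) as [A [B [D _]]].
  apply (bessel_real nu); auto.
  fold (kt nu) in B; fold (kt nu); rewrite kt_0 by auto; reflexivity.
Qed.

Lemma Cconj_RtoC (t : R) : Cconj (RtoC t) = RtoC t.
Proof. apply C_eq; simpl; ring. Qed.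

Lemma Im_conj_fixed (z : C) : z = Cconj z -> z = RtoC (Re z).
Proof. intros E; apply (f_equal Im) in E; rewrite im_conj in E; apply C_eq; simpl; lra. Qed.

Lemma kt_real (nu t : R) : 1 <= nu -> kt nu (RtoC t) = RtoC (Re (kt nu (RtoC t))) /\
  kt' nu (RtoC t) = RtoC (Re (kt' nu (RtoC t))).
Proof.
  intros H; destruct (kt_conj nu (RtoC t) H) as [A B]; rewrite Cconj_RtoC in A, B.
  split; apply Im_conj_fixed; auto.
Qed.

(** Continuous dependence on the data combined with the Lipschitz bound on the slope; integer orders
    are no exception. *)
Lemma kt_continuity (T N : R) : 1 <= T -> 1 <= N -> exists K, 0 < K /\
  forall nu mu s, 1 <= nu <= N -> 1 <= mu <= N -> Cmod s <= T ->
  Cmod (kt nu s - kt mu s)%C <= K * Rabs (nu - mu) /\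
  Cmod (kt' nu s - kt' mu s)%C <= K * Rabs (nu - mu).
Proof.
  intros HT HN; set (N' := 1 + (1 + N) ^ 2).
  destruct (bessel_continuity T N') as [K [HK H]]; [auto | unfold N'; nra|].
  exists ((K + 1) * (N + 1)); split; [nra|].
  intros nu mu s Hnu Hmu Hs.
  pose proof (normalized_slope_lipschitz nu mu _ _ (proj1 Hnu) (proj1 Hmu)
    (kt_normalized nu (proj1 Hnu)) (kt_normalized mu (proj1 Hmu))) as L; fold (kt' nu) (kt' mu) in L.
  pose proof (normalized_slope_bound mu _ (proj1 Hmu) (kt_normalized mu (proj1 Hmu))) as B; fold (kt' mu) in B.
  destruct (kt_real nu 0 (proj1 Hnu)) as [_ Rn]; destruct (kt_real mu 0 (proj1 Hmu)) as [_ Rm].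
  specialize (H nu mu (kt nu) (kt' nu) (kt mu) (kt' mu)).
  assert (H' := H ltac:(unfold N'; rewrite Rabs_pos_eq; nra) ltac:(unfold N'; rewrite Rabs_pos_eq; nra)
    (kt_is_bessel nu (proj1 Hnu)) (kt_is_bessel mu (proj1 Hmu))); clear H.
  rewrite Rn, Rm, !kt_0, <- !RtoC_minus, !Cmod_R in H' by lra.
  rewrite !pow2_abs in H'; replace (1 - 1) with 0 in H' by ring.
  assert (H2 := H' ltac:(unfold N'; nra) s Hs); clear H'.
  set (d := Rabs (nu - mu)) in *.
  assert (Hd : 0 <= d) by apply Rabs_pos.
  assert (Hd2 : (nu - mu) ^ 2 = d ^ 2) by (unfold d; rewrite pow2_abs; auto).
  assert (L2 : Rabs (Re (kt' nu 0%C) - Re (kt' mu 0%C)) <= N * d).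
  { eapply Rle_trans; [exact L|].
    replace (nu ^ 2 - mu ^ 2) with ((nu + mu) * (nu - mu)) by ring.
    rewrite Rabs_mult, (Rabs_pos_eq (nu + mu)) by lra; fold d; nra. }
  assert (L3 : (Re (kt' nu 0%C) - Re (kt' mu 0%C)) ^ 2 <= (N * d) ^ 2).
  { rewrite <- pow2_abs; apply pow_incr; split; [apply Rabs_pos | auto]. }
  assert (Hfin : Cmod (kt nu s - kt mu s)%C ^ 2 + Cmod (kt' nu s - kt' mu s)%C ^ 2 <=
     ((K + 1) * (N + 1) * d) ^ 2).
  { eapply Rle_trans; [exact H2|]; rewrite Hd2.
    apply Rle_trans with (K * ((N ^ 2 + 1) * d ^ 2)); [apply Rmult_le_compat_l; lra|].
    replace (((K + 1) * (N + 1) * d) ^ 2) with ((K + 1) ^ 2 * ((N + 1) ^ 2 * d ^ 2)) by ring.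
    apply Rmult_le_compat; [lra | nra | nra | apply Rmult_le_compat_r; nra]. }
  apply sq_sum_le; auto; try apply Cmod_ge_0; repeat apply Rmult_le_pos; lra.
Qed.

Lemma kt_slope (nu : R) : 1 <= nu -> (forall z : Z, nu <> IZR z) ->
  Re (kt' nu 0%C) = / rk nu 0 * rk' nu 0.
Proof.
  intros Hnu Hz.
  pose proof (normalized_slope_lipschitz nu nu _ _ Hnu Hnu (kt_normalized nu Hnu)
    (normalized_nonint nu Hnu Hz)) as L.
  replace (nu ^ 2 - nu ^ 2) with 0 in L by ring; rewrite Rabs_R0 in L.
  cbn [snd] in L; fold (kt' nu) in L; rewrite kn'_RtoC, <- RtoC_mult in L.
  assert (L' : Rabs (Re (kt' nu 0%C) - / rk nu 0 * rk' nu 0) <= 0).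
  { eapply Rle_trans; [exact L | lra]. }
  apply Rabs_le_between in L'; lra.
Qed.

(** Both sides solve the equation with equal data at s = 0: the values by the choice of the factor,
    the slopes by uniqueness of the normalized solution. *)
Lemma kn_kt (nu : R) (s : C) : 1 <= nu -> (forall z : Z, nu <> IZR z) ->
  kn nu s = (RtoC (rk nu 0) * kt nu s)%C.
Proof.
  intros Hnu Hz; pose proof (rk_recessive nu Hnu Hz) as Hr.
  assert (Hg : 0 < rk nu 0) by apply Hr.
  assert (E0 : kn nu 0%C = (RtoC (rk nu 0) * kt nu 0%C)%C) by (rewrite kt_0, kn_RtoC by auto; ring).
  assert (E1 : kn' nu 0%C = (RtoC (rk nu 0) * kt' nu 0%C)%C).
  { destruct (kt_real nu 0 Hnu) as [_ R]; rewrite R, kt_slope, kn'_RtoC, <- RtoC_mult by auto.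
    f_equal; field; lra. }
  destruct (bessel_unique nu _ _ _ _ (kn_is_bessel nu)
    (is_bessel_scal nu (RtoC (rk nu 0)) _ _ (kt_is_bessel nu Hnu)) E0 E1 s) as [E _]; exact E.
Qed.

(** ** The logarithm *)

Lemma cos_sin_carg (z : C) : z <> 0%C -> cos (carg z) = Re z / Cmod z /\ sin (carg z) = Im z / Cmod z.
Proof.
  intros Hz; apply Cmod_gt_0 in Hz; set (x := Re z / Cmod z).
  assert (Hx2 : 1 - x ^ 2 = (Im z / Cmod z) ^ 2).
  { pose proof (Cmod2_alt z) as E; unfold x.
    replace ((Im z / Cmod z) ^ 2) with (Im z ^ 2 / Cmod z ^ 2) by (field; lra).
    replace (Im z ^ 2) with (Cmod z ^ 2 - Re z ^ 2) by lra; field; lra. }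
  assert (Hx : -1 <= x <= 1) by (pose proof (pow2_ge_0 (Im z / Cmod z)); nra).
  assert (Hs : sin (acos x) = Rabs (Im z) / Cmod z).
  { rewrite sin_acos by auto; unfold Rsqr; replace (1 - x * x) with ((Im z / Cmod z) ^ 2) by lra.
    replace ((Im z / Cmod z) ^ 2) with (Rsqr (Im z / Cmod z)) by (unfold Rsqr; ring).
    rewrite sqrt_Rsqr_abs; unfold Rdiv; rewrite Rabs_mult, Rabs_inv, (Rabs_pos_eq (Cmod z)); lra. }
  unfold carg; fold x; destruct (Rle_dec 0 (Im z)) as [Hi|Hi].
  - rewrite cos_acos, Hs, Rabs_pos_eq by auto; auto.
  - rewrite cos_neg, sin_neg, cos_acos, Hs, Rabs_left1 by (auto; lra); split; auto.
    field; lra.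
Qed.

Lemma cexp_clog (z : C) : z <> 0%C -> cexp (clog z) = z.
Proof.
  intros Hz; destruct (cos_sin_carg z Hz) as [A B]; pose proof (proj1 (Cmod_gt_0 z) Hz).
  apply C_eq; [rewrite Re_cexp | rewrite Im_cexp]; unfold clog; simpl; rewrite exp_ln by auto.
  - rewrite A; field; lra.
  - rewrite B; field; lra.
Qed.

Lemma slit_neq_0 (z : C) : slit_plane z -> z <> 0%C.
Proof. intros H E; apply H; rewrite E; simpl; lra. Qed.

Lemma Im_clog_slit (z : C) : slit_plane z -> Rabs (Im (clog z)) < PI.
Proof.
  intros Hz; pose proof (slit_neq_0 z Hz) as H0; destruct (cos_sin_carg z H0) as [A B].
  pose proof (proj1 (Cmod_gt_0 z) H0) as Hp.
  assert (Hb : Rabs (carg z) <= PI).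
  { unfold carg; pose proof (acos_bound (Re z / Cmod z)); pose proof PI_RGT_0.
    destruct (Rle_dec 0 (Im z)); [rewrite Rabs_pos_eq | rewrite Rabs_left1]; lra. }
  simpl; destruct (Rle_lt_or_eq_dec _ _ Hb) as [|E]; auto.
  exfalso; apply Hz.
  assert (C1 : cos (carg z) = -1).
  { rewrite <- cos_PI, <- E; unfold Rabs; destruct (Rcase_abs (carg z)); auto; rewrite cos_neg; auto. }
  assert (S1 : sin (carg z) = 0).
  { pose proof (sin2_cos2 (carg z)) as S; rewrite C1 in S; unfold Rsqr in S; nra. }
  rewrite A in C1; rewrite B in S1.
  assert (Im z = Im z / Cmod z * Cmod z) by (field; lra).
  assert (Re z = Re z / Cmod z * Cmod z) by (field; lra). split; nra.
Qed.

Lemma clog_cexp (s : C) : Rabs (Im s) < PI -> clog (cexp s) = s.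
Proof.
  intros Hs; apply Rabs_lt_between in Hs; unfold clog; rewrite Cmod_cexp, ln_exp.
  apply C_eq; [reflexivity|]; simpl; unfold carg; rewrite Cmod_cexp, Re_cexp, Im_cexp.
  pose proof (exp_pos (Re s)).
  replace (exp (Re s) * cos (Im s) / exp (Re s)) with (cos (Im s)) by (field; lra).
  destruct (Rle_dec 0 (Im s)) as [Hi|Hi].
  - pose proof (sin_ge_0 (Im s) Hi ltac:(lra)).
    destruct (Rle_dec 0 (exp (Re s) * sin (Im s))) as [|Hn]; [|exfalso; apply Hn; nra].
    apply acos_cos; lra.
  - pose proof (sin_gt_0 (- Im s) ltac:(lra) ltac:(lra)) as S; rewrite sin_neg in S.
    destruct (Rle_dec 0 (exp (Re s) * sin (Im s))) as [|Hn]; [exfalso; nra|].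
    rewrite <- cos_neg, acos_cos; lra.
Qed.

Lemma slit_cexp (s : C) : Rabs (Im s) < PI -> slit_plane (cexp s).
Proof.
  intros Hs [HI HR]; rewrite Im_cexp in HI; rewrite Re_cexp in HR; pose proof (exp_pos (Re s)).
  apply Rabs_lt_between in Hs.
  assert (S : sin (Im s) = 0) by nra.
  destruct (Rtotal_order (Im s) 0) as [h|[h|h]].
  - pose proof (sin_gt_0 (- Im s) ltac:(lra) ltac:(lra)); rewrite sin_neg in *; lra.
  - rewrite h, cos_0 in HR; lra.
  - pose proof (sin_gt_0 (Im s) ltac:(lra) ltac:(lra)); lra.
Qed.

(** A positive factor leaves the principal argument unchanged, so no correction by a multiple of 2
    pi arises. *)
Lemma clog_half (z : C) : z <> 0%C -> clog (z / 2) = (clog z - RtoC (ln 2))%C.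
Proof.
  intros Hz; apply Cmod_gt_0 in Hz.
  assert (E : (z / 2)%C = (RtoC (/ 2) * z)%C) by (rewrite RtoC_inv by lra; field).
  rewrite E; unfold clog, carg; rewrite Cmod_mult, Cmod_R, Re_RtoC_mul, Im_RtoC_mul, Rabs_pos_eq by lra.
  rewrite ln_mult, ln_Rinv by lra.
  replace (/ 2 * Re z / (/ 2 * Cmod z)) with (Re z / Cmod z) by (field; lra).
  apply C_eq; simpl; [ring|].
  destruct (Rle_dec 0 (/ 2 * Im z)), (Rle_dec 0 (Im z)); try lra; ring.
Qed.

Lemma cexp_pow (s : C) (k : nat) : (cexp s ^ k)%C = cexp (RtoC (INR k) * s).
Proof.
  induction k as [|k IH].
  - simpl; rewrite Cmult_0_l, cexp_0; reflexivity.
  - rewrite S_INR, RtoC_plus; simpl Cpow; rewrite IH, <- cexp_plus; f_equal; ring.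
Qed.

Lemma CSeries_scal (c : C) (a : nat -> C) (b : nat -> R) : (forall k, Cmod (a k) <= b k) ->
  ex_series b -> (c * CSeries a)%C = CSeries (fun k => c * a k)%C.
Proof.
  intros H Hb.
  apply (Cconverges_unique (sum_n (fun k => c * a k)%C)).
  - apply Cconverges_ext with (fun n => c * sum_n a n)%C.
    + intros n; induction n as [|n IH]; [rewrite !sum_O; auto|].
      rewrite !sum_n_SC, <- IH; ring.
    + apply Cconverges_scal, CSeries_converges with b; auto.
  - apply CSeries_converges with (fun k => Cmod c * b k).
    + intros k; rewrite Cmod_mult; apply Rmult_le_compat_l; [apply Cmod_ge_0 | auto].
    + apply ex_series_scal_R; auto.
Qed.

Lemma besselI_bi (nu : R) (z : C) : z <> 0%C -> besselI nu z = bi nu (clog z).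
Proof.
  intros Hz.
  assert (Hz2 : (z / 2)%C <> 0%C).
  { intros E; apply Hz; replace z with (z / 2 * 2)%C by field; rewrite E; ring. }
  assert (E : forall k, (cpower (z / 2) nu *
     (RtoC (rgamma (nu + INR k + 1) / INR (fact k)) * (z / 2) ^ (2 * k)))%C =
     (RtoC (bi_coef nu k) * cexp (RtoC (nu + 2 * INR k) * clog z))%C).
  { intros k; rewrite <- (cexp_clog (z / 2)) at 2 by auto; unfold cpower.
    rewrite cexp_pow, (clog_half z Hz).
    replace (cexp (RtoC nu * (clog z - RtoC (ln 2))) *
      (RtoC (rgamma (nu + INR k + 1) / INR (fact k)) *
       cexp (RtoC (INR (2 * k)) * (clog z - RtoC (ln 2)))))%C with
     (RtoC (rgamma (nu + INR k + 1) / INR (fact k)) * (cexp (RtoC nu * (clog z - RtoC (ln 2))) *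
       cexp (RtoC (INR (2 * k)) * (clog z - RtoC (ln 2)))))%C by ring.
    rewrite <- cexp_plus; unfold bi_coef; rewrite (RtoC_mult (_ / _)), <- cexp_RtoC.
    replace (RtoC (rgamma (nu + INR k + 1) / INR (fact k)) * cexp (RtoC (- ((nu + 2 * INR k) * ln 2))) *
      cexp (RtoC (nu + 2 * INR k) * clog z))%C with
     (RtoC (rgamma (nu + INR k + 1) / INR (fact k)) * (cexp (RtoC (- ((nu + 2 * INR k) * ln 2))) *
      cexp (RtoC (nu + 2 * INR k) * clog z)))%C by ring.
    rewrite <- cexp_plus; f_equal; f_equal.
    rewrite mult_INR, RtoC_opp, !RtoC_mult, !RtoC_plus, !RtoC_mult; simpl (INR 2).
    rewrite RtoC_plus; ring. }
  assert (Hc : cpower (z / 2) nu <> 0%C) by apply cexp_neq_0.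
  pose proof (proj1 (Cmod_gt_0 _) Hc) as Hcp.
  unfold besselI.
  rewrite (CSeries_scal _ _ (fun k => / Cmod (cpower (z / 2) nu) * bi_dom nu (Cmod (clog z)) k)).
  - unfold bi; f_equal; apply functional_extensionality; apply E.
  - intros k; pose proof (bi_term_dom0 nu (Cmod (clog z)) k (clog z) ltac:(lra)) as B.
    rewrite <- E, Cmod_mult in B.
    apply Rmult_le_reg_l with (Cmod (cpower (z / 2) nu)); auto.
    rewrite <- Rmult_assoc, Rinv_r, Rmult_1_l by lra; exact B.
  - apply ex_series_scal_R, ex_series_bi_dom.
Qed.

Lemma besselK_nonint_kn (nu : R) (z : C) : z <> 0%C -> besselK_nonint nu z = kn nu (clog z).
Proof. intros Hz; unfold besselK_nonint, kn; rewrite !besselI_bi by auto; reflexivity. Qed.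

(** ** Integer order *)

Lemma sum_n_continuity (a : nat -> R -> R) (x : R) (n : nat) : (forall k, continuity_pt (a k) x) ->
  continuity_pt (fun y => sum_n (fun k => a k y) n) x.
Proof.
  intros H; induction n as [|n IH].
  - apply continuity_pt_ext with (a 0%nat); auto; intros y; rewrite sum_O; auto.
  - apply continuity_pt_ext with (fun y => sum_n (fun k => a k y) n + a (S n) y).
    + intros y; rewrite sum_Sn; reflexivity.
    + apply (continuity_pt_plus (fun y => sum_n (fun k => a k y) n) (a (S n))); auto.
Qed.

Lemma Series_tail (a b : nat -> R) (n : nat) : (forall k, Rabs (a k) <= b k) -> ex_series b ->
  Rabs (Series a - sum_n a n) <= Series b - sum_n b n.
Proof.
  intros H Hb; pose proof (ex_series_dominated a b H Hb) as Ha.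
  rewrite (Series_incr_n a (S n)), (Series_incr_n b (S n)) by (auto; lia).
  rewrite <- !sum_n_Reals; simpl pred.
  replace (sum_n a n + Series (fun k => a (S n + k)%nat) - sum_n a n) with (Series (fun k => a (S n + k)%nat)) by ring.
  replace (sum_n b n + Series (fun k => b (S n + k)%nat) - sum_n b n) with (Series (fun k => b (S n + k)%nat)) by ring.
  assert (Xb : ex_series (fun k => b (S n + k)%nat)) by (apply (ex_series_incr_n b (S n)); auto).
  eapply Rle_trans; [apply Series_Rabs|].
  - apply ex_series_dominated with (fun k => b (S n + k)%nat); auto.
    intros k; rewrite Rabs_Rabsolu; auto.
  - apply Series_le; auto; intros k; split; [apply Rabs_pos | auto].
Qed.

Lemma Series_continuity (a : nat -> R -> R) (b : nat -> R) (x d : R) : 0 < d ->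
  (forall k, continuity_pt (a k) x) -> ex_series b ->
  (forall k y, Rabs (y - x) < d -> Rabs (a k y) <= b k) ->
  continuity_pt (fun y => Series (fun k => a k y)) x.
Proof.
  intros Hd Ha Hb H eps He.
  assert (L : is_lim_seq (sum_n b) (Series b)) by (apply (Series_correct b); auto).
  apply is_lim_seq_spec in L.
  assert (He3 : 0 < eps / 3) by lra.
  destruct (L (mkposreal _ He3)) as [N HN]; simpl in HN; specialize (HN N (le_n _)).
  apply Rabs_lt_between in HN.
  destruct (sum_n_continuity a x N Ha (eps / 3) He3) as [d1 [P1 D1]].
  exists (Rmin d d1); split; [apply Rmin_pos; auto|]; intros y [Hy1 Hy2].
  simpl in *; unfold Rdist in *.
  pose proof (Rlt_le_trans _ _ _ Hy2 (Rmin_l _ _)) as Hyd.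
  specialize (D1 y (conj Hy1 (Rlt_le_trans _ _ _ Hy2 (Rmin_r _ _)))).
  pose proof (Series_tail (fun k => a k y) b N (fun k => H k y Hyd) Hb) as T1.
  pose proof (Series_tail (fun k => a k x) b N (fun k => H k x ltac:(rewrite Rminus_eq_0, Rabs_R0; auto)) Hb) as T2.
  apply Rabs_lt_between in D1; apply Rabs_le_between in T1; apply Rabs_le_between in T2.
  apply Rabs_lt_between; lra.
Qed.

Lemma bi_coef_continuity (k : nat) (nu : R) : 1 <= nu -> continuity_pt (fun mu => bi_coef mu k) nu.
Proof.
  intros Hnu; pose proof (pos_INR k); unfold bi_coef, Rdiv.
  apply (continuity_pt_mult (fun mu => rgamma (mu + INR k + 1) * / INR (fact k))
     (fun mu => exp (- ((mu + 2 * INR k) * ln 2)))).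
  - apply (continuity_pt_mult (fun mu => rgamma (mu + INR k + 1)) (fun _ => / INR (fact k))).
    + apply (continuity_pt_comp (fun mu => mu + INR k + 1) rgamma).
      * eapply is_derive_continuity_pt; auto_derive; auto; reflexivity.
      * apply rgamma_continuous; lra.
    + apply continuity_pt_const; easy.
  - eapply is_derive_continuity_pt; auto_derive; auto; reflexivity.
Qed.

Lemma bi_coef_bound (nu mu : R) (k : nat) : 1 <= nu -> Rabs (mu - nu) < / 2 ->
  0 <= bi_coef mu k <= (nu + 2) * (nu + 3) / INR (fact k).
Proof.
  intros Hnu Hmu; apply Rabs_lt_between in Hmu; pose proof (pos_INR k).
  pose proof (bi_coef_pos mu k ltac:(lra)); split; [lra|].
  assert (G : rgamma (mu + 1) <= (nu + 2) * (nu + 3)).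
  { eapply Rle_trans; [apply (rgamma_le_gauss 1); [lia | lra]|].
    unfold gauss, Rpower; simpl; rewrite ln_1, Rmult_0_r, exp_0; nra. }
  pose proof (rgamma_decr mu k ltac:(lra)) as D.
  unfold bi_coef; pose proof (INR_fact_lt_0 k) as Hf.
  assert (E : exp (- ((mu + 2 * INR k) * ln 2)) <= 1).
  { apply Rle_trans with (exp 0); [apply exp_le | rewrite exp_0; lra].
    assert (0 < ln 2) by (rewrite <- ln_1; apply ln_increasing; lra). nra. }
  pose proof (exp_pos (- ((mu + 2 * INR k) * ln 2))).
  assert (P : 0 < rgamma (mu + INR k + 1) / INR (fact k))
    by (apply Rdiv_lt_0_compat; auto; apply rgamma_pos; lra).
  apply Rle_trans with (rgamma (mu + INR k + 1) / INR (fact k)); [nra|].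
  apply Rmult_le_compat_r; [left; apply Rinv_0_lt_compat; auto | lra].
Qed.

Lemma ri_0_continuity (nu : R) : 1 <= nu -> continuity_pt (fun mu => ri mu 0) nu /\
  continuity_pt (fun mu => ri' mu 0) nu.
Proof.
  intros Hnu.
  assert (X : ex_series (fun k => (nu + 2) * (nu + 3) ^ 2 * (exp 1 ^ k / INR (fact k))))
    by (apply ex_series_scal_R, ex_series_exp).
  assert (Hk : forall k, 1 + INR k <= exp 1 ^ k).
  { intros k; pose proof (exp_ineq1_le (INR k)) as E.
    rewrite exp_pow, Rmult_1_r; auto. }
  assert (B : forall k y, Rabs (y - nu) < / 2 ->
    Rabs (bi_coef y k * exp ((y + 2 * INR k) * 0)) <= (nu + 2) * (nu + 3) ^ 2 * (exp 1 ^ k / INR (fact k)) /\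
    Rabs (bi_coef y k * (y + 2 * INR k) * exp ((y + 2 * INR k) * 0)) <=
      (nu + 2) * (nu + 3) ^ 2 * (exp 1 ^ k / INR (fact k))).
  { intros k y Hy; destruct (bi_coef_bound nu y k Hnu Hy) as [b0 b1].
    rewrite Rmult_0_r, exp_0, !Rmult_1_r; pose proof (pos_INR k); specialize (Hk k).
    apply Rabs_lt_between in Hy; pose proof (INR_fact_lt_0 k) as Hf.
    rewrite Rabs_mult, !(Rabs_pos_eq (bi_coef y k)), (Rabs_pos_eq (y + 2 * INR k)) by lra.
    assert (E : (nu + 2) * (nu + 3) ^ 2 * (exp 1 ^ k / INR (fact k)) =
      (nu + 2) * (nu + 3) / INR (fact k) * ((nu + 3) * exp 1 ^ k)) by (field; lra).
    rewrite E.
    assert (M : bi_coef y k * (y + 2 * INR k) <=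
      (nu + 2) * (nu + 3) / INR (fact k) * ((nu + 3) * exp 1 ^ k))
      by (apply Rmult_le_compat; nra).
    split; auto; eapply Rle_trans; [exact b1|].
    rewrite <- (Rmult_1_r ((nu + 2) * (nu + 3) / INR (fact k))) at 1.
    apply Rmult_le_compat_l; nra. }
  split.
  - apply (Series_continuity (fun k mu => bi_coef mu k * exp ((mu + 2 * INR k) * 0)) _ nu (/ 2)) with (3 := X);
      [lra| |intros; apply B; auto].
    intros k; apply (continuity_pt_mult (fun mu => bi_coef mu k) (fun mu => exp ((mu + 2 * INR k) * 0))).
    + apply bi_coef_continuity; auto.
    + eapply is_derive_continuity_pt; auto_derive; auto; reflexivity.
  - apply (Series_continuity (fun k mu => bi_coef mu k * (mu + 2 * INR k) * exp ((mu + 2 * INR k) * 0)) _ nu (/ 2))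
      with (3 := X); [lra| |intros; apply B; auto].
    intros k; apply (continuity_pt_mult (fun mu => bi_coef mu k * (mu + 2 * INR k))
      (fun mu => exp ((mu + 2 * INR k) * 0))).
    + apply (continuity_pt_mult (fun mu => bi_coef mu k) (fun mu => mu + 2 * INR k)).
      * apply bi_coef_continuity; auto.
      * eapply is_derive_continuity_pt; auto_derive; auto; reflexivity.
    + eapply is_derive_continuity_pt; auto_derive; auto; reflexivity.
Qed.

Lemma continuity_pt_is_lim (f : R -> R) (x : R) : continuity_pt f x -> is_lim f x (f x).
Proof. intros H; apply is_lim_continuity; auto. Qed.

(** At a positive integer both [rgamma (1 - mu)] and the sine vanish. Passing from mu - 1 to mu
    multiplies the quotient by mu - 1, so everything reduces to mu = 1, where sin x/x -> 1
    applies. *)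
Lemma rgamma_sin_lim (m : nat) : exists l, l <> 0 /\
  is_lim (fun mu => rgamma (1 - mu) / sin (mu * PI)) (INR (S m)) l.
Proof.
  pose proof PI_RGT_0 as Hpi.
  induction m as [|m [l [Hl IH]]].
  - exists (rgamma 1 * / PI * / 1); split.
    { pose proof (rgamma_pos 1 ltac:(lra)); rewrite Rinv_1, Rmult_1_r.
      apply Rmult_integral_contrapositive_currified; [lra | apply Rinv_neq_0_compat; lra]. }
    assert (S : is_lim (fun mu => sin (PI * mu + - PI) / (PI * mu + - PI)) (INR 1) 1).
    { apply (is_lim_comp_lin (fun x => sin x / x) PI (- PI) (INR 1) 1); [|lra].
      replace (Rbar_plus (Rbar_mult PI (INR 1)) (- PI)) with (Finite 0) by (simpl; f_equal; ring).
      apply is_lim_sinc_0. }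
    apply is_lim_ext_loc with
      (fun mu => rgamma (2 - mu) * / PI * / (sin (PI * mu + - PI) / (PI * mu + - PI))).
    + exists (mkposreal (/ 2) ltac:(lra)); intros y Hy Hy1; simpl in Hy1.
      change (Rabs (y - 1) < / 2) in Hy; apply Rabs_lt_between in Hy.
      rewrite (rgamma_step (1 - y)); replace (1 - y + 1) with (2 - y) by ring.
      replace (y * PI) with (PI * y + - PI + PI) by ring; rewrite neg_sin.
      assert (sin (PI * y + - PI) <> 0).
      { intros E; replace (PI * y + - PI) with ((y - 1) * PI) in E by ring.
        destruct (Rlt_le_dec 0 (y - 1)).
        - pose proof (sin_gt_0 ((y - 1) * PI) ltac:(nra) ltac:(nra)); lra.
        - pose proof (sin_gt_0 ((1 - y) * PI) ltac:(nra) ltac:(nra)) as P.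
          replace ((1 - y) * PI) with (- ((y - 1) * PI)) in P by ring; rewrite sin_neg in P; lra. }
      field; repeat split; auto; nra.
    + replace (Finite (rgamma 1 * / PI * / 1)) with
        (Rbar_mult (Finite (rgamma 1 * / PI)) (Rbar_inv (Finite 1))) by reflexivity.
      apply is_lim_mult; [| |exact I].
      * assert (Cg : continuity_pt (fun mu => rgamma (2 - mu) * / PI) (INR 1)).
        { apply (continuity_pt_mult (fun mu => rgamma (2 - mu)) (fun _ => / PI));
            [|apply continuity_pt_const; easy].
          apply (continuity_pt_comp (fun mu => 2 - mu) rgamma); [|simpl; apply rgamma_continuous; lra].
          eapply is_derive_continuity_pt; auto_derive; auto; reflexivity. }
        apply continuity_pt_is_lim in Cg.
        replace (2 - INR 1) with 1 in Cg by (simpl; ring); exact Cg.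
      * apply is_lim_inv; auto; intros E; injection E; lra.
  - exists (INR (S m) * l); split.
    { apply Rmult_integral_contrapositive_currified; auto; apply not_0_INR; lia. }
    apply is_lim_ext with (fun mu => (mu - 1) * (rgamma (1 - (1 * mu + -1)) / sin ((1 * mu + -1) * PI))).
    + intros mu; rewrite (rgamma_step (1 - mu)).
      replace (1 - (1 * mu + -1)) with (1 - mu + 1) by ring.
      replace (mu * PI) with ((1 * mu + -1) * PI + PI) by ring; rewrite neg_sin.
      unfold Rdiv; rewrite Rinv_opp; ring.
    + replace (Finite (INR (S m) * l)) with (Rbar_mult (INR (S m)) l) by reflexivity.
      apply is_lim_mult; [| |exact I].
      * assert (Cg : continuity_pt (fun mu => mu - 1) (INR (S (S m))))
          by (eapply is_derive_continuity_pt; auto_derive; auto; reflexivity).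
        apply continuity_pt_is_lim in Cg.
        replace (INR (S (S m)) - 1) with (INR (S m)) in Cg by (rewrite (S_INR (S m)); ring); exact Cg.
      * apply (is_lim_comp_lin (fun x => rgamma (1 - x) / sin (x * PI)) 1 (-1)); [|lra].
        replace (Rbar_plus (Rbar_mult 1 (INR (S (S m)))) (-1)) with (Finite (INR (S m))); auto.
        change (Finite (INR (S m)) = Finite (1 * INR (S (S m)) + -1)); rewrite (S_INR (S m)); f_equal; ring.
Qed.

Lemma kt_slope_continuity (nu : R) : 1 < nu -> continuity_pt (fun mu => Re (kt' mu 0%C)) nu.
Proof.
  intros Hnu eps He.
  exists (Rmin (nu - 1) (Rmin 1 (eps / (2 * nu + 1)))); split.
  { repeat apply Rmin_pos; try lra; apply Rdiv_lt_0_compat; lra. }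
  intros mu [_ Hmu]; simpl in *; unfold Rdist in *.
  pose proof (Rlt_le_trans _ _ _ Hmu (Rmin_l _ _)) as H1.
  pose proof (Rlt_le_trans _ _ _ Hmu (Rmin_r _ _)) as H2.
  pose proof (Rlt_le_trans _ _ _ H2 (Rmin_l _ _)) as H3.
  pose proof (Rlt_le_trans _ _ _ H2 (Rmin_r _ _)) as H4.
  apply (proj2 (Rlt_div_r (Rabs (mu - nu)) eps (2 * nu + 1) ltac:(lra))) in H4.
  assert (Hm : 1 <= mu /\ mu <= nu + 1) by (apply Rabs_lt_between in H1; apply Rabs_lt_between in H3; lra).
  pose proof (normalized_slope_lipschitz mu nu _ _ (proj1 Hm) (Rlt_le _ _ Hnu)
    (kt_normalized mu (proj1 Hm)) (kt_normalized nu (Rlt_le _ _ Hnu))) as L.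
  fold (kt' nu) (kt' mu) in L.
  eapply Rle_lt_trans; [exact L|].
  replace (mu ^ 2 - nu ^ 2) with ((mu + nu) * (mu - nu)) by ring.
  rewrite Rabs_mult, (Rabs_pos_eq (mu + nu)) by lra.
  pose proof (Rabs_pos (mu - nu)); nra.
Qed.

(** The Wronskian at t = 0, with the slope known, expresses K_mu(1) by quantities having limits at
    integer orders, where the defining formula is 0/0. *)
Lemma rk_0_value (mu : R) : 1 <= mu -> (forall z : Z, mu <> IZR z) ->
  rk mu 0 = k_wronskian mu * / (ri' mu 0 - Re (kt' mu 0%C) * ri mu 0).
Proof.
  intros Hmu Hz; pose proof (rk_wronskian mu 0 (proj2 (sin_nonint mu) Hz)) as W.
  pose proof (ri_pos mu 0 ltac:(lra)); pose proof (ri'_ge mu 0 ltac:(lra)).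
  pose proof (kt_slope mu Hmu Hz) as S.
  destruct (normalized_slope_bound mu _ Hmu (kt_normalized mu Hmu)) as [_ B]; fold (kt' mu) in B.
  assert (Hg : 0 < rk mu 0) by apply (rk_recessive mu Hmu Hz).
  set (sg := Re (kt' mu 0%C)) in *.
  assert (D : 0 < ri' mu 0 - sg * ri mu 0) by nra.
  assert (E : rk' mu 0 = rk mu 0 * sg) by (rewrite S; field; lra).
  replace (k_wronskian mu) with (rk mu 0 * (ri' mu 0 - sg * ri mu 0)) by (rewrite E in W; lra).
  field; lra.
Qed.

(** With m >= 1 the integer order is at least 2, so that all orders near it exceed 1 and [kt] is
    meaningful there. *)
Lemma rk_0_lim (m : nat) : (1 <= m)%nat -> exists l, l <> 0 /\ is_lim (fun mu => rk mu 0) (INR (S m)) l.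
Proof.
  intros Hm; destruct (rgamma_sin_lim m) as [l [Hl L]]; set (nu := INR (S m)) in *.
  assert (Hnu : 2 <= nu) by (unfold nu; rewrite S_INR; pose proof (INR_ge_1 m Hm); lra).
  pose proof (ri_pos nu 0 ltac:(lra)); pose proof (ri'_ge nu 0 ltac:(lra)).
  destruct (normalized_slope_bound nu _ ltac:(lra) (kt_normalized nu ltac:(lra))) as [_ B].
  fold (kt' nu) in B.
  assert (D : 0 < ri' nu 0 - Re (kt' nu 0%C) * ri nu 0) by nra.
  pose proof (rgamma_pos (1 + nu) ltac:(lra)); pose proof PI_RGT_0.
  exists (PI * nu * rgamma (1 + nu) * l * / (ri' nu 0 - Re (kt' nu 0%C) * ri nu 0)); split.
  { apply Rmult_integral_contrapositive_currified; [|apply Rinv_neq_0_compat; lra].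
    apply Rmult_integral_contrapositive_currified; auto.
    apply Rgt_not_eq, Rmult_lt_0_compat; nra. }
  apply is_lim_ext_loc with (fun mu => k_wronskian mu * / (ri' mu 0 - Re (kt' mu 0%C) * ri mu 0)).
  { exists (mkposreal (/ 2) ltac:(lra)); intros y Hy Hne; symmetry.
    change (Rabs (y - nu) < / 2) in Hy; pose proof Hy as Hy'; apply Rabs_lt_between in Hy'.
    apply rk_0_value; [lra|]; apply (nonint_near (Z.of_nat (S m)));
      rewrite <- INR_IZR_INZ; fold nu; [lra|]; intros Ey; apply Hne; f_equal; auto. }
  destruct (ri_0_continuity nu ltac:(lra)) as [C0 C1].
  replace (Finite (PI * nu * rgamma (1 + nu) * l * / (ri' nu 0 - Re (kt' nu 0%C) * ri nu 0))) with
    (Rbar_mult (Rbar_mult (Finite (PI * nu * rgamma (1 + nu))) (Finite l))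
      (Finite (/ (ri' nu 0 - Re (kt' nu 0%C) * ri nu 0)))) by reflexivity.
  apply is_lim_mult; [| |exact I].
  - apply is_lim_mult; [|exact L|exact I].
    apply (continuity_pt_is_lim (fun mu => PI * mu * rgamma (1 + mu))).
    apply (continuity_pt_mult (fun mu => PI * mu) (fun mu => rgamma (1 + mu))).
    + eapply is_derive_continuity_pt; auto_derive; auto; reflexivity.
    + apply (continuity_pt_comp (fun mu => 1 + mu) rgamma); [|apply rgamma_continuous; lra].
      eapply is_derive_continuity_pt; auto_derive; auto; reflexivity.
  - apply (continuity_pt_is_lim (fun mu => / (ri' mu 0 - Re (kt' mu 0%C) * ri mu 0))).
    apply (continuity_pt_inv (fun mu => ri' mu 0 - Re (kt' mu 0%C) * ri mu 0)); [|lra].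
    apply (continuity_pt_minus (fun mu => ri' mu 0) (fun mu => Re (kt' mu 0%C) * ri mu 0)); auto.
    apply (continuity_pt_mult (fun mu => Re (kt' mu 0%C)) (fun mu => ri mu 0)); auto.
    apply kt_slope_continuity; lra.
Qed.

Lemma kt_continuous_order (nu : R) (s : C) : 1 < nu -> 
  continuity_pt (fun mu => Re (kt mu s)) nu /\ continuity_pt (fun mu => Im (kt mu s)) nu.
Proof.
  intros Hnu; pose proof (Cmod_ge_0 s).
  destruct (kt_continuity (1 + Cmod s) (nu + 1)) as [K [HK H1]]; [lra | lra|].
  assert (A : forall p : C -> R, (forall x y, Rabs (p x - p y) <= Cmod (x - y)%C) ->
    continuity_pt (fun mu => p (kt mu s)) nu).
  { intros p Hp eps He; exists (Rmin (nu - 1) (Rmin 1 (eps / K))); split.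
    { repeat apply Rmin_pos; try lra; apply Rdiv_lt_0_compat; lra. }
    intros mu [_ Hmu]; simpl in *; unfold Rdist in *.
    pose proof (Rlt_le_trans _ _ _ Hmu (Rmin_l _ _)) as H2.
    pose proof (Rlt_le_trans _ _ _ Hmu (Rmin_r _ _)) as H3.
    pose proof (Rlt_le_trans _ _ _ H3 (Rmin_l _ _)) as H4.
    pose proof (Rlt_le_trans _ _ _ H3 (Rmin_r _ _)) as H5.
    apply (proj2 (Rlt_div_r _ _ _ HK)) in H5.
    apply Rabs_lt_between in H2; apply Rabs_lt_between in H4.
    eapply Rle_lt_trans; [apply Hp|]; destruct (H1 mu nu s) as [B _]; lra. }
  split; apply A; intros x y; [apply Re_sub_le|].
  eapply Rle_trans; [|apply im_le_Cmod]; right; f_equal.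
Qed.

Lemma besselK_kt_nonint (nu : R) (z : C) : 1 <= nu -> sin (nu * PI) <> 0 -> slit_plane z ->
  besselK nu z = (RtoC (rk nu 0) * kt nu (clog z))%C.
Proof.
  intros Hnu Hs Hz; unfold besselK; destruct (Req_EM_T (sin (nu * PI)) 0) as [|_]; [easy|].
  rewrite besselK_nonint_kn by (apply slit_neq_0; auto).
  apply kn_kt; auto; apply sin_nonint; auto.
Qed.

(** At integer order [besselK] is a limit over mu <> nu, in which K_mu(1) and [kt mu] converge
    separately, the first to a nonzero number. Thus zeros of K_nu are zeros of [kt] whatever the
    order. *)
Lemma besselK_kt (nu : R) : 1 < nu -> exists g : R, g <> 0 /\
  forall z, slit_plane z -> besselK nu z = (RtoC g * kt nu (clog z))%C.
Proof.
  intros Hnu; destruct (Req_dec (sin (nu * PI)) 0) as [Hs|Hs].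
  2:{ exists (rk nu 0); split.
      - apply Rgt_not_eq; apply (rk_recessive nu); [lra | apply sin_nonint; auto].
      - intros z Hz; apply besselK_kt_nonint; auto; lra. }
  pose proof PI_RGT_0 as Hpi.
  assert (E : exists m, (1 <= m)%nat /\ nu = INR (S m)).
  { pose proof Hs as Hs'; apply sin_eq_0_0 in Hs'; destruct Hs' as [z Hz].
    apply Rmult_eq_reg_r in Hz; [|lra].
    assert (1 < z)%Z by (apply lt_IZR; lra).
    exists (Z.to_nat (z - 1)); split; [lia|].
    rewrite S_INR, INR_IZR_INZ, Z2Nat.id, minus_IZR by lia; lra. }
  destruct E as [m [Hm E]]; destruct (rk_0_lim m Hm) as [g [Hg L]]; rewrite <- E in L.
  exists g; split; auto; intros z Hz.
  unfold besselK; destruct (Req_EM_T (sin (nu * PI)) 0) as [_|]; [|easy].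
  destruct (kt_continuous_order nu (clog z) Hnu) as [C1 C2].
  apply continuity_pt_is_lim in C1; apply continuity_pt_is_lim in C2.
  assert (Loc : Rbar_locally' nu (fun mu => besselK_nonint mu z = (RtoC (rk mu 0) * kt mu (clog z))%C)).
  { exists (mkposreal (/ 2) ltac:(lra)); intros y Hy Hne.
    change (Rabs (y - nu) < / 2) in Hy; pose proof Hy as Hy'; apply Rabs_lt_between in Hy'.
    rewrite besselK_nonint_kn by (apply slit_neq_0; auto); apply kn_kt.
    - rewrite E, S_INR in Hy'; pose proof (INR_ge_1 m Hm); lra.
    - apply (nonint_near (Z.of_nat (S m))); rewrite <- INR_IZR_INZ, <- E; [lra|].
      intros Ey; apply Hne; f_equal; auto. }
  apply C_eq.
  - change (real (Lim (fun mu => Re (besselK_nonint mu z)) nu) = Re (RtoC g * kt nu (clog z))).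
    rewrite (is_lim_unique _ nu (Finite (g * Re (kt nu (clog z))))); [exact (eq_sym (Re_RtoC_mul _ _))|].
    apply is_lim_ext_loc with (fun mu => rk mu 0 * Re (kt mu (clog z))).
    + destruct Loc as [d Hd]; exists d; intros y Hy Hne; rewrite (Hd y Hy Hne).
      symmetry; apply Re_RtoC_mul.
    + replace (Finite (g * Re (kt nu (clog z)))) with (Rbar_mult g (Re (kt nu (clog z)))) by reflexivity.
      apply is_lim_mult; auto; exact I.
  - change (real (Lim (fun mu => Im (besselK_nonint mu z)) nu) = Im (RtoC g * kt nu (clog z))).
    rewrite (is_lim_unique _ nu (Finite (g * Im (kt nu (clog z))))); [exact (eq_sym (Im_RtoC_mul _ _))|].
    apply is_lim_ext_loc with (fun mu => rk mu 0 * Im (kt mu (clog z))).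
    + destruct Loc as [d Hd]; exists d; intros y Hy Hne; rewrite (Hd y Hy Hne).
      symmetry; apply Im_RtoC_mul.
    + replace (Finite (g * Im (kt nu (clog z)))) with (Rbar_mult g (Im (kt nu (clog z)))) by reflexivity.
      apply is_lim_mult; auto; exact I.
Qed.

(** * Zeros of K_nu(e^s) in the strip |Im s| <= pi: location *)

Lemma is_cderive_mult (f g : C -> C) (s a b : C) : is_cderive f s a -> is_cderive g s b ->
  is_cderive (fun s => f s * g s)%C s (a * g s + f s * b)%C.
Proof.
  intros Hf Hg eps He.
  set (M := Cmod (f s) + Cmod (g s) + Cmod a + 1).
  pose proof (Cmod_ge_0 (f s)); pose proof (Cmod_ge_0 (g s)); pose proof (Cmod_ge_0 a).
  assert (HM : 1 <= M) by (unfold M; lra).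
  set (e := Rmin 1 (eps / (4 * M))).
  assert (He' : 0 < e) by (apply Rmin_pos; [lra | apply Rdiv_lt_0_compat; lra]).
  assert (He1 : e <= 1) by apply Rmin_l.
  assert (He2 : e * (4 * M) <= eps).
  { pose proof (Rmin_r 1 (eps / (4 * M))) as Hr; fold e in Hr.
    apply (proj2 (Rle_div_r e eps (4 * M) ltac:(lra))); auto. }
  destruct (Hf e He') as [d1 [P1 D1]]; destruct (Hg e He') as [d2 [P2 D2]].
  destruct (is_cderive_continuous g s b Hg e He') as [d3 [P3 D3]].
  exists (Rmin d1 (Rmin d2 d3)); split; [repeat apply Rmin_pos; auto|]; intros h Hh.
  pose proof (Rlt_le_trans _ _ _ Hh (Rmin_l _ _)) as H1'.
  pose proof (Rlt_le_trans _ _ _ Hh (Rmin_r _ _)) as H2'.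
  specialize (D1 h H1'); specialize (D2 h (Rlt_le_trans _ _ _ H2' (Rmin_l _ _))).
  specialize (D3 (s + h)%C ltac:(replace (s + h - s)%C with h by ring;
     exact (Rlt_le_trans _ _ _ H2' (Rmin_r _ _)))).
  replace (f (s + h) * g (s + h) - f s * g s - (a * g s + f s * b) * h)%C with
    ((f (s + h) - f s - a * h) * g (s + h) + a * h * (g (s + h) - g s) +
     f s * (g (s + h) - g s - b * h))%C by ring.
  pose proof (Cmod_le_sub (g (s + h)%C) (g s)) as G.
  pose proof (Cmod_ge_0 h).
  eapply Rle_trans; [apply Cmod_triangle|]; eapply Rle_trans; [apply Rplus_le_compat_r, Cmod_triangle|].
  rewrite !Cmod_mult.
  assert (A1 : Cmod (f (s + h) - f s - a * h)%C * Cmod (g (s + h)%C) <= e * Cmod h * M).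
  { apply Rmult_le_compat; try apply Cmod_ge_0; auto; unfold M; lra. }
  assert (A2 : Cmod a * Cmod h * Cmod (g (s + h) - g s)%C <= M * Cmod h * e).
  { apply Rmult_le_compat; try apply Cmod_ge_0; [apply Rmult_le_pos; auto | | lra].
    apply Rmult_le_compat_r; auto; unfold M; lra. }
  assert (A3 : Cmod (f s) * Cmod (g (s + h) - g s - b * h)%C <= M * (e * Cmod h)).
  { apply Rmult_le_compat; try apply Cmod_ge_0; auto; unfold M; lra. }
  assert (A4 : e * (4 * M) * Cmod h <= eps * Cmod h) by (apply Rmult_le_compat_r; auto).
  assert (0 <= e * M * Cmod h) by (repeat apply Rmult_le_pos; lra).
  nra.
Qed.

(* Along a path on which alpha may only grow and beta only shrink, up to a small coupling e, the
   quantity |alpha|^2 - (4 - t/2) |beta|^2 stays positive. *)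
Lemma dominated_component (al be : R -> C) (a b e : R -> C) :
  (forall t, 0 <= t <= PI -> is_pderive al t (a t * al t + e t * (be t - al t))%C) ->
  (forall t, 0 <= t <= PI -> is_pderive be t (b t * be t + e t * (be t - al t))%C) ->
  (forall t, 0 <= t <= PI -> 0 <= Re (a t) /\ Re (b t) <= 0 /\ Cmod (e t) <= / 100) ->
  4 * Cmod (be 0) ^ 2 < Cmod (al 0) ^ 2 ->
  forall t, 0 <= t <= PI -> be t <> al t.
Proof.
  intros Hal Hbe Hc H0 t Ht Heq.
  set (ip := fun x y : C => Re x * Re y + Im x * Im y).
  set (A := fun t => Cmod (al t) ^ 2); set (B := fun t => Cmod (be t) ^ 2).
  set (dA := fun t => 2 * ip (al t) (a t * al t + e t * (be t - al t))%C).
  set (dB := fun t => 2 * ip (be t) (b t * be t + e t * (be t - al t))%C).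
  assert (ipE : forall x c w, ip x (c * x + w)%C = Re c * Cmod x ^ 2 + ip x w).
  { intros x c w; unfold ip; rewrite Cmod2_alt; destruct x, c, w; simpl; ring. }
  assert (ipB : forall x c w, Rabs (ip x (c * w)%C) <= Cmod x * (Cmod c * Cmod w)).
  { intros x c w; rewrite <- Cmod_mult; unfold ip; apply Rabs_le; split.
    - pose proof (Re_cinner_le x (- (c * w))%C) as R; rewrite Cmod_opp in R.
      replace (Re (- (c * w))%C) with (- Re (c * w)%C) in R by reflexivity.
      replace (Im (- (c * w))%C) with (- Im (c * w)%C) in R by reflexivity. lra.
    - apply Re_cinner_le. }
  (* The diagonal terms have the favourable sign, and the coupling contributes at most 2p(p+q)/100
     <= (3p^2 + q^2)/100, with the roles of p and q exchanged for B. *)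
  assert (Bd : forall x, 0 <= x <= PI -> - (/ 100) * (3 * A x + B x) <= dA x /\
     dB x <= / 100 * (A x + 3 * B x)).
  { intros x Hx; destruct (Hc x Hx) as [c1 [c2 c3]]; unfold dA, dB, A, B.
    rewrite !ipE.
    pose proof (ipB (al x) (e x) (be x - al x)%C) as I1; pose proof (ipB (be x) (e x) (be x - al x)%C) as I2.
    pose proof (Cmod_sub_le (be x) (al x)) as S.
    pose proof (Cmod_ge_0 (al x)); pose proof (Cmod_ge_0 (be x)); pose proof (Cmod_ge_0 (be x - al x)%C).
    pose proof (Cmod_ge_0 (e x)).
    set (p := Cmod (al x)) in *; set (q := Cmod (be x)) in *.
    assert (E1 : Cmod (e x) * Cmod (be x - al x)%C <= / 100 * (p + q)) by (apply Rmult_le_compat; lra).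
    assert (E2 : p * (Cmod (e x) * Cmod (be x - al x)%C) <= p * (/ 100 * (p + q)))
      by (apply Rmult_le_compat_l; auto).
    assert (E3 : q * (Cmod (e x) * Cmod (be x - al x)%C) <= q * (/ 100 * (p + q)))
      by (apply Rmult_le_compat_l; auto).
    apply Rabs_le_between in I1; apply Rabs_le_between in I2.
    pose proof (pow2_ge_0 (p - q)).
    assert (0 <= Re (a x) * p ^ 2) by (apply Rmult_le_pos; [auto | apply pow2_ge_0]).
    assert (Re (b x) * q ^ 2 <= 0) by (pose proof (pow2_ge_0 q); nra).
    split; nra. }
  (* The coupling terms in A total at most (3 + 4)/100 and are paid by exp(7t/100); those in B are
     paid by the term B/2 from the decreasing weight. The weight stays at least 2 because t <= pi <=
     4. *)
  assert (Mono : (A 0 - (4 - 0 / 2) * B 0) * exp (7 / 100 * 0) <= (A t - (4 - t / 2) * B t) * exp (7 / 100 * t)).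
  { apply (derive_ge0_le (fun t => (A t - (4 - t * / 2) * B t) * exp (7 / 100 * t))
     (fun t => (dA t - (4 - t * / 2) * dB t + B t / 2 + 7 / 100 * (A t - (4 - t * / 2) * B t)) *
        exp (7 / 100 * t))); [lra| |].
    - intros x Hx.
      assert (DA : is_derive A x (dA x)) by (apply (is_pderive_Cmod2 al), Hal; lra).
      assert (DB : is_derive B x (dB x)) by (apply (is_pderive_Cmod2 be), Hbe; lra).
      der; field.
    - intros x Hx; destruct (Bd x ltac:(lra)) as [B1 B2].
      pose proof PI_4.
      assert (0 <= A x) by apply pow2_ge_0. assert (0 <= B x) by apply pow2_ge_0.
      apply Rmult_le_pos; [|left; apply exp_pos].
      assert (Hm : 2 <= 4 - x * / 2 <= 4) by lra.
      set (m := 4 - x * / 2) in *.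
      assert (m * dB x <= m * (/ 100 * (A x + 3 * B x))) by (apply Rmult_le_compat_l; lra).
      assert (m * A x <= 4 * A x) by (apply Rmult_le_compat_r; lra).
      assert (m * B x <= 4 * B x) by (apply Rmult_le_compat_r; lra). lra. }
  rewrite Rmult_0_r, exp_0, Rmult_1_r in Mono.
  assert (P : 0 < A 0 - (4 - 0 / 2) * B 0) by (unfold A, B; lra).
  assert (Z : A t = B t) by (unfold A, B; rewrite Heq; auto).
  assert (0 <= B t) by apply pow2_ge_0.
  pose proof PI_4; pose proof (exp_pos (7 / 100 * t)).
  assert (A t - (4 - t / 2) * B t <= 0) by nra. nra.
Qed.

Lemma Cmod_RtoC_pos (x : R) : 0 <= x -> Cmod (RtoC x) = x.
Proof. intros; rewrite Cmod_R, Rabs_pos_eq; auto. Qed.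

(** [al] and [be] measure the components along the WKB solutions e^(-s/2 - e^s) and e^(-s/2 + e^s).
    Going up from the real line the first grows and the second shrinks, because Im e^s >= 0, and on
    the real line recessiveness makes [be] small against [al]. A zero would force al = be. The
    coupling (nu^2 - 1/4)/(2 e^s) is at most 1/100 in modulus once e^t >= 50 nu^2. *)
Lemma kt_nonzero_right (nu t th : R) : 1 <= nu -> 50 * nu ^ 2 <= exp t -> 0 <= th <= PI ->
  kt nu (RtoC t + RtoC th * Ci) <> 0%C.
Proof.
  intros Hnu Hr Hth E.
  set (k := kt nu) in *; set (k1 := kt' nu).
  set (al := fun s => (k1 s - (cexp s - RtoC (/ 2)) * k s)%C).
  set (be := fun s => (k1 s + (cexp s + RtoC (/ 2)) * k s)%C).
  set (e := fun s => (RtoC ((nu ^ 2 - / 4) / 2) / cexp s)%C).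
  assert (Hk : is_bessel nu k k1) by (apply kt_is_bessel; auto).
  assert (Sq : forall s, cexp (2 * s) = (cexp s * cexp s)%C) by (intros; rewrite <- cexp_plus; f_equal; ring).
  assert (Q4 : RtoC (/ 4) = (RtoC (/ 2) * RtoC (/ 2))%C) by (rewrite <- RtoC_mult; f_equal; field).
  assert (Ee : forall s, (e s * (be s - al s))%C = (RtoC (nu ^ 2 - / 4) * k s)%C).
  { intros s; unfold e, be, al.
    replace ((nu ^ 2 - / 4) / 2) with (/ 2 * (nu ^ 2 - / 4)) by field.
    rewrite (RtoC_mult (/ 2)), (RtoC_inv 2) by lra; field; apply cexp_neq_0. }
  assert (Dm : forall c s, is_cderive (fun s => (cexp s + RtoC c) * k s)%C s
     (cexp s * k s + (cexp s + RtoC c) * k1 s)%C).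
  { intros c s; eapply is_cderive_eq.
    - apply (is_cderive_mult (fun s => cexp s + RtoC c)%C k).
      + apply (is_cderive_plus cexp (fun _ => RtoC c)); [apply is_cderive_cexp | apply is_cderive_const].
      + apply Hk.
    - ring. }
  assert (Dal : forall s, is_cderive al s ((RtoC (/ 2) - cexp s) * al s + e s * (be s - al s))%C).
  { intros s; rewrite Ee; eapply is_cderive_eq.
    - apply (is_cderive_minus k1 (fun s => (cexp s - RtoC (/ 2)) * k s)%C); [apply Hk|].
      pose proof (Dm (- / 2) s) as D; rewrite RtoC_opp in D; exact D.
    - unfold al; rewrite Sq, RtoC_minus, Q4, !(RtoC_inv 2) by lra; field. }
  assert (Dbe : forall s, is_cderive be s ((RtoC (/ 2) + cexp s) * be s + e s * (be s - al s))%C).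
  { intros s; rewrite Ee; eapply is_cderive_eq.
    - apply (is_cderive_plus k1 (fun s => (cexp s + RtoC (/ 2)) * k s)%C); [apply Hk | apply Dm].
    - unfold be; rewrite Sq, RtoC_minus, Q4, !(RtoC_inv 2) by lra; field. }
  set (z := fun th => (RtoC t + RtoC th * Ci)%C).
  assert (Rez : forall x, Re (z x) = t /\ Im (z x) = x) by (intros x; unfold z; simpl; split; ring).
  apply (dominated_component (fun x => al (z x)) (fun x => be (z x))
    (fun x => (RtoC (/ 2) - cexp (z x)) * Ci)%C (fun x => (RtoC (/ 2) + cexp (z x)) * Ci)%C
    (fun x => e (z x) * Ci)%C) with (t := th); auto.
  - intros x Hx; pose proof (is_cderive_path al (RtoC t) Ci _ x (Dal _)) as P.
    fold (z x) in P; match type of P with is_pderive _ _ ?l => match goal with |- is_pderive _ _ ?l' =>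
      replace l' with l by ring end end; exact P.
  - intros x Hx; pose proof (is_cderive_path be (RtoC t) Ci _ x (Dbe _)) as P.
    fold (z x) in P; match type of P with is_pderive _ _ ?l => match goal with |- is_pderive _ _ ?l' =>
      replace l' with l by ring end end; exact P.
  - intros x Hx; destruct (Rez x) as [r i].
    assert (Hs : 0 <= Im (cexp (z x))).
    { rewrite Im_cexp, i; apply Rmult_le_pos; [left; apply exp_pos | apply sin_ge_0; lra]. }
    replace (Re ((RtoC (/ 2) - cexp (z x)) * Ci)%C) with (Im (cexp (z x)))
      by (destruct (cexp (z x)); simpl; ring).
    replace (Re ((RtoC (/ 2) + cexp (z x)) * Ci)%C) with (- Im (cexp (z x)))
      by (destruct (cexp (z x)); simpl; ring).
    split; [lra | split; [lra|]].
    unfold e; rewrite Cmod_mult, Cmod_Ci, Rmult_1_r, Cmod_div by apply cexp_neq_0.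
    rewrite Cmod_cexp, r, Cmod_RtoC_pos by nra.
    apply Rle_div_l; [apply exp_pos|]; nra.
  - destruct (kt_recessive nu Hnu) as [_ R]; destruct (R t) as [r0 [_ [r1 r2]]].
    destruct (kt_real nu t Hnu) as [E0 E1].
    replace (z 0) with (RtoC t) by (unfold z; ring).
    unfold al, be, k, k1; rewrite E0, E1, cexp_RtoC, <- RtoC_minus, <- RtoC_plus, <- !RtoC_mult,
      <- RtoC_minus, <- RtoC_plus, !Cmod_R, !pow2_abs.
    set (u := Re (kt nu (RtoC t))) in *; set (u1 := Re (kt' nu (RtoC t))) in *.
    assert (Hbe : - (nu * u) <= u1 + (exp t + / 2) * u <= 0) by (split; nra).
    assert (Hal : u1 - (exp t - / 2) * u <= - (2 * exp t * u)) by nra.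
    assert (Hbig : nu * u < exp t * u) by (apply Rmult_lt_compat_r; nra).
    set (B := u1 + (exp t + / 2) * u) in *; set (A := u1 - (exp t - / 2) * u) in *.
    assert (0 < nu * u) by nra.
    assert (4 * B ^ 2 <= (2 * (nu * u)) ^ 2) by nra.
    assert ((2 * (nu * u)) ^ 2 < A ^ 2) by nra. lra.
  - fold (z th) in E; unfold be, al; rewrite E; ring.
Qed.

(** Here the comparison solutions are e^(-nu s) and e^(nu s), whose moduli are constant on vertical
    lines, and the coupling e^(2s)/(2 nu) is small. On the real line |u' + nu u| <= u/10, while u' -
    nu u <= -2u. *)
Lemma kt_nonzero_left (nu t th : R) : 1 <= nu -> exp t <= / 10 -> 0 <= th <= PI ->
  kt nu (RtoC t + RtoC th * Ci) <> 0%C.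
Proof.
  intros Hnu Hr Hth E.
  set (k := kt nu) in *; set (k1 := kt' nu).
  set (al := fun s => (k1 s - RtoC nu * k s)%C).
  set (be := fun s => (k1 s + RtoC nu * k s)%C).
  set (e := fun s => (cexp (2 * s) * RtoC (/ (2 * nu)))%C).
  assert (Hk : is_bessel nu k k1) by (apply kt_is_bessel; auto).
  assert (Ee : forall s, (e s * (be s - al s))%C = (cexp (2 * s) * k s)%C).
  { intros s; unfold e, be, al.
    replace (cexp (2 * s) * RtoC (/ (2 * nu)) * (k1 s + RtoC nu * k s - (k1 s - RtoC nu * k s)))%C
      with (cexp (2 * s) * k s * (RtoC 2 * RtoC nu * RtoC (/ (2 * nu))))%C by ring.
    rewrite <- !RtoC_mult; replace (2 * nu * / (2 * nu)) with 1 by (field; lra); ring. }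
  assert (N2 : RtoC (nu ^ 2) = (RtoC nu * RtoC nu)%C) by (rewrite <- RtoC_mult; f_equal; ring).
  assert (Dal : forall s, is_cderive al s (- RtoC nu * al s + e s * (be s - al s))%C).
  { intros s; rewrite Ee; eapply is_cderive_eq.
    - apply (is_cderive_minus k1 (fun s => RtoC nu * k s)%C); [apply Hk | apply is_cderive_scal, Hk].
    - unfold al; rewrite N2; ring. }
  assert (Dbe : forall s, is_cderive be s (RtoC nu * be s + e s * (be s - al s))%C).
  { intros s; rewrite Ee; eapply is_cderive_eq.
    - apply (is_cderive_plus k1 (fun s => RtoC nu * k s)%C); [apply Hk | apply is_cderive_scal, Hk].
    - unfold be; rewrite N2; ring. }
  set (z := fun th => (RtoC t + RtoC th * Ci)%C).
  apply (dominated_component (fun x => al (z x)) (fun x => be (z x))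
    (fun _ => - RtoC nu * Ci)%C (fun _ => RtoC nu * Ci)%C
    (fun x => e (z x) * Ci)%C) with (t := th); auto.
  - intros x Hx; pose proof (is_cderive_path al (RtoC t) Ci _ x (Dal _)) as P.
    fold (z x) in P; match type of P with is_pderive _ _ ?l => match goal with |- is_pderive _ _ ?l' =>
      replace l' with l by ring end end; exact P.
  - intros x Hx; pose proof (is_cderive_path be (RtoC t) Ci _ x (Dbe _)) as P.
    fold (z x) in P; match type of P with is_pderive _ _ ?l => match goal with |- is_pderive _ _ ?l' =>
      replace l' with l by ring end end; exact P.
  - intros x Hx; split; [simpl; lra | split; [simpl; lra|]].
    unfold e; rewrite !Cmod_mult, Cmod_Ci, Rmult_1_r, Cmod_cexp, Cmod_RtoC_pos
      by (left; apply Rinv_0_lt_compat; lra).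
    replace (Re (2 * z x)) with (t + t) by (unfold z; simpl; ring).
    rewrite exp_plus; pose proof (exp_pos t).
    assert (/ (2 * nu) <= / 2) by (apply Rinv_le_contravar; lra).
    assert (0 < / (2 * nu)) by (apply Rinv_0_lt_compat; lra).
    assert (exp t * exp t <= / 10 * / 10) by (apply Rmult_le_compat; lra).
    assert (exp t * exp t * / (2 * nu) <= / 10 * / 10 * / 2) by (apply Rmult_le_compat; nra). lra.
  - destruct (kt_recessive nu Hnu) as [_ R]; destruct (R t) as [r0 [r1 [_ r2]]].
    destruct (kt_real nu t Hnu) as [E0 E1].
    replace (z 0) with (RtoC t) by (unfold z; ring).
    unfold al, be, k, k1; rewrite E0, E1, <- !RtoC_mult,
      <- RtoC_minus, <- RtoC_plus, !Cmod_R, !pow2_abs.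
    set (u := Re (kt nu (RtoC t))) in *; set (u1 := Re (kt' nu (RtoC t))) in *.
    assert (Hbe : - (/ 10 * u) <= u1 + nu * u <= 0) by (split; nra).
    assert (Hal : u1 - nu * u <= - (2 * u)) by nra.
    set (B := u1 + nu * u) in *; set (A := u1 - nu * u) in *.
    assert (4 * B ^ 2 <= (2 * (/ 10 * u)) ^ 2) by nra.
    assert ((2 * (/ 10 * u)) ^ 2 < A ^ 2) by nra. lra.
  - fold (z th) in E; unfold be, al; rewrite E; ring.
Qed.

Lemma kt_zeros_bounded (N : R) : 1 <= N -> exists T, 0 < T /\
  forall nu s, 1 <= nu <= N -> Rabs (Im s) <= PI -> kt nu s = 0%C -> Rabs (Re s) <= T.
Proof.
  intros HN; exists (50 * N ^ 2 + 10); split; [nra|].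
  assert (Up : forall nu s, 1 <= nu <= N -> 0 <= Im s <= PI -> kt nu s = 0%C -> Rabs (Re s) <= 50 * N ^ 2 + 10).
  { intros nu s Hnu Hs E.
    assert (Es : s = (RtoC (Re s) + RtoC (Im s) * Ci)%C) by (apply C_eq; simpl; ring).
    apply Rabs_le; split; apply Rnot_lt_le; intros Hl.
    - rewrite Es in E; apply kt_nonzero_left in E; auto; try lra.
      pose proof (exp_ineq1_le (- Re s)) as X; pose proof (exp_Ropp (Re s)) as Y.
      pose proof (exp_pos (Re s)).
      rewrite <- (Rinv_inv (exp (Re s))), <- Y.
      apply Rinv_le_contravar; nra.
    - rewrite Es in E; apply kt_nonzero_right in E; auto; try lra.
      pose proof (exp_ineq1_le (Re s)); nra. }
  intros nu s Hnu Hs E; apply Rabs_le_between in Hs.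
  destruct (Rle_dec 0 (Im s)); [apply (Up nu); auto; lra|].
  rewrite <- (re_conj s); apply (Up nu); auto.
  - rewrite im_conj; lra.
  - destruct (kt_conj nu s (proj1 Hnu)) as [Ec _]; rewrite Ec, E; apply C_eq; simpl; ring.
Qed.

(** ** The boundary of the strip *)

Lemma cexp_pi (x : R) : cexp (RtoC x * Ci) = (cos x, sin x).
Proof.
  apply C_eq; [rewrite Re_cexp | rewrite Im_cexp];
    replace (Re (RtoC x * Ci)) with 0 by (simpl; ring);
    replace (Im (RtoC x * Ci)) with x by (simpl; ring); rewrite exp_0; simpl; ring.
Qed.

(** All exponents are nu + 2k, and the extra phase e^(2 pi i k) is 1. *)
Lemma bi_rotate (nu : R) (s : C) : bi nu (s + RtoC PI * Ci) = (cexp (RtoC (nu * PI) * Ci) * bi nu s)%C.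
Proof.
  unfold bi; rewrite (CSeries_scal _ _ (bi_dom nu (Cmod s))).
  - f_equal; apply functional_extensionality; intros k.
    replace (RtoC (nu + 2 * INR k) * (s + RtoC PI * Ci))%C with
      (RtoC (nu * PI) * Ci + RtoC (nu + 2 * INR k) * s + RtoC (INR k) * (RtoC (2 * PI) * Ci))%C
      by (rewrite !RtoC_plus, !RtoC_mult; ring).
    rewrite !cexp_plus, <- (cexp_pow (RtoC (2 * PI) * Ci)), (cexp_pi (2 * PI)), cos_2PI, sin_2PI.
    replace (1, 0) with (RtoC 1) by reflexivity.
    rewrite <- RtoC_pow, pow1; ring.
  - intros k; apply bi_term_dom0; lra.
  - apply ex_series_bi_dom.
Qed.

(** I_nu and I_(-nu) turn by opposite phases; the phase difference 2i sin(nu pi) cancels the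
    denominator and leaves I_nu over. This is the classical continuation formula of K_nu across the
    cut. *)
Lemma kn_rotate (nu : R) (s : C) : sin (nu * PI) <> 0 ->
  kn nu (s + RtoC PI * Ci) = (Cconj (cexp (RtoC (nu * PI) * Ci)) * kn nu s - RtoC PI * Ci * bi nu s)%C.
Proof.
  intros Hs; unfold kn; rewrite !bi_rotate.
  replace (- nu * PI) with (- (nu * PI)) by ring.
  rewrite !cexp_pi, cos_neg, sin_neg; set (c := cos (nu * PI)); set (q := sin (nu * PI)) in *.
  set (J := bi (- nu) s); set (I := bi nu s).
  apply C_eq; destruct J, I; unfold RtoC; simpl; field; auto.
Qed.

Lemma kt_boundary (nu t : R) : 1 <= nu -> sin (nu * PI) <> 0 ->
  Re (kt nu (RtoC t + RtoC PI * Ci)) = cos (nu * PI) * Re (kt nu (RtoC t)) /\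
  Im (kt nu (RtoC t + RtoC PI * Ci)) =
    - sin (nu * PI) * Re (kt nu (RtoC t)) - PI * ri nu t / rk nu 0.
Proof.
  intros Hnu Hs; pose proof (proj1 (sin_nonint nu) Hs) as Hz.
  assert (Hg : 0 < rk nu 0) by apply (rk_recessive nu Hnu Hz).
  pose proof (kn_rotate nu (RtoC t) Hs) as E.
  rewrite !kn_kt, bi_RtoC, cexp_pi in E by auto.
  destruct (kt_real nu t Hnu) as [E0 _]; rewrite E0 in E.
  set (u := Re (kt nu (RtoC t))) in *; set (w := kt nu (RtoC t + RtoC PI * Ci)) in *.
  split; apply Rmult_eq_reg_l with (rk nu 0); try lra.
  - rewrite <- Re_RtoC_mul, E; simpl; ring.
  - rewrite <- Im_RtoC_mul, E; simpl; field; lra.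
Qed.

(** At integer orders both sides are continuous in nu and agree at all nearby non-integer orders. *)
Lemma kt_boundary_re (nu t : R) : 1 < nu ->
  Re (kt nu (RtoC t + RtoC PI * Ci)) = cos (nu * PI) * Re (kt nu (RtoC t)).
Proof.
  intros Hnu; destruct (Req_dec (sin (nu * PI)) 0) as [Hs|Hs]; [|apply kt_boundary; auto; lra].
  pose proof (proj1 (kt_continuous_order nu (RtoC t + RtoC PI * Ci) Hnu)) as C1.
  pose proof (proj1 (kt_continuous_order nu (RtoC t) Hnu)) as C2.
  assert (C3 : continuity_pt (fun mu => cos (mu * PI)) nu)
    by (eapply is_derive_continuity_pt; auto_derive; auto; reflexivity).
  pose proof (continuity_pt_minus _ _ _ C1 (continuity_pt_mult _ _ _ C3 C2)) as CC.
  apply continuity_pt_is_lim in CC; apply is_lim_unique in CC.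
  apply Rminus_diag_uniq.
  match type of CC with Lim ?f _ = Finite ?v =>
    assert (L : is_lim f nu 0); [|apply is_lim_unique in L; rewrite L in CC; injection CC as CC; symmetry; exact CC] end.
  apply is_lim_ext_loc with (fun _ => 0); [|apply is_lim_const].
  assert (Hn : exists z : Z, nu = IZR z).
  { apply sin_eq_0_0 in Hs; destruct Hs as [z Hz]; exists z; pose proof PI_RGT_0.
    apply Rmult_eq_reg_r with PI; lra. }
  destruct Hn as [z Hz].
  exists (mkposreal (Rmin (nu - 1) (/ 2)) ltac:(apply Rmin_pos; lra)); intros y Hy Hne.
  change (Rabs (y - nu) < Rmin (nu - 1) (/ 2)) in Hy.
  pose proof (Rlt_le_trans _ _ _ Hy (Rmin_l _ _)) as H1; pose proof (Rlt_le_trans _ _ _ Hy (Rmin_r _ _)) as H2.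
  apply Rabs_lt_between in H1; apply Rabs_lt_between in H2.
  destruct (kt_boundary y t) as [B _]; [lra| |].
  - apply sin_nonint, (nonint_near z); rewrite <- Hz; [apply Rabs_lt_between; lra|].
    intros Ey; apply Hne; f_equal; auto.
  - unfold minus_fct, mult_fct; rewrite B; ring.
Qed.

Lemma cos_sin_nu (n : nat) (d : R) : cos ((nu_ n + d) * PI) = sin (d * PI) /\
  sin ((nu_ n + d) * PI) = - cos (d * PI).
Proof.
  unfold nu_; replace ((2 * INR n + 3 / 2 + d) * PI) with ((3 * (PI / 2) + d * PI) + 2 * INR n * PI) by field.
  rewrite cos_period, sin_period, cos_plus, sin_plus, cos_3PI2, sin_3PI2; split; ring.
Qed.

(** In this interval the real part can vanish only at nu_n + 1; there sin(nu pi) = 1 and the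
    imaginary part is a sum of two negative terms. At nu_n itself the sine is -1 and the two terms
    compete, which is how boundary zeros arise. *)
Lemma kt_boundary_nonzero (n : nat) (nu t : R) : nu_ n < nu < nu_ n + 2 ->
  kt nu (RtoC t + RtoC PI * Ci) <> 0%C.
Proof.
  intros Hnu E; pose proof (pos_INR n); pose proof PI_RGT_0.
  assert (H1 : 1 < nu) by (unfold nu_ in Hnu; lra).
  pose proof (kt_boundary_re nu t H1) as Hre; rewrite E in Hre; simpl in Hre.
  destruct (kt_recessive nu ltac:(lra)) as [_ R]; destruct (R t) as [r0 _].
  destruct (cos_sin_nu n (nu - nu_ n)) as [Hc Hs].
  replace (nu_ n + (nu - nu_ n)) with nu in Hc, Hs by ring.
  rewrite Hc in Hre; set (d := nu - nu_ n) in *.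
  assert (Hd : 0 < d < 2) by (unfold d; lra).
  assert (S0 : sin (d * PI) = 0).
  { destruct (Rmult_integral _ _ (eq_sym Hre)) as [|]; lra. }
  assert (d = 1).
  { destruct (Rtotal_order d 1) as [h|[h|h]]; auto.
    - pose proof (sin_gt_0 (d * PI) ltac:(nra) ltac:(nra)); lra.
    - pose proof (sin_lt_0 (d * PI) ltac:(nra) ltac:(nra)); lra. }
  subst d; rewrite H2, Rmult_1_l, cos_PI in Hs.
  assert (Hs0 : sin (nu * PI) <> 0) by lra.
  destruct (kt_boundary nu t ltac:(lra) Hs0) as [_ B]; rewrite E, Hs in B; simpl in B.
  assert (Hg : 0 < rk nu 0) by (apply (rk_recessive nu); [lra | apply sin_nonint; auto]).
  pose proof (ri_pos nu t ltac:(lra)).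
  assert (0 < PI * ri nu t / rk nu 0) by (apply Rdiv_lt_0_compat; auto; apply Rmult_lt_0_compat; lra).
  lra.
Qed.

(** * Dependence of the zeros on nu *)

Lemma disc_mean_value (k k1 : C -> C) (d s0 s s' : C) (r : R) :
  (forall s, is_cderive k s (k1 s)) ->
  (forall s, Cmod (s - s0)%C <= r -> Cmod (k1 s - d)%C <= Cmod d / 2) ->
  Cmod (s - s0)%C <= r -> Cmod (s' - s0)%C <= r ->
  Cmod (k s' - k s - d * (s' - s))%C <= Cmod d / 2 * Cmod (s' - s)%C.
Proof.
  intros Hk Hk1 Hs Hs'.
  pose proof (complex_mean_value k k1 s (s' - s)%C d (Cmod d / 2) Hk) as M.
  replace (s + (s' - s))%C with s' in M by ring; apply M; intros t Ht; apply Hk1.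
  replace (s + RtoC t * (s' - s) - s0)%C with (RtoC (1 - t) * (s - s0) + RtoC t * (s' - s0))%C
    by (rewrite RtoC_minus; ring).
  eapply Rle_trans; [apply Cmod_triangle|]; rewrite !Cmod_mult, !Cmod_R, !Rabs_pos_eq by lra; nra.
Qed.

(** Newton's map with the derivative frozen at [d]: s -> s - k(s)/d contracts distances in the disc
    by 1/2. The first step is at most r/4, so the iterates stay within r/2 of s0 and converge. *)
Lemma newton_zero (k k1 : C -> C) (d s0 : C) (r : R) : 0 < r -> d <> 0%C ->
  (forall s, is_cderive k s (k1 s)) ->
  (forall s, Cmod (s - s0)%C <= r -> Cmod (k1 s - d)%C <= Cmod d / 2) ->
  Cmod (k s0) <= Cmod d * r / 4 ->
  exists s, Cmod (s - s0)%C < r /\ k s = 0%C.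
Proof.
  intros Hr Hd Hk Hk1 Hs0; pose proof (proj1 (Cmod_gt_0 d) Hd) as Hdp.
  set (N := fun s => (s - k s / d)%C).
  assert (Contr : forall s s', Cmod (s - s0)%C <= r -> Cmod (s' - s0)%C <= r ->
    Cmod (N s' - N s)%C <= / 2 * Cmod (s' - s)%C).
  { intros s s' Hs Hs'.
    pose proof (disc_mean_value k k1 d s0 s s' r Hk Hk1 Hs Hs') as M'.
    unfold N; replace (s' - k s' / d - (s - k s / d))%C with (- ((k s' - k s - d * (s' - s)) / d))%C
      by (field; auto).
    rewrite Cmod_opp, Cmod_div by auto; apply Rle_div_l; auto; lra. }
  assert (HN0 : Cmod (N s0 - s0)%C <= r / 4).
  { unfold N; replace (s0 - k s0 / d - s0)%C with (- (k s0 / d))%C by ring.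
    rewrite Cmod_opp, Cmod_div by auto; apply Rle_div_l; auto; lra. }
  set (u := fun j => Nat.iter j N s0).
  assert (Hu : forall j, Cmod (u j - s0)%C <= r / 2 /\ Cmod (u (S j) - u j)%C <= r / 4 * (/ 2) ^ j).
  { induction j as [|j [IH1 IH2]].
    - simpl; replace (s0 - s0)%C with (RtoC 0) by ring; rewrite Cmod_0; split; [lra|].
      rewrite Rmult_1_r; exact HN0.
    - assert (B : Cmod (u (S j) - s0)%C <= r / 2).
      { change (u (S j)) with (N (u j)).
        eapply Rle_trans; [apply (Cmod_sub_triangle _ (N s0))|].
        pose proof (Contr s0 (u j) ltac:(replace (s0 - s0)%C with (RtoC 0) by ring; rewrite Cmod_0; lra)
          ltac:(lra)). lra. }
      split; auto.
      change (u (S (S j))) with (N (u (S j))); change (u (S j)) with (N (u j)) at 2.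
      eapply Rle_trans; [apply Contr; lra|]; simpl pow; lra. }
  assert (Geo : forall i j, (i <= j)%nat -> Cmod (u j - u i)%C <= r / 2 * (/ 2) ^ i).
  { intros i j Hij.
    assert (G : Cmod (u j - u i)%C <= r / 2 * (/ 2) ^ i - r / 2 * (/ 2) ^ j).
    { induction Hij as [|j Hij IH].
      - replace (u i - u i)%C with (RtoC 0) by ring; rewrite Cmod_0; lra.
      - eapply Rle_trans; [apply (Cmod_sub_triangle _ (u j))|].
        destruct (Hu j) as [_ H2]; simpl pow; lra. }
    assert (0 < (/ 2) ^ j) by (apply pow_lt; lra). nra. }
  assert (Small : forall eps, 0 < eps -> exists i, r / 2 * (/ 2) ^ i <= eps).
  { intros eps He; destruct (pow_lt_1_zero (/ 2) ltac:(rewrite Rabs_pos_eq; lra) (eps / r)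
      ltac:(apply Rdiv_lt_0_compat; lra)) as [i Hi].
    exists i; specialize (Hi i (le_n _)); rewrite Rabs_pos_eq in Hi by (left; apply pow_lt; lra).
    apply (proj2 (Rlt_div_r _ _ _ Hr)) in Hi; assert (0 < (/ 2) ^ i) by (apply pow_lt; lra); nra. }
  destruct (Ccauchy_converges u) as [s Hs].
  { intros eps He; destruct (Small (eps / 2)) as [i Hi]; [lra|]; exists i; intros p q Hp Hq.
    eapply Rle_trans; [apply (Cmod_sub_triangle _ (u i))|].
    rewrite (Cmod_sub_sym (u i)); pose proof (Geo i p Hp); pose proof (Geo i q Hq); lra. }
  exists s; split.
  { eapply Rle_lt_trans; [apply (Cconverges_le u s s0 (r / 2) 0 Hs); intros; apply Hu | lra]. }
  apply Cmod_small_0; intros eps He.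
  destruct (is_cderive_continuous k s _ (Hk s) (eps / 2)) as [del [Pd D]]; [lra|].
  destruct (Hs (del / 2)) as [J1 HJ1]; [lra|].
  destruct (Small (eps / (2 * Cmod d))) as [J2 HJ2]; [apply Rdiv_lt_0_compat; lra|].
  set (J := max J1 J2); specialize (HJ1 J ltac:(unfold J; lia)).
  specialize (D (u J) ltac:(lra)).
  pose proof (Geo J (S J) ltac:(lia)) as G.
  assert (PJ : (/ 2) ^ J <= (/ 2) ^ J2).
  { unfold J; clear; induction J1 as [|J1 IH]; [simpl; lra|].
    destruct (le_lt_dec J2 J1) as [h|h].
    - replace (max (S J1) J2) with (S (max J1 J2)) by lia.
      simpl; assert (0 < (/ 2) ^ max J1 J2) by (apply pow_lt; lra); lra.
    - replace (max (S J1) J2) with (max J1 J2) by lia; auto. }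
  assert (K : Cmod (k (u J)) <= eps / 2).
  { replace (k (u J)) with (- (d * (u (S J) - u J)))%C.
    - rewrite Cmod_opp, Cmod_mult.
      apply Rle_trans with (Cmod d * (eps / (2 * Cmod d))).
      + apply Rmult_le_compat_l; [lra|].
        eapply Rle_trans; [exact G|]; eapply Rle_trans; [|exact HJ2].
        apply Rmult_le_compat_l; lra.
      + right; field; lra.
    - change (u (S J)) with (N (u J)); unfold N; field; auto. }
  pose proof (Cmod_le_sub (k s) (k (u J))); rewrite (Cmod_sub_sym (k s)) in *; lra.
Qed.

Lemma zero_unique_in_disc (k k1 : C -> C) (d s0 s s' : C) (r : R) : d <> 0%C ->
  (forall s, is_cderive k s (k1 s)) ->
  (forall s, Cmod (s - s0)%C <= r -> Cmod (k1 s - d)%C <= Cmod d / 2) ->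
  Cmod (s - s0)%C <= r -> Cmod (s' - s0)%C <= r -> k s = 0%C -> k s' = 0%C -> s = s'.
Proof.
  intros Hd Hk Hk1 Hs Hs' E E'; pose proof (proj1 (Cmod_gt_0 d) Hd) as Hdp.
    pose proof (disc_mean_value k k1 d s0 s s' r Hk Hk1 Hs Hs') as M'.
  rewrite E, E' in M'; replace (0 - 0 - d * (s' - s))%C with (- (d * (s' - s)))%C in M' by ring.
  rewrite Cmod_opp, Cmod_mult in M'; pose proof (Cmod_ge_0 (s' - s)).
  assert (Z : Cmod (s' - s) = 0) by nra.
  apply Cmod_eq_0 in Z; replace s' with (s' - s + s)%C by ring; rewrite Z; ring.
Qed.

Lemma kt_joint_continuity (nu0 : R) (s0 : C) (eps : R) : 1 < nu0 -> 0 < eps -> exists d, 0 < d /\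
  forall nu s, Rabs (nu - nu0) < d -> Cmod (s - s0)%C < d ->
  1 < nu /\ Cmod (kt nu s - kt nu0 s0)%C < eps /\ Cmod (kt' nu s - kt' nu0 s0)%C < eps.
Proof.
  intros Hnu He; pose proof (Cmod_ge_0 s0).
  destruct (kt_continuity (2 + Cmod s0) (nu0 + 1)) as [K [HK HL]]; [lra | lra|].
  destruct (kt_is_bessel nu0 (Rlt_le _ _ Hnu) s0) as [D0 D1].
  destruct (is_cderive_continuous _ _ _ D0 (eps / 2)) as [d0 [P0 C0]]; [lra|].
  destruct (is_cderive_continuous _ _ _ D1 (eps / 2)) as [d1 [P1 C1]]; [lra|].
  set (d := Rmin (Rmin d0 d1) (Rmin 1 (Rmin (nu0 - 1) (eps / (2 * K))))).
  assert (B1 : d <= d0) by (unfold d; eapply Rle_trans; [apply Rmin_l | apply Rmin_l]).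
  assert (B2 : d <= d1) by (unfold d; eapply Rle_trans; [apply Rmin_l | apply Rmin_r]).
  assert (B3 : d <= 1) by (unfold d; eapply Rle_trans; [apply Rmin_r | apply Rmin_l]).
  assert (B4 : d <= nu0 - 1) by (unfold d; eapply Rle_trans; [apply Rmin_r|];
    eapply Rle_trans; [apply Rmin_r | apply Rmin_l]).
  assert (B5 : d <= eps / (2 * K)) by (unfold d; eapply Rle_trans; [apply Rmin_r|];
    eapply Rle_trans; [apply Rmin_r | apply Rmin_r]).
  exists d; split.
  { unfold d; repeat apply Rmin_pos; try lra; apply Rdiv_lt_0_compat; lra. }
  intros nu s Hn Hs.
  apply (proj2 (Rle_div_r d eps (2 * K) ltac:(lra))) in B5.
  pose proof Hn as Hn'; apply Rabs_lt_between in Hn'.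
  pose proof (Cmod_le_sub s s0).
  destruct (HL nu nu0 s ltac:(lra) ltac:(lra) ltac:(lra)) as [L0 L1].
  specialize (C0 s ltac:(lra)); specialize (C1 s ltac:(lra)).
  assert (K * Rabs (nu - nu0) <= K * d) by (apply Rmult_le_compat_l; lra).
  split; [lra|split; (eapply Rle_lt_trans; [eapply Cmod_sub_triangle|])].
  - eapply Rlt_le_trans; [apply Rplus_le_lt_compat; [exact L0 | exact C0]|]; lra.
  - eapply Rlt_le_trans; [apply Rplus_le_lt_compat; [exact L1 | exact C1]|]; lra.
Qed.

(** At a multiple zero the energy would vanish at s0, hence also at 0 by the growth estimate centred
    at s0, against kt = 1 there. *)
Lemma kt_zero_simple (nu : R) (s0 : C) : 1 <= nu -> kt nu s0 = 0%C -> kt' nu s0 <> 0%C.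
Proof.
  intros Hnu E0 E1; set (T := 1 + Cmod s0); pose proof (Cmod_ge_0 s0).
  pose proof (linear_growth (fun s => kt nu (s + s0)%C) (fun s => kt' nu (s + s0)%C)
    (fun s => cexp (2 * (s + s0)) + RtoC (nu ^ 2))%C (fun _ => 0%C) T
    (exp (2 * (T + Cmod s0)) + nu ^ 2) 0) as G.
  assert (G' := G ltac:(pose proof (exp_pos (2 * (T + Cmod s0))); pose proof (pow2_ge_0 nu); lra)
    ltac:(unfold T; lra)); clear G.
  assert (A1 : forall s, is_cderive (fun s => kt nu (s + s0)%C) s (kt' nu (s + s0)%C) /\
     is_cderive (fun s => kt' nu (s + s0)%C) s
       ((cexp (2 * (s + s0)) + RtoC (nu ^ 2)) * kt nu (s + s0) + 0)%C).
  { intros s; destruct (kt_is_bessel nu Hnu (s + s0)%C) as [D0 D1]; split.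
    - apply is_cderive_shift; auto.
    - rewrite Cplus_0_r; apply (is_cderive_shift (kt' nu)); auto. }
  specialize (G' A1).
  assert (G := G' ltac:(intros s Hs; apply Cmod_coeff_le; [rewrite Rabs_pos_eq; lra|];
    eapply Rle_trans; [apply Cmod_triangle | lra]) ltac:(intros; cbv beta; rewrite Cmod_0; lra)
    (- s0)%C ltac:(rewrite Cmod_opp; unfold T; lra)).
  cbv beta in G;   replace (- s0 + s0)%C with (RtoC 0) in G by ring.
  rewrite !Cplus_0_l, E0, E1, kt_0, Cmod_0, Cmod_1 in G by auto.
  pose proof (pow2_ge_0 (Cmod (kt' nu 0%C))); nra.
Qed.

Lemma uniform_radius (m : nat) (P : nat -> R -> Prop) :
  (forall i, (i < m)%nat -> exists r, 0 < r /\ forall r', 0 < r' <= r -> P i r') ->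
  exists r, 0 < r /\ forall r', 0 < r' <= r -> forall i, (i < m)%nat -> P i r'.
Proof.
  induction m as [|m IH]; intros H; [exists 1; split; [lra | lia]|].
  destruct IH as [r1 [R1 H1]]; [intros i Hi; apply H; lia|].
  destruct (H m (Nat.lt_succ_diag_r m)) as [r2 [R2 H2]].
  exists (Rmin r1 r2); split; [apply Rmin_pos; auto|]; intros r' Hr' i Hi.
  pose proof (Rmin_l r1 r2); pose proof (Rmin_r r1 r2).
  destruct (Nat.eq_dec i m) as [->|]; [apply H2; lra | apply H1; [lra | lia]].
Qed.

Definition injective_upto (m : nat) (w : nat -> C) : Prop :=
  forall i j, (i < m)%nat -> (j < m)%nat -> w i = w j -> i = j.

(** Newton's map gives exactly one zero near each simple zero. The radius rho is fixed before nu: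
    uniqueness in the disc of radius rho is what later forces independently chosen enumerations to
    agree. *)
Lemma zeros_persist (nu0 : R) (m : nat) (w : nat -> C) (r : R) : 1 < nu0 -> 0 < r ->
  injective_upto m w -> (forall i, (i < m)%nat -> kt nu0 (w i) = 0%C) ->
  exists rho d, 0 < rho /\ 0 < d /\ forall nu, Rabs (nu - nu0) < d -> exists w',
    injective_upto m w' /\ forall i, (i < m)%nat ->
      kt nu (w' i) = 0%C /\ Cmod (w' i - w i)%C < r /\
      forall s, kt nu s = 0%C -> Cmod (s - w i)%C < rho -> s = w' i.
Proof.
  intros Hnu Hr Hinj Hz.
  assert (Sep : forall i, (i < m)%nat -> exists r1, 0 < r1 /\ forall r', 0 < r' <= r1 ->
     forall j, (j < m)%nat -> i <> j -> 2 * r' <= Cmod (w i - w j)%C).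
  { intros i Hi; apply (uniform_radius m (fun j r' => i <> j -> 2 * r' <= Cmod (w i - w j)%C)).
    intros j Hj; destruct (Nat.eq_dec i j) as [->|Hij]; [exists 1; split; [lra | easy]|].
    assert (Hne : (w i - w j)%C <> 0%C).
    { intros E; apply Hij, Hinj; auto; replace (w i) with (w i - w j + w j)%C by ring; rewrite E; ring. }
    apply Cmod_gt_0 in Hne; exists (Cmod (w i - w j)%C / 2); split; [lra|]; intros; lra. }
  assert (Loc : forall i, (i < m)%nat -> exists r1, 0 < r1 /\ forall r', 0 < r' <= r1 ->
     exists d1, 0 < d1 /\ forall d', 0 < d' <= d1 -> forall nu, Rabs (nu - nu0) < d' ->
       (exists s, Cmod (s - w i)%C < r' /\ kt nu s = 0%C) /\
       (forall s s', Cmod (s - w i)%C <= r' -> Cmod (s' - w i)%C <= r' -> kt nu s = 0%C -> kt nu s' = 0%C -> s = s')).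
  { intros i Hi; set (dd := kt' nu0 (w i)).
    assert (Hdd : dd <> 0%C) by (apply kt_zero_simple; auto; lra).
    pose proof (proj1 (Cmod_gt_0 dd) Hdd) as Hp.
    destruct (kt_joint_continuity nu0 (w i) (Cmod dd / 2) Hnu ltac:(lra)) as [d1 [P1 J1]].
    exists (d1 / 2); split; [lra|]; intros r' Hr'.
    destruct (kt_joint_continuity nu0 (w i) (Cmod dd * r' / 4) Hnu ltac:(nra)) as [d2 [P2 J2]].
    exists (Rmin d1 d2); split; [apply Rmin_pos; auto|]; intros d' Hd' nu Hn.
    pose proof (Rmin_l d1 d2); pose proof (Rmin_r d1 d2).
    assert (Hd : forall s, Cmod (s - w i)%C <= r' -> Cmod (kt' nu s - dd)%C <= Cmod dd / 2).
    { intros s Hs; destruct (J1 nu s) as [_ [_ B]]; [lra | lra|]; fold dd in B; lra. }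
    destruct (J2 nu (w i) ltac:(lra)) as [Hn1 [B _]].
    { replace (w i - w i)%C with (RtoC 0) by ring; rewrite Cmod_0; auto. }
    rewrite Hz in B by auto; replace (kt nu (w i) - 0)%C with (kt nu (w i)) in B by ring.
    assert (Dk : forall s, is_cderive (kt nu) s (kt' nu s)) by (intros; apply kt_is_bessel; lra).
    split.
    - apply (newton_zero (kt nu) (kt' nu) dd); auto; lra.
    - intros s s' Hs Hs' E E'; apply (zero_unique_in_disc (kt nu) (kt' nu) dd (w i) s s' r'); auto. }
  destruct (uniform_radius m _ Sep) as [r1 [R1 S1]].
  destruct (uniform_radius m _ Loc) as [r2 [R2 L2]].
  (* rho is also at most half the mutual distances, keeping the new zeros distinct, and at most the
     radius on which the derivative is nearly constant. *)
  set (rho := Rmin r (Rmin r1 r2)).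
  assert (Hrho : 0 < rho) by (repeat apply Rmin_pos; auto).
  assert (Hrho1 : rho <= r) by apply Rmin_l.
  assert (Hrho2 : rho <= r1) by (eapply Rle_trans; [apply Rmin_r | apply Rmin_l]).
  assert (Hrho3 : rho <= r2) by (eapply Rle_trans; [apply Rmin_r | apply Rmin_r]).
  destruct (uniform_radius m (fun i d' => forall nu, Rabs (nu - nu0) < d' ->
       (exists s, Cmod (s - w i)%C < rho /\ kt nu s = 0%C) /\
       (forall s s', Cmod (s - w i)%C <= rho -> Cmod (s' - w i)%C <= rho ->
          kt nu s = 0%C -> kt nu s' = 0%C -> s = s'))) as [d [Hd HD]].
  { intros i Hi; apply (L2 rho); auto; lra. }
  specialize (HD d ltac:(lra)).
  exists rho, d; split; auto; split; auto; intros nu Hn.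
  assert (Ch : forall i, exists s, (i < m)%nat -> Cmod (s - w i)%C < rho /\ kt nu s = 0%C).
  { intros i; destruct (le_lt_dec m i) as [h|h]; [exists (w i); lia|].
    destruct (HD i h nu Hn) as [[s Hs] _]; exists s; auto. }
  apply choice in Ch; destruct Ch as [w' Hw'].
  exists w'; split.
  - intros i j Hi Hj E; apply NNPP; intros Hij.
    pose proof (S1 rho ltac:(lra) i Hi j Hj Hij) as S.
    destruct (Hw' i Hi) as [A _]; destruct (Hw' j Hj) as [B _]; rewrite E in A.
    pose proof (Cmod_sub_triangle (w i) (w' j) (w j)); rewrite (Cmod_sub_sym (w i) (w' j)) in *; lra.
  - intros i Hi; destruct (Hw' i Hi) as [A B]; split; auto; split; [lra|].
    intros s Es Hs; destruct (HD i Hi nu Hn) as [_ U]; apply U; auto; lra.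
Qed.

Definition strip_zero (nu : R) (s : C) : Prop := Rabs (Im s) <= PI /\ kt nu s = 0%C.

(** No zero comes from elsewhere. All zeros lie in a fixed compact rectangle; a point of it that is
    no zero at order nu0 has a neighbourhood free of zeros for nearby orders, and compactness makes
    the sizes uniform. *)
Lemma strip_zeros_near (nu0 r : R) : 1 < nu0 -> 0 < r -> exists d, 0 < d /\
  forall nu s, Rabs (nu - nu0) < d -> strip_zero nu s ->
  exists s0, strip_zero nu0 s0 /\ Cmod (s - s0)%C < r.
Proof.
  intros Hnu Hr.
  destruct (kt_zeros_bounded (nu0 + 1)) as [T [HT HB]]; [lra|].
  assert (Loc : forall p : R * R, exists del : posreal,
     (kt nu0 p = 0%C -> del <= r / 2) /\
     (kt nu0 p <> 0%C -> forall nu s, Rabs (nu - nu0) < del -> Cmod (s - p)%C < 2 * del -> kt nu s <> 0%C)).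
  { intros p; destruct (classic (kt nu0 p = 0%C)) as [E|E].
    - exists (mkposreal (r / 2) ltac:(lra)); simpl; split; [lra | easy].
    - pose proof (proj1 (Cmod_gt_0 _) E) as Hp.
      destruct (kt_joint_continuity nu0 p _ Hnu Hp) as [d [Pd J]].
      exists (mkposreal (d / 2) ltac:(lra)); simpl; split; [easy|].
      intros _ nu s Hn Hs Ez; destruct (J nu s ltac:(lra) ltac:(lra)) as [_ [B _]].
      rewrite Ez in B; replace (0 - kt nu0 p)%C with (- kt nu0 p)%C in B by ring.
      rewrite Cmod_opp in B; lra. }
  apply choice in Loc; destruct Loc as [del Hdel].
  (* A lower bound for the sizes of the covering neighbourhoods; the covering point is provided
     under a double negation, removed by [NNPP] below. *)
  destruct (compactness_value_2d (- T) T (- PI) PI (fun x y => del (x, y))) as [d Hd].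
  exists (Rmin (Rmin 1 (nu0 - 1)) d); split.
  { repeat apply Rmin_pos; try lra; apply cond_pos. }
  intros nu s Hn [Hs Ez].
  pose proof (Rlt_le_trans _ _ _ Hn (Rmin_l _ _)) as H1.
  pose proof (Rlt_le_trans _ _ _ H1 (Rmin_l _ _)) as H2.
  pose proof (Rlt_le_trans _ _ _ H1 (Rmin_r _ _)) as H3.
  pose proof (Rlt_le_trans _ _ _ Hn (Rmin_r _ _)) as H4.
  apply Rabs_lt_between in H2; apply Rabs_lt_between in H3.
  pose proof (HB nu s ltac:(lra) Hs Ez) as Hre.
  apply Rabs_le_between in Hre; pose proof Hs as Him; apply Rabs_le_between in Him.
  specialize (Hd (Re s) (Im s) ltac:(lra) ltac:(lra)); apply NNPP in Hd.
  destruct Hd as [u [v [Hu [Hv [Hx [Hy Hle]]]]]].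
  assert (Hdist : Cmod (s - (u, v))%C < 2 * del (u, v)).
  { eapply Rle_lt_trans; [apply Cmod_le_abs|].
    replace (Re (s - (u, v))%C) with (Re s - u) by reflexivity.
    replace (Im (s - (u, v))%C) with (Im s - v) by reflexivity; lra. }
  destruct (Hdel (u, v)) as [D1 D2].
  destruct (classic (kt nu0 (u, v) = 0%C)) as [E|E].
  - exists (u, v); split; [split; auto; simpl; apply Rabs_le; lra|].
    specialize (D1 E); lra.
  - exfalso; apply (D2 E nu s); auto; lra.
Qed.

(** If some w_i lies on the boundary, its perturbation may leave the strip; hence the last clause is
    an inclusion and not an enumeration. *)
Lemma strip_zeros_transfer (nu0 : R) (m : nat) (w : nat -> C) (r : R) : 1 < nu0 -> 0 < r ->
  enumerates m (strip_zero nu0) w ->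
  exists rho d, 0 < rho /\ 0 < d /\ forall nu, Rabs (nu - nu0) < d -> exists w',
    injective_upto m w' /\
    (forall i, (i < m)%nat -> kt nu (w' i) = 0%C /\ Cmod (w' i - w i)%C < r /\
      forall s, kt nu s = 0%C -> Cmod (s - w i)%C < rho -> s = w' i) /\
    (forall s, strip_zero nu s -> exists i, (i < m)%nat /\ s = w' i).
Proof.
  intros Hnu Hr [Hinj Hw].
  assert (Hz : forall i, (i < m)%nat -> kt nu0 (w i) = 0%C).
  { intros i Hi; apply (proj2 (Hw (w i))); exists i; auto. }
  destruct (zeros_persist nu0 m w r Hnu Hr Hinj Hz) as [rho [d1 [Hrho [Hd1 P]]]].
  destruct (strip_zeros_near nu0 rho Hnu Hrho) as [d2 [Hd2 Q]].
  exists rho, (Rmin d1 d2); split; auto; split; [apply Rmin_pos; auto|]; intros nu Hn.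
  destruct (P nu (Rlt_le_trans _ _ _ Hn (Rmin_l _ _))) as [w' [I' P']].
  exists w'; split; auto; split; auto.
  intros s Hs; destruct (Q nu s (Rlt_le_trans _ _ _ Hn (Rmin_r _ _)) Hs) as [s0 [Hs0 Hd]].
  apply Hw in Hs0; destruct Hs0 as [i [Hi ->]]; exists i; split; auto.
  apply (P' i Hi); auto; apply Hs.
Qed.

(** ** Counting *)

Lemma injection_le (m M : nat) (w v : nat -> C) : injective_upto m w ->
  (forall i, (i < m)%nat -> exists j, (j < M)%nat /\ w i = v j) -> (m <= M)%nat.
Proof.
  intros Hw H.
  rewrite <- (length_seq m 0), <- (length_map w), <- (length_seq M 0), <- (length_map v (seq 0 M)).
  apply NoDup_incl_length.
  - apply NoDup_map_NoDup_ForallPairs; [|apply seq_NoDup].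
    intros i j Hi Hj E; apply in_seq in Hi; apply in_seq in Hj; apply Hw; auto; lia.
  - intros s Hs; apply in_map_iff in Hs; destruct Hs as [i [<- Hi]]; apply in_seq in Hi.
    destruct (H i ltac:(lia)) as [j [Hj ->]]; apply in_map, in_seq; lia.
Qed.

Lemma enumerates_count_unique (m M : nat) (P : C -> Prop) (w v : nat -> C) :
  enumerates m P w -> enumerates M P v -> m = M.
Proof.
  intros [Iw Hw] [Iv Hv]; apply Nat.le_antisymm.
  - apply (injection_le m M w v Iw); intros i Hi; apply Hv, Hw; exists i; auto.
  - apply (injection_le M m v w Iv); intros i Hi; apply Hw, Hv; exists i; auto.
Qed.

(** Were no finite list complete, lists could be extended point by point beyond length M. *)
Lemma enumerates_exists (M : nat) (P : C -> Prop) :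
  (forall m w, injective_upto m w -> (forall i, (i < m)%nat -> P (w i)) -> (m <= M)%nat) ->
  exists m w, enumerates m P w.
Proof.
  intros H; apply NNPP; intros Hno.
  assert (Ext : forall m, exists w, injective_upto m w /\ forall i, (i < m)%nat -> P (w i)).
  { induction m as [|m [w [Iw Hw]]]; [exists (fun _ => 0%C); split; [intros i j Hi; lia | lia]|].
    destruct (classic (exists s, P s /\ forall i, (i < m)%nat -> s <> w i)) as [[s [Ps Hs]]|Hn].
    - exists (fun i => if Nat.eq_dec i m then s else w i); split.
      + intros i j Hi Hj; destruct (Nat.eq_dec i m), (Nat.eq_dec j m); intros E; subst; auto.
        * destruct (Hs j); auto; lia.
        * destruct (Hs i); auto; lia.
        * apply Iw; auto; lia.
      + intros i Hi; destruct (Nat.eq_dec i m); auto; apply Hw; lia.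
    - exfalso; apply Hno; exists m, w; split; auto; intros s; split.
      + intros Ps; apply NNPP; intros Hi; apply Hn; exists s; split; auto.
        intros i Him E; apply Hi; exists i; auto.
      + intros [i [Hi ->]]; auto. }
  destruct (Ext (S M)) as [w [Iw Hw]]; specialize (H (S M) w Iw Hw); lia.
Qed.

Definition open_strip_zero (nu : R) (s : C) : Prop := Rabs (Im s) < PI /\ kt nu s = 0%C.

Lemma kt_zero_conj (nu : R) (s : C) : 1 <= nu -> kt nu s = 0%C -> kt nu (Cconj s) = 0%C.
Proof.
  intros Hnu E; destruct (kt_conj nu s Hnu) as [Ec _]; rewrite Ec, E; apply C_eq; simpl; ring.
Qed.

Lemma nu_gt_1 (n : nat) : 1 < nu_ n.
Proof. unfold nu_; pose proof (pos_INR n); lra. Qed.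

Lemma strip_zero_open (n : nat) (nu : R) (s : C) : nu_ n < nu < nu_ n + 2 ->
  strip_zero nu s <-> open_strip_zero nu s.
Proof.
  intros Hnu; pose proof (nu_gt_1 n); split; intros [Hs E]; split; auto; [|lra].
  destruct (Rle_lt_or_eq_dec _ _ Hs) as [|Heq]; auto; exfalso.
  assert (A : forall s, Im s = PI -> kt nu s = 0%C -> False).
  { intros u Iu Eu; apply (kt_boundary_nonzero n nu (Re u)); auto.
    replace (RtoC (Re u) + RtoC PI * Ci)%C with u; auto.
    apply C_eq; simpl; [ring | rewrite <- Iu; ring]. }
  unfold Rabs in Heq; destruct (Rcase_abs (Im s)).
  - apply (A (Cconj s)); [rewrite im_conj; lra|]; apply kt_zero_conj; auto; lra.
  - apply (A s); auto.
Qed.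

Lemma interior_radius (m : nat) (w : nat -> C) :
  (forall i, (i < m)%nat -> Rabs (Im (w i)) < PI) -> exists r, 0 < r /\
  forall i s, (i < m)%nat -> Cmod (s - w i)%C < r -> Rabs (Im s) <= PI.
Proof.
  intros H.
  destruct (uniform_radius m (fun i r => r <= PI - Rabs (Im (w i)))) as [r [Hr HR]].
  { intros i Hi; specialize (H i Hi); exists (PI - Rabs (Im (w i))); split; [lra | intros; lra]. }
  exists r; split; auto; intros i s Hi Hs; specialize (HR r ltac:(lra) i Hi).
  pose proof (im_le_Cmod (s - w i)%C) as B.
  replace (Im (s - w i)%C) with (Im s - Im (w i)) in B by reflexivity.
  pose proof (Rabs_triang (Im s - Im (w i)) (Im (w i))) as Tr.
  replace (Im s - Im (w i) + Im (w i)) with (Im s) in Tr by ring; lra.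
Qed.

Lemma point_below (a c d : R) : a < c -> 0 < d -> exists y, a < y < c /\ Rabs (y - c) < d.
Proof.
  intros Hac Hd; exists (Rmax ((a + c) / 2) (c - d / 2)).
  pose proof (Rmax_l ((a + c) / 2) (c - d / 2)); pose proof (Rmax_r ((a + c) / 2) (c - d / 2)).
  assert (Rmax ((a + c) / 2) (c - d / 2) < c) by (apply Rmax_lub_lt; lra).
  split; [lra | rewrite Rabs_left1; lra].
Qed.

(** All zeros at order nu0 are interior, so small perturbations keep them in the strip, and the
    inclusion of the transfer lemma becomes an enumeration. *)
Lemma open_count_locally_constant (n m : nat) (nu0 : R) (w : nat -> C) : nu_ n < nu0 < nu_ n + 2 ->
  enumerates m (strip_zero nu0) w -> exists d, 0 < d /\
  forall nu, Rabs (nu - nu0) < d -> exists w', enumerates m (strip_zero nu) w'.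
Proof.
  intros Hnu Hw; pose proof (nu_gt_1 n).
  destruct (interior_radius m w) as [r [Hr HR]].
  { intros i Hi; apply (strip_zero_open n nu0); auto; apply Hw; exists i; auto. }
  destruct (strip_zeros_transfer nu0 m w r ltac:(lra) Hr Hw) as [rho [d [_ [Hd T]]]].
  exists d; split; auto; intros nu Hn; destruct (T nu Hn) as [w' [I' [Z' C']]].
  exists w'; split; auto; intros s; split; auto.
  intros [i [Hi ->]]; destruct (Z' i Hi) as [E [D _]]; split; eauto.
Qed.

(** Connectedness through the supremum c of the points up to which the count is M. At c the zeros
    are finite in number, since any finite family of them persists slightly to the left, where there
    are only M. Local constancy then gives M at c and beyond. *)
Lemma strip_zero_count (n M : nat) (d0 : R) : 0 < d0 ->
  (forall nu, nu_ n < nu < nu_ n + d0 -> exists w, enumerates M (strip_zero nu) w) ->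
  forall nu, nu_ n < nu < nu_ n + 2 -> exists w, enumerates M (strip_zero nu) w.
Proof.
  intros Hd0 H0 nu1 Hnu1; pose proof (nu_gt_1 n) as Hn1; apply NNPP; intros Hno.
  set (a := nu_ n) in *.
  set (E := fun x => a < x <= nu1 /\ forall y, a < y < x -> exists w, enumerates M (strip_zero y) w).
  destruct (completeness E) as [c [Hub Hlub]].
  { exists nu1; intros x [Hx _]; lra. }
  { exists (Rmin nu1 (a + d0)); split.
    - split; [apply Rmin_glb_lt; lra | apply Rmin_l].
    - intros y Hy; apply H0; pose proof (Rmin_r nu1 (a + d0)); lra. }
  assert (Hc1 : a < c).
  { assert (Ex : E (Rmin nu1 (a + d0))).
    { split; [split; [apply Rmin_glb_lt; lra | apply Rmin_l]|].
      intros y Hy; apply H0; pose proof (Rmin_r nu1 (a + d0)); lra. }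
    apply Hub in Ex; assert (a < Rmin nu1 (a + d0)) by (apply Rmin_glb_lt; lra); lra. }
  assert (Hc2 : c <= nu1) by (apply Hlub; intros x [Hx _]; lra).
  assert (Below : forall y, a < y < c -> exists w, enumerates M (strip_zero y) w).
  { intros y Hy; apply NNPP; intros Hny.
    assert (U : is_upper_bound E y).
    { intros x [Hx HE]; apply Rnot_lt_le; intros h; apply Hny, HE; lra. }
    apply Hlub in U; lra. }
  assert (Hc : a < c < a + 2) by lra.
  assert (Hex : exists m w, enumerates m (strip_zero c) w).
  { apply enumerates_exists with M; intros m w Iw Hw.
    destruct (interior_radius m w) as [r [Hr HR]].
    { intros i Hi; apply (strip_zero_open n c); auto. }
    destruct (zeros_persist c m w r ltac:(lra) Hr Iw (fun i Hi => proj2 (Hw i Hi))) as [rho [d [_ [Hd P]]]].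
    destruct (point_below a c d Hc1 Hd) as [y Hy].
    destruct (P y (proj2 Hy)) as [w' [I' Z']]; destruct (Below y (proj1 Hy)) as [v [_ Hv]].
    apply (injection_le m M w' v I'); intros i Hi; apply Hv.
    destruct (Z' i Hi) as [Ei [D _]]; split; eauto. }
  destruct Hex as [m [w Hw]].
  destruct (open_count_locally_constant n m c w Hc Hw) as [d [Hd L]].
  assert (Em : m = M).
  { destruct (point_below a c d Hc1 Hd) as [y Hy].
    destruct (L y (proj2 Hy)) as [w' W']; destruct (Below y (proj1 Hy)) as [v V].
    apply (enumerates_count_unique m M _ w' v W' V). }
  subst m.
  destruct (Rle_lt_or_eq_dec _ _ Hc2) as [Hlt|Heq]; [|subst c; apply Hno; exists w; auto].
  assert (Ex : E (Rmin nu1 (c + d))).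
  { split; [split; [apply Rmin_glb_lt; lra | apply Rmin_l]|]; intros y Hy.
    pose proof (Rmin_r nu1 (c + d)).
    destruct (Rlt_le_dec y c); [apply Below; lra|]; apply L; rewrite Rabs_pos_eq; lra. }
  apply Hub in Ex; assert (c < Rmin nu1 (c + d)) by (apply Rmin_glb_lt; lra); lra.
Qed.

(** * The order nu_n *)

Ltac eqC := match goal with |- @eq _ ?a ?b => change (@eq C a b) end.

Definition pk_coef (n k : nat) : R := hankel (nu_ n) k / 2 ^ k.

Lemma pk_coef_0 (n : nat) : pk_coef n 0 = 1.
Proof. unfold pk_coef, hankel; simpl; field. Qed.

Lemma pk_coef_succ (n k : nat) :
  2 * INR (S k) * pk_coef n (S k) = (nu_ n ^ 2 - (INR k + / 2) ^ 2) * pk_coef n k.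
Proof.
  unfold pk_coef, hankel.
  change (hankel_prod (nu_ n) (S k)) with
    (hankel_prod (nu_ n) k * (4 * nu_ n ^ 2 - (2 * INR (S k) - 1) ^ 2)).
  rewrite fact_simpl, mult_INR; replace (2 * S k)%nat with (S (S (2 * k))) by lia.
  rewrite <- !tech_pow_Rmult.
  pose proof (INR_fact_lt_0 k); pose proof (pos_INR k).
  assert (0 < 2 ^ k) by (apply pow_lt; lra). assert (0 < 2 ^ (2 * k)) by (apply pow_lt; lra).
  rewrite S_INR; field; repeat split; lra.
Qed.

Lemma pk_coef_pos (n k : nat) : (k <= 2 * n + 1)%nat -> 0 < pk_coef n k.
Proof.
  induction k as [|k IH]; intros Hk; [rewrite pk_coef_0; lra|].
  specialize (IH ltac:(lia)); pose proof (pk_coef_succ n k) as E.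
  assert (Hk' : INR k <= 2 * INR n).
  { replace (2 * INR n) with (INR (2 * n)) by (rewrite mult_INR; simpl; ring); apply le_INR; lia. }
  pose proof (pos_INR k); pose proof (pos_INR (S k)).
  assert (0 < nu_ n ^ 2 - (INR k + / 2) ^ 2) by (unfold nu_; nra).
  assert (0 < INR (S k)) by (apply lt_0_INR; lia).
  assert (0 < 2 * INR (S k) * pk_coef n (S k)) by (rewrite E; apply Rmult_lt_0_compat; auto).
  apply Rmult_lt_reg_l with (2 * INR (S k)); lra.
Qed.

(** In z = e^s this is e^(-z) z^(-a). *)
Definition pk_term (a : R) (s : C) : C := cexp (- cexp s - RtoC a * s).

Lemma pk_term_mul (a : R) (s : C) : (cexp s * pk_term a s)%C = pk_term (a - 1) s.
Proof. unfold pk_term; rewrite <- cexp_plus, RtoC_minus; f_equal; ring. Qed.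

Lemma pk_term_derive (a : R) (s : C) :
  is_cderive (pk_term a) s (- pk_term (a - 1) s - RtoC a * pk_term a s)%C.
Proof.
  eapply is_cderive_eq.
  - apply (is_cderive_comp cexp (fun s => - cexp s - RtoC a * s)%C); [|apply is_cderive_cexp].
    apply (is_cderive_minus (fun s => - cexp s)%C (fun s => RtoC a * s)%C).
    + replace (fun s => - cexp s)%C with (fun s => -1 * cexp s)%C
        by (apply functional_extensionality; intros; ring).
      apply is_cderive_scal, is_cderive_cexp.
    + apply is_cderive_scal, is_cderive_id.
  - fold (pk_term a s); rewrite <- pk_term_mul; ring.
Qed.

(** The finite expansion of K_(nu_n)(e^s) without its factor sqrt(pi/2). *)
Definition pk (n : nat) (s : C) : C :=
  sum_n (fun k => RtoC (pk_coef n k) * pk_term (INR k + / 2) s)%C (2 * n + 1).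

Definition pk' (n : nat) (s : C) : C :=
  sum_n (fun k => RtoC (pk_coef n k) *
    (- pk_term (INR k + / 2 - 1) s - RtoC (INR k + / 2) * pk_term (INR k + / 2) s))%C (2 * n + 1).

Lemma is_cderive_sum_n (f f1 : nat -> C -> C) (s : C) (m : nat) :
  (forall k, is_cderive (f k) s (f1 k s)) ->
  is_cderive (fun s => sum_n (fun k => f k s) m) s (sum_n (fun k => f1 k s) m).
Proof.
  intros H; induction m as [|m IH].
  - rewrite sum_O; replace (fun s => sum_n (fun k => f k s) 0) with (f 0%nat); auto.
    apply functional_extensionality; intros u; rewrite sum_O; auto.
  - rewrite sum_n_SC.
    replace (fun s => sum_n (fun k => f k s) (S m)) with (fun s => sum_n (fun k => f k s) m + f (S m) s)%C.
    + apply is_cderive_plus; auto.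
    + apply functional_extensionality; intros u; rewrite sum_n_SC; auto.
Qed.

(** By the coefficient recurrence the sums telescope: each partial sum solves the equation up to one
    term with factor (m + 1/2)^2 - nu_n^2, which vanishes at m = 2n+1, where m + 1/2 = nu_n. *)
Lemma pk_is_bessel (n : nat) : is_bessel (nu_ n) (pk n) (pk' n).
Proof.
  intros s; split.
  - apply (is_cderive_sum_n (fun k s => RtoC (pk_coef n k) * pk_term (INR k + / 2) s)%C
      (fun k s => RtoC (pk_coef n k) *
        (- pk_term (INR k + / 2 - 1) s - RtoC (INR k + / 2) * pk_term (INR k + / 2) s))%C).
    intros k; apply is_cderive_scal, pk_term_derive.
  - eapply is_cderive_eq.
    + apply (is_cderive_sum_n (fun k s => RtoC (pk_coef n k) *
        (- pk_term (INR k + / 2 - 1) s - RtoC (INR k + / 2) * pk_term (INR k + / 2) s))%C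
        (fun k s => RtoC (pk_coef n k) *
        (-1 * (- pk_term (INR k + / 2 - 1 - 1) s - RtoC (INR k + / 2 - 1) * pk_term (INR k + / 2 - 1) s) -
         RtoC (INR k + / 2) * (- pk_term (INR k + / 2 - 1) s - RtoC (INR k + / 2) * pk_term (INR k + / 2) s)))%C).
      intros k; apply is_cderive_scal.
      replace (fun s => - pk_term (INR k + / 2 - 1) s - RtoC (INR k + / 2) * pk_term (INR k + / 2) s)%C with
        (fun s => -1 * pk_term (INR k + / 2 - 1) s - RtoC (INR k + / 2) * pk_term (INR k + / 2) s)%C
        by (apply functional_extensionality; intros; ring).
      apply (is_cderive_minus (fun s => -1 * pk_term (INR k + / 2 - 1) s)%C
         (fun s => RtoC (INR k + / 2) * pk_term (INR k + / 2) s)%C);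
        apply is_cderive_scal, pk_term_derive.
    + assert (Part : forall m, sum_n (fun k => RtoC (pk_coef n k) *
        (-1 * (- pk_term (INR k + / 2 - 1 - 1) s - RtoC (INR k + / 2 - 1) * pk_term (INR k + / 2 - 1) s) -
         RtoC (INR k + / 2) * (- pk_term (INR k + / 2 - 1) s - RtoC (INR k + / 2) * pk_term (INR k + / 2) s)))%C m =
        ((cexp (2 * s) + RtoC (nu_ n ^ 2)) * sum_n (fun k => RtoC (pk_coef n k) * pk_term (INR k + / 2) s) m +
         RtoC (pk_coef n m * ((INR m + / 2) ^ 2 - nu_ n ^ 2)) * pk_term (INR m + / 2) s)%C).
      { assert (Step : forall k, (RtoC (pk_coef n k) *
        (-1 * (- pk_term (INR k + / 2 - 1 - 1) s - RtoC (INR k + / 2 - 1) * pk_term (INR k + / 2 - 1) s) -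
         RtoC (INR k + / 2) * (- pk_term (INR k + / 2 - 1) s - RtoC (INR k + / 2) * pk_term (INR k + / 2) s)) =
         (cexp (2 * s) + RtoC (nu_ n ^ 2)) * (RtoC (pk_coef n k) * pk_term (INR k + / 2) s) +
         (RtoC (2 * INR k * pk_coef n k) * pk_term (INR k + / 2 - 1) s +
          RtoC (pk_coef n k * ((INR k + / 2) ^ 2 - nu_ n ^ 2)) * pk_term (INR k + / 2) s))%C).
        { intros k; rewrite <- !pk_term_mul.
          replace (cexp (2 * s)) with (cexp s * cexp s)%C by (rewrite <- cexp_plus; f_equal; ring).
          replace (INR k + / 2 - 1) with (INR k - / 2) by field.
          replace (RtoC (2 * INR k * pk_coef n k)) with
            (RtoC (pk_coef n k) * (RtoC (INR k - / 2) + RtoC (INR k + / 2)))%C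
            by (rewrite <- RtoC_plus, <- RtoC_mult; f_equal; field).
          replace (RtoC (pk_coef n k * ((INR k + / 2) ^ 2 - nu_ n ^ 2))) with
            (RtoC (pk_coef n k) * (RtoC (INR k + / 2) * RtoC (INR k + / 2) - RtoC (nu_ n ^ 2)))%C
            by (rewrite <- RtoC_mult, <- RtoC_minus, <- RtoC_mult; f_equal; ring).
          ring. }
        induction m as [|m IH].
        - rewrite !sum_O, Step; simpl INR; rewrite Rmult_0_r, Rmult_0_l; eqC; ring.
        - rewrite !sum_n_SC, IH, Step, pk_coef_succ.
          replace (INR (S m) + / 2 - 1) with (INR m + / 2) by (rewrite S_INR; ring).
          replace (pk_coef n m * ((INR m + / 2) ^ 2 - nu_ n ^ 2)) with
            (- ((nu_ n ^ 2 - (INR m + / 2) ^ 2) * pk_coef n m)) by ring.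
          rewrite RtoC_opp; eqC; ring. }
      cbv beta; rewrite Part; unfold pk.
      replace ((INR (2 * n + 1) + / 2) ^ 2 - nu_ n ^ 2) with 0.
      * rewrite Rmult_0_r; ring.
      * unfold nu_; rewrite plus_INR, mult_INR; simpl; field.
Qed.

Lemma sum_n_RtoC (f : nat -> R) (m : nat) : sum_n (fun k => RtoC (f k)) m = RtoC (sum_n f m).
Proof.
  induction m as [|m IH]; [rewrite !sum_O; auto|].
  rewrite sum_n_SC, sum_Sn, IH, <- RtoC_plus; reflexivity.
Qed.

Definition rpk_term (a t : R) : R := exp (- exp t - a * t).

Lemma pk_term_RtoC (a t : R) : pk_term a (RtoC t) = RtoC (rpk_term a t).
Proof.
  unfold pk_term, rpk_term; rewrite cexp_RtoC, <- RtoC_opp, <- RtoC_mult, <- RtoC_minus; apply cexp_RtoC.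
Qed.

Lemma pk_RtoC (n : nat) (t : R) : pk n (RtoC t) =
  RtoC (sum_n (fun k => pk_coef n k * rpk_term (INR k + / 2) t) (2 * n + 1)).
Proof.
  unfold pk; rewrite <- sum_n_RtoC; f_equal; apply functional_extensionality; intros k.
  rewrite pk_term_RtoC, <- RtoC_mult; reflexivity.
Qed.

Lemma pk'_RtoC (n : nat) (t : R) : pk' n (RtoC t) =
  RtoC (sum_n (fun k => pk_coef n k * (- rpk_term (INR k + / 2 - 1) t -
     (INR k + / 2) * rpk_term (INR k + / 2) t)) (2 * n + 1)).
Proof.
  unfold pk'; rewrite <- sum_n_RtoC; f_equal; apply functional_extensionality; intros k.
  rewrite !pk_term_RtoC, <- RtoC_mult, <- RtoC_opp, <- RtoC_minus, <- RtoC_mult; reflexivity.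
Qed.

Lemma rpk_term_le (a t : R) : -1 <= a -> 0 <= t -> 0 < rpk_term a t <= 1.
Proof.
  intros Ha Ht; unfold rpk_term; split; [apply exp_pos|].
  rewrite <- exp_0; apply exp_le; pose proof (exp_ineq1_le t); nra.
Qed.

Lemma sum_n_bounded (f g : nat -> R) (m : nat) : (forall k, (k <= m)%nat -> Rabs (f k) <= g k) ->
  Rabs (sum_n f m) <= sum_n g m.
Proof.
  induction m as [|m IH]; intros H; [rewrite !sum_O; auto|].
  rewrite !sum_Sn; eapply Rle_trans; [apply Rabs_triang|].
  apply Rplus_le_compat; [apply IH; auto | apply H; auto].
Qed.

Lemma pk_0_pos (n : nat) : 0 < Re (pk n 0%C).
Proof.
  rewrite pk_RtoC; simpl Re.
  assert (H : forall m, (m <= 2 * n + 1)%nat ->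
    0 < sum_n (fun k => pk_coef n k * rpk_term (INR k + / 2) 0) m).
  { induction m as [|m IH]; intros Hm.
    - rewrite sum_O; apply Rmult_lt_0_compat; [apply pk_coef_pos; auto | apply exp_pos].
    - rewrite sum_Sn; apply Rplus_lt_0_compat; [apply IH; lia|].
      apply Rmult_lt_0_compat; [apply pk_coef_pos; auto | apply exp_pos]. }
  apply H; auto.
Qed.

(** The Wronskian of [pk] and [kt] is constant, and it tends to 0 at infinity because [pk] and its
    derivative are bounded for t >= 0 while [kt] and its derivative decay. Hence the data at s = 0
    are proportional. *)
Lemma pk_kt (n : nat) (s : C) : pk n s = (pk n 0%C * kt (nu_ n) s)%C.
Proof.
  pose proof (nu_gt_1 n) as Hn; set (nu := nu_ n) in *.
  assert (Hnu : 3 / 2 <= nu) by (unfold nu, nu_; pose proof (pos_INR n); lra).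
  pose proof (kt_recessive nu ltac:(lra)) as R.
  set (u := fun t => Re (kt nu (RtoC t))) in *; set (u1 := fun t => Re (kt' nu (RtoC t))) in *.
  set (q := fun t => Re (pk n (RtoC t))); set (q1 := fun t => Re (pk' n (RtoC t))).
  assert (Hq : real_bessel nu q q1) by exact (bessel_real_line _ _ _ (pk_is_bessel n)).
  set (A := sum_n (fun k => pk_coef n k) (2 * n + 1)).
  set (B := sum_n (fun k => pk_coef n k * (1 + (INR k + / 2))) (2 * n + 1)).
  assert (HA : forall t, 0 <= t -> Rabs (q t) <= A).
  { intros t Ht; unfold q; rewrite pk_RtoC; apply sum_n_bounded; intros k Hk.
    pose proof (pk_coef_pos n k Hk); pose proof (pos_INR k).
    destruct (rpk_term_le (INR k + / 2) t ltac:(lra) Ht).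
    rewrite Rabs_pos_eq by nra; nra. }
  assert (HB : forall t, 0 <= t -> Rabs (q1 t) <= B).
  { intros t Ht; unfold q1; rewrite pk'_RtoC; apply sum_n_bounded; intros k Hk.
    pose proof (pk_coef_pos n k Hk); pose proof (pos_INR k).
    destruct (rpk_term_le (INR k + / 2) t ltac:(lra) Ht).
    destruct (rpk_term_le (INR k + / 2 - 1) t ltac:(lra) Ht).
    rewrite Rabs_mult, (Rabs_pos_eq (pk_coef n k)) by lra; apply Rmult_le_compat_l; [lra|].
    apply Rabs_le; nra. }
  assert (u0 : u 0 = 1) by (unfold u; rewrite kt_0 by lra; reflexivity).
  assert (W0 : Rabs (q1 0 * u 0 - q 0 * u1 0) <= 0).
  { apply is_lim_0_le with (f := fun t => (B + A * (1 + nu)) * exp (- t)) (t := 0); [apply scaled_exp_neg_lim|].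
    (* At t = 2 tau the decay exp(t - nu t), with nu >= 3/2, is at most exp(-tau). *)
    intros tau Htau; set (t := 2 * tau).
    rewrite <- (wronskian_constant nu q q1 u u1 t Hq (proj1 R)).
    specialize (HA t ltac:(unfold t; lra)); specialize (HB t ltac:(unfold t; lra)).
    pose proof (recessive_decay nu t u u1 R ltac:(unfold t; lra)) as D; rewrite u0, Rmult_1_l in D.
    destruct R as [_ R]; destruct (R t) as [r0 [r1 [_ r2]]].
    assert (E1 : exp t * exp (- (nu * t)) <= exp (- tau)).
    { rewrite <- exp_plus; apply exp_le; unfold t; nra. }
    pose proof (exp_ineq1_le t) as Et.
    assert (E2 : exp t * u t <= exp (- tau)).
    { eapply Rle_trans; [|exact E1]; apply Rmult_le_compat_l; [left; apply exp_pos | auto]. }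
    assert (E3 : u t <= exp t * u t) by (unfold t in *; nra).
    assert (E4 : Rabs (u1 t) <= (exp t + nu) * u t) by (apply Rabs_le; nra).
    unfold Rminus; eapply Rle_trans; [apply Rabs_triang|]; rewrite Rabs_Ropp, !Rabs_mult.
    rewrite (Rabs_pos_eq (u t)) by lra.
    assert (0 <= A) by (eapply Rle_trans; [apply Rabs_pos | exact HA]).
    assert (0 <= B) by (eapply Rle_trans; [apply Rabs_pos | exact HB]).
    assert (Rabs (q1 t) * u t <= B * exp (- tau)) by (apply Rmult_le_compat; [apply Rabs_pos | lra | lra | lra]).
    assert (Rabs (q t) * Rabs (u1 t) <= A * ((1 + nu) * exp (- tau)))
      by (apply Rmult_le_compat; [apply Rabs_pos | apply Rabs_pos | lra | nra]).
    lra. }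
  assert (W : q1 0 = q 0 * u1 0) by (apply Rabs_le_between in W0; rewrite u0 in W0; lra).
  assert (P0 : pk n 0%C = RtoC (q 0)) by (unfold q; rewrite pk_RtoC; reflexivity).
  assert (P1 : pk' n 0%C = RtoC (q1 0)) by (unfold q1; rewrite pk'_RtoC; reflexivity).
  assert (E0 : pk n 0%C = (pk n 0%C * kt nu 0%C)%C) by (rewrite kt_0 by lra; ring).
  assert (E1 : pk' n 0%C = (pk n 0%C * kt' nu 0%C)%C).
  { rewrite P0, P1, (proj2 (kt_real nu 0 ltac:(lra))); fold (u1 0); rewrite <- RtoC_mult, W; auto. }
  destruct (bessel_unique nu _ _ _ _ (pk_is_bessel n)
    (is_bessel_scal nu (pk n 0%C) _ _ (kt_is_bessel nu ltac:(lra))) E0 E1 s) as [E _]; exact E.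
Qed.

Lemma sum_n_shift (f : nat -> C) (m : nat) : sum_n f (S m) = (f 0%nat + sum_n (fun k => f (S k)) m)%C.
Proof.
  induction m as [|m IH]; [rewrite sum_n_SC, !sum_O; auto|].
  rewrite sum_n_SC, IH, (sum_n_SC _ m); eqC; ring.
Qed.

Lemma sum_n_rev (f : nat -> C) (m : nat) : sum_n (fun k => f (m - k)%nat) m = sum_n f m.
Proof.
  induction m as [|m IH]; [rewrite !sum_O; auto|].
  rewrite sum_n_shift, sum_n_SC, <- IH; simpl Nat.sub; rewrite Cplus_comm; reflexivity.
Qed.

(** The sum is reversed, as one side is ordered by powers of z and the other by powers of 1/z; the
    prefactor is z^(2n+3/2) e^z. *)
Lemma besselK_poly_pk (n : nat) (s : C) :
  besselK_poly n (cexp s) = (cexp (RtoC (INR (2 * n + 1) + / 2) * s + cexp s) * pk n s)%C.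
Proof.
  unfold besselK_poly, pk; set (N := (2 * n + 1)%nat); rewrite <- sum_n_rev.
  assert (H : forall m, (m <= N)%nat ->
    sum_n (fun k => RtoC (hankel (nu_ n) (N - (N - k)) / 2 ^ (N - (N - k))) * cexp s ^ (N - k))%C m =
    (cexp (RtoC (INR N + / 2) * s + cexp s) *
      sum_n (fun k => RtoC (pk_coef n k) * pk_term (INR k + / 2) s) m)%C).
  { assert (T : forall k, (k <= N)%nat ->
      (RtoC (hankel (nu_ n) (N - (N - k)) / 2 ^ (N - (N - k))) * cexp s ^ (N - k))%C =
      (cexp (RtoC (INR N + / 2) * s + cexp s) * (RtoC (pk_coef n k) * pk_term (INR k + / 2) s))%C).
    { intros k Hk; replace (N - (N - k))%nat with k by lia; fold (pk_coef n k).
      rewrite cexp_pow, minus_INR by auto.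
      replace (cexp (RtoC (INR N + / 2) * s + cexp s) * (RtoC (pk_coef n k) * pk_term (INR k + / 2) s))%C with
        (RtoC (pk_coef n k) * (cexp (RtoC (INR N + / 2) * s + cexp s) * pk_term (INR k + / 2) s))%C by ring.
      unfold pk_term; rewrite <- cexp_plus; f_equal; f_equal.
      rewrite RtoC_minus, !RtoC_plus; ring. }
    induction m as [|m IH]; intros Hm; [rewrite !sum_O; apply T; auto|].
    rewrite !sum_n_SC, IH, T by lia; eqC; ring. }
  apply H; auto.
Qed.

Lemma besselK_poly_zero (n : nat) (s : C) : besselK_poly n (cexp s) = 0%C <-> kt (nu_ n) s = 0%C.
Proof.
  rewrite besselK_poly_pk, pk_kt.
  assert (P : pk n 0%C <> 0%C).
  { intros E; pose proof (pk_0_pos n) as P; rewrite E in P; simpl in P; lra. }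
  split; intros E; [|rewrite E; ring].
  apply Cmod_eq_0; apply (f_equal Cmod) in E; rewrite Cmod_0, !Cmod_mult in E.
  pose proof (proj1 (Cmod_gt_0 _) P).
  pose proof (proj1 (Cmod_gt_0 _) (cexp_neq_0 (RtoC (INR (2 * n + 1) + / 2) * s + cexp s))).
  apply Rmult_integral in E; destruct E as [E|E]; [lra|].
  apply Rmult_integral in E; destruct E as [E|E]; [lra | auto].
Qed.

(** * The boundary of the strip at order nu_n *)

Lemma cos_sin_nu_n (n : nat) : cos (nu_ n * PI) = 0 /\ sin (nu_ n * PI) = -1.
Proof.
  destruct (cos_sin_nu n 0) as [A B]; rewrite Rplus_0_r, Rmult_0_l in A, B.
  rewrite A, B, sin_0, cos_0; split; lra.
Qed.

Lemma kt_boundary_nu_n (n : nat) (t : R) : kt (nu_ n) (RtoC t + RtoC PI * Ci) =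
  (Ci * RtoC (Re (kt (nu_ n) (RtoC t)) - PI * ri (nu_ n) t / rk (nu_ n) 0))%C.
Proof.
  destruct (cos_sin_nu_n n) as [Hc Hs]; pose proof (nu_gt_1 n).
  destruct (kt_boundary (nu_ n) t ltac:(lra) ltac:(lra)) as [A B]; rewrite Hc in A; rewrite Hs in B.
  apply C_eq; [rewrite A; simpl; ring | rewrite B; simpl; field].
  apply Rgt_not_eq, (rk_recessive (nu_ n)); [lra | apply sin_nonint; lra].
Qed.

Lemma rk_nu_n_pos (n : nat) : 0 < rk (nu_ n) 0.
Proof.
  destruct (cos_sin_nu_n n) as [Hc Hs]; pose proof (nu_gt_1 n).
  apply (rk_recessive (nu_ n)); [lra | apply sin_nonint; lra].
Qed.

(** This is (K - pi I)/K(1) at order nu_n, with K and I taken at e^t; its zero is log x_n. *)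
Definition boundary_fn (n : nat) (t : R) : R :=
  Re (kt (nu_ n) (RtoC t)) - PI * ri (nu_ n) t / rk (nu_ n) 0.

Definition boundary_fn' (n : nat) (t : R) : R :=
  Re (kt' (nu_ n) (RtoC t)) - PI * ri' (nu_ n) t / rk (nu_ n) 0.

Lemma boundary_fn_derive (n : nat) (t : R) : is_derive (boundary_fn n) t (boundary_fn' n t) /\
  boundary_fn' n t < 0.
Proof.
  pose proof (nu_gt_1 n) as Hn; pose proof (rk_nu_n_pos n) as Hg.
  destruct (kt_recessive (nu_ n) ltac:(lra)) as [D R]; destruct (D t) as [D0 _].
  pose proof (ri_derive (nu_ n) t) as D1; pose proof PI_RGT_0; split.
  - apply is_derive_ext with (fun t => Re (kt (nu_ n) (RtoC t)) - PI * / rk (nu_ n) 0 * ri (nu_ n) t).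
    + intros x; eqR; unfold boundary_fn; field; lra.
    + unfold boundary_fn'; eapply is_derive_eq.
      * apply (is_derive_minus_R (fun t => Re (kt (nu_ n) (RtoC t)))
          (fun t => PI * / rk (nu_ n) 0 * ri (nu_ n) t)); [exact D0 | apply is_derive_scal_R; exact D1].
      * eqR; field; lra.
  - unfold boundary_fn'; destruct (R t) as [r0 [r1 _]].
    pose proof (ri_pos (nu_ n) t ltac:(lra)); pose proof (ri'_ge (nu_ n) t ltac:(lra)).
    assert (0 < ri' (nu_ n) t) by nra.
    assert (0 < PI * ri' (nu_ n) t / rk (nu_ n) 0) by (apply Rdiv_lt_0_compat; nra). nra.
Qed.

Lemma boundary_fn_unique (n : nat) (t t' : R) : boundary_fn n t = 0 -> boundary_fn n t' = 0 -> t = t'.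
Proof.
  assert (A : forall t t', t < t' -> boundary_fn n t = 0 -> boundary_fn n t' = 0 -> False).
  { intros x y Hxy Ex Ey.
    destruct (mean_value (boundary_fn n) (boundary_fn' n) x y) as [z [_ E]]; [lra| |].
    - intros; apply boundary_fn_derive.
    - pose proof (proj2 (boundary_fn_derive n z)); rewrite Ex, Ey in E; nra. }
  intros E E'; destruct (Rtotal_order t t') as [h|[h|h]]; auto; exfalso; eauto.
Qed.

(** On the boundary line [kt] is i times [boundary_fn], and differentiation in the real direction
    gives the complex derivative. *)
Lemma Im_kt'_boundary (n : nat) (t : R) : Im (kt' (nu_ n) (RtoC t + RtoC PI * Ci)) = boundary_fn' n t.
Proof.
  pose proof (nu_gt_1 n).
  destruct (kt_is_bessel (nu_ n) ltac:(lra) (RtoC t + RtoC PI * Ci)%C) as [D _].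
  replace (RtoC t + RtoC PI * Ci)%C with (RtoC PI * Ci + RtoC t * 1)%C in D at 1 by ring.
  apply is_cderive_path in D; destruct D as [_ D]; rewrite Cmult_1_r in D.
  assert (E : forall x, Im (kt (nu_ n) (RtoC PI * Ci + RtoC x * 1)) = boundary_fn n x).
  { intros x; replace (RtoC PI * Ci + RtoC x * 1)%C with (RtoC x + RtoC PI * Ci)%C by ring.
    rewrite kt_boundary_nu_n; simpl; unfold boundary_fn; ring. }
  pose proof (is_derive_ext _ _ _ _ E D) as D'.
  apply is_derive_unique in D'; rewrite <- D'; apply is_derive_unique, boundary_fn_derive.
Qed.

(* As nu increases from nu_n, Re kt (t + i pi) = cos (nu pi) kt t becomes positive, and it still
   increases in the direction i; hence the zero near the upper boundary moves inside the strip. *)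
Lemma boundary_zero_moves_inside (n : nat) (t : R) : exists r d, 0 < r /\ 0 < d /\
  forall nu s, nu_ n < nu < nu_ n + d -> Cmod (s - (RtoC t + RtoC PI * Ci))%C < r ->
  kt nu s = 0%C -> Im s < PI.
Proof.
  pose proof (nu_gt_1 n) as Hn; set (p0 := (RtoC t + RtoC PI * Ci)%C).
  pose proof (proj2 (boundary_fn_derive n t)) as Hneg; rewrite <- Im_kt'_boundary in Hneg.
  fold p0 in Hneg; set (dd := kt' (nu_ n) p0) in *.
  destruct (kt_joint_continuity (nu_ n) p0 (- Im dd) Hn ltac:(lra)) as [d [Hd J]].
  exists d, (Rmin d 1); split; auto; split; [apply Rmin_pos; lra|].
  intros nu s Hnu Hs E; apply Rnot_le_lt; intros Hi.
  pose proof (Rmin_l d 1); pose proof (Rmin_r d 1).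
  set (p := (RtoC (Re s) + RtoC PI * Ci)%C); set (eta := Im s - PI).
  assert (Hsp : s = (p + Ci * RtoC eta)%C) by (apply C_eq; unfold p, eta; simpl; ring).
  pose proof (Cmod2_alt (s - p0)%C) as E2.
  replace (Re (s - p0)%C) with (Re s - t) in E2 by (unfold p0; destruct s; simpl; ring).
  replace (Im (s - p0)%C) with eta in E2 by (unfold p0, eta; destruct s; simpl; ring).
  assert (Hn1 : Rabs (nu - nu_ n) < d) by (rewrite Rabs_pos_eq; lra).
  assert (Dk : forall u, is_cderive (kt nu) u (kt' nu u)) by (intros; apply kt_is_bessel; lra).
  (* On the line itself Re kt = cos(nu pi) kt(e^t part) is positive for nu just above nu_n, so it
     carries no zero. *)
  destruct (Req_dec eta 0) as [He0|He0].
  { rewrite He0 in Hsp; replace (p + Ci * RtoC 0)%C with p in Hsp by ring.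
    pose proof (kt_boundary_re nu (Re s) ltac:(lra)) as B; fold p in B; rewrite <- Hsp, E in B.
    destruct (cos_sin_nu n (nu - nu_ n)) as [Hc _]; replace (nu_ n + (nu - nu_ n)) with nu in Hc by ring.
    pose proof PI_RGT_0; pose proof (sin_gt_0 ((nu - nu_ n) * PI) ltac:(nra) ltac:(nra)).
    destruct (kt_recessive nu ltac:(lra)) as [_ R]; destruct (R (Re s)) as [r0 _].
    simpl in B; rewrite Hc in B; nra. }
  assert (Heta : 0 < eta) by (unfold eta in *; lra).
  pose proof (path_mean_value (fun x => kt nu (p + RtoC x * (Ci * RtoC eta))%C)
     (fun x => kt' nu (p + RtoC x * (Ci * RtoC eta)) * (Ci * RtoC eta))%C
     (dd * (Ci * RtoC eta))%C) as M.
  (* From the boundary point p straight up to s: the derivative of Re kt in the direction i is -Im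
     kt', positive near p0, so Re kt at s exceeds its positive value at p and cannot be 0. *)
  destruct (mean_value (fun x => Re (kt nu (p + RtoC x * (Ci * RtoC eta))))
    (fun x => Re (kt' nu (p + RtoC x * (Ci * RtoC eta)) * (Ci * RtoC eta))%C) 0 1) as [x [Hx MV]]; [lra| |].
  { intros x _; apply (is_cderive_path (kt nu) p (Ci * RtoC eta)%C), Dk. }
  clear M; replace (p + RtoC 1 * (Ci * RtoC eta))%C with s in MV by (rewrite Hsp; ring).
  replace (p + RtoC 0 * (Ci * RtoC eta))%C with p in MV by ring.
  destruct (J nu (p + RtoC x * (Ci * RtoC eta))%C Hn1) as [_ [_ B]].
  { eapply Rle_lt_trans; [|exact Hs].
    apply Rsqr_incr_0_var; [|apply Cmod_ge_0]; unfold Rsqr.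
    pose proof (Cmod2_alt (p + RtoC x * (Ci * RtoC eta) - p0)%C) as E3.
    replace (Re (p + RtoC x * (Ci * RtoC eta) - p0)%C) with (Re s - t) in E3 by (unfold p, p0; destruct s; simpl; ring).
    replace (Im (p + RtoC x * (Ci * RtoC eta) - p0)%C) with (x * eta) in E3 by (unfold p, p0; destruct s; simpl; ring).
    assert ((x * eta) ^ 2 <= eta ^ 2) by (apply pow_incr; nra). simpl pow in *; lra. }
  pose proof (kt_boundary_re nu (Re s) ltac:(lra)) as Bd; fold p in Bd.
  destruct (cos_sin_nu n (nu - nu_ n)) as [Hc _]; replace (nu_ n + (nu - nu_ n)) with nu in Hc by ring.
  pose proof PI_RGT_0; pose proof (sin_gt_0 ((nu - nu_ n) * PI) ltac:(nra) ltac:(nra)).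
  destruct (kt_recessive nu ltac:(lra)) as [_ R]; destruct (R (Re s)) as [r0 _].
  set (k1 := kt' nu (p + RtoC x * (Ci * RtoC eta))%C) in *.
  replace (Re (k1 * (Ci * RtoC eta))%C) with (- Im k1 * eta) in MV by (destruct k1; simpl; ring).
  pose proof (im_le_Cmod (k1 - dd)%C) as IL.
  replace (Im (k1 - dd)%C) with (Im k1 - Im dd) in IL by reflexivity; fold dd in B.
  assert (IL' : Rabs (Im k1 - Im dd) < - Im dd) by lra.
  apply Rabs_lt_between in IL'.
  rewrite E, Bd, Hc in MV; simpl in MV; nra.
Qed.

(** * The zeros near nu_n *)

Lemma clog_RtoC (x : R) : 0 < x -> clog (RtoC x) = RtoC (ln x).
Proof.
  intros Hx; rewrite <- (exp_ln x) at 1 by auto; rewrite <- cexp_RtoC; apply clog_cexp.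
  simpl; rewrite Rabs_R0; apply PI_RGT_0.
Qed.

Lemma slit_RtoC (x : R) : 0 < x -> slit_plane (RtoC x).
Proof. intros Hx [_ H]; simpl in H; lra. Qed.

Lemma slit_nonreal (z : C) : Im z <> 0 -> slit_plane z.
Proof. intros Hz [H _]; auto. Qed.

Lemma boundary_fn_zero (n : nat) (x : R) : 0 < x ->
  besselK (nu_ n) (RtoC x) = (RtoC PI * besselI (nu_ n) (RtoC x))%C -> boundary_fn n (ln x) = 0.
Proof.
  intros Hx E; pose proof (nu_gt_1 n); destruct (cos_sin_nu_n n) as [_ Hs].
  rewrite besselK_kt_nonint, besselI_bi, clog_RtoC, bi_RtoC in E
    by (auto; try lra; try apply slit_RtoC; try apply slit_neq_0, slit_RtoC; auto).
  rewrite (proj1 (kt_real (nu_ n) (ln x) ltac:(lra))), <- !RtoC_mult in E; apply RtoC_inj in E.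
  pose proof (rk_nu_n_pos n); unfold boundary_fn; rewrite <- E; field; lra.
Qed.

(** The first two are the logarithms of -x seen from above and from below the cut. *)
Definition limit_points (x : R) (w : nat -> C) (i : nat) : C :=
  match i with
  | O => (RtoC (ln x) + RtoC PI * Ci)%C
  | 1%nat => (RtoC (ln x) - RtoC PI * Ci)%C
  | S (S j) => clog (w j)
  end.

(** On the lines Im s = pi and Im s = -pi the zeros come from the strictly decreasing [boundary_fn],
    hence one on each. In the open strip exp matches them with the non-real roots of the polynomial,
    the real axis being excluded by K > 0. *)
Lemma limit_points_enumerate (n : nat) (x : R) (w : nat -> C) : 0 < x ->
  besselK (nu_ n) (RtoC x) = (RtoC PI * besselI (nu_ n) (RtoC x))%C ->
  enumerates (2 * n) (nonreal_zero n) w ->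
  enumerates (2 * n + 2) (strip_zero (nu_ n)) (limit_points x w).
Proof.
  intros Hx E [Iw Hw]; pose proof (nu_gt_1 n) as Hn; pose proof PI_RGT_0 as Hpi.
  pose proof (boundary_fn_zero n x Hx E) as B.
  assert (Hj : forall j, (j < 2 * n)%nat -> Im (w j) <> 0 /\ besselK_poly n (w j) = 0%C).
  { intros j Hj; assert (Z : nonreal_zero n (w j)) by (apply Hw; exists j; auto).
    destruct Z; auto. }
  assert (Hcl : forall j, (j < 2 * n)%nat -> Rabs (Im (clog (w j))) < PI /\ cexp (clog (w j)) = w j).
  { intros j h; destruct (Hj j h) as [h1 _]; split; [apply Im_clog_slit, slit_nonreal; auto|].
    apply cexp_clog, slit_neq_0, slit_nonreal; auto. }
  assert (I0 : Im (limit_points x w 0) = PI) by (simpl; ring).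
  assert (I1 : Im (limit_points x w 1) = - PI) by (simpl; ring).
  assert (Z0 : kt (nu_ n) (limit_points x w 0) = 0%C).
  { simpl limit_points; rewrite kt_boundary_nu_n; fold (boundary_fn n (ln x)); rewrite B; ring. }
  assert (C01 : limit_points x w 1 = Cconj (limit_points x w 0)) by (apply C_eq; simpl; ring).
  split.
  - assert (Lt : forall i, (i < 2 * n + 2)%nat -> (2 <= i)%nat -> Rabs (Im (limit_points x w i)) < PI).
    { intros i h1 h2; destruct i as [|[|j]]; try lia; apply Hcl; lia. }
    assert (Ab : forall i j, (i < 2 * n + 2)%nat -> (j < 2 * n + 2)%nat -> (i < j)%nat ->
      limit_points x w i = limit_points x w j -> False).
    { intros i j Hi Hjj Hij Eij; destruct i as [|[|i]].
      - destruct j as [|[|j]]; [lia | rewrite <- Eij, I0 in I1; lra|].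
        specialize (Lt (S (S j)) Hjj ltac:(lia)); rewrite <- Eij, I0, Rabs_pos_eq in Lt; lra.
      - destruct j as [|[|j]]; try lia.
        specialize (Lt (S (S j)) Hjj ltac:(lia)); rewrite <- Eij, I1, Rabs_left1 in Lt; lra.
      - destruct j as [|[|j]]; try lia; simpl limit_points in Eij.
        apply (f_equal cexp) in Eij.
        rewrite (proj2 (Hcl i ltac:(lia))), (proj2 (Hcl j ltac:(lia))) in Eij.
        apply Iw in Eij; lia. }
    intros i j Hi Hjj Eij; destruct (Nat.lt_trichotomy i j) as [h|[h|h]]; auto; exfalso; eauto.
  - intros s; split.
    + intros [Hs Ez].
      assert (Up : forall u, Im u = PI -> kt (nu_ n) u = 0%C -> u = limit_points x w 0).
      { intros u Iu Eu.
        assert (Du : u = (RtoC (Re u) + RtoC PI * Ci)%C)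
          by (apply C_eq; simpl; [ring | rewrite <- Iu; ring]).
        pose proof Eu as Eu2; rewrite Du, kt_boundary_nu_n in Eu2; fold (boundary_fn n (Re u)) in Eu2.
        apply (f_equal Im) in Eu2; simpl in Eu2.
        rewrite Du; simpl limit_points; do 2 f_equal.
        apply (boundary_fn_unique n); auto; lra. }
      destruct (Rle_lt_or_eq_dec _ _ Hs) as [Hlt|Heq].
      * assert (Hi : Im s <> 0).
        { intros Z; assert (Es : s = RtoC (Re s)) by (apply C_eq; simpl; auto).
          destruct (kt_recessive (nu_ n) ltac:(lra)) as [_ Rr]; destruct (Rr (Re s)) as [r0 _].
          rewrite <- Es, Ez in r0; simpl in r0; lra. }
        assert (Hz : nonreal_zero n (cexp s)).
        { split; [apply besselK_poly_zero; auto|]; rewrite Im_cexp.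
          pose proof (exp_pos (Re s)); apply Rabs_lt_between in Hlt.
          apply Rmult_integral_contrapositive_currified; [lra|].
          destruct (Rlt_le_dec 0 (Im s)).
          - pose proof (sin_gt_0 (Im s) ltac:(lra) ltac:(lra)); lra.
          - pose proof (sin_gt_0 (- Im s) ltac:(lra) ltac:(lra)) as S; rewrite sin_neg in S; lra. }
        apply Hw in Hz; destruct Hz as [j [Hjj Ej]].
        exists (S (S j)); split; [lia|]; simpl; rewrite <- Ej, clog_cexp; auto.
      * unfold Rabs in Heq; destruct (Rcase_abs (Im s)).
        -- exists 1%nat; split; [lia|]; rewrite C01, <- (Cconj_conj s); f_equal.
           apply Up; [rewrite im_conj; lra | apply kt_zero_conj; auto; lra].
        -- exists 0%nat; split; [lia|]; apply Up; auto.
    + intros [i [Hi ->]]; destruct i as [|[|j]].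
      * split; auto; rewrite I0, Rabs_pos_eq; lra.
      * split; [rewrite I1, Rabs_left1; lra|]; rewrite C01; apply kt_zero_conj; auto; lra.
      * simpl limit_points; destruct (Hcl j ltac:(lia)) as [A1 A2]; split; [lra|].
        apply besselK_poly_zero; rewrite A2; apply Hj; lia.
Qed.

(** The transferred zeros must be shown to lie in the strip: the interior ones by their distance
    from the boundary, the upper boundary one by [boundary_zero_moves_inside], the lower one by
    conjugation. *)
Lemma zeros_near_nu_n (n : nat) (x : R) (w : nat -> C) : 0 < x ->
  besselK (nu_ n) (RtoC x) = (RtoC PI * besselI (nu_ n) (RtoC x))%C ->
  enumerates (2 * n) (nonreal_zero n) w ->
  forall r, 0 < r -> exists rho d, 0 < rho /\ 0 < d /\ forall nu, nu_ n < nu < nu_ n + d ->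
    exists w', enumerates (2 * n + 2) (strip_zero nu) w' /\
    forall i, (i < 2 * n + 2)%nat -> Cmod (w' i - limit_points x w i)%C < r /\
      forall s, kt nu s = 0%C -> Cmod (s - limit_points x w i)%C < rho -> s = w' i.
Proof.
  intros Hx E Hw r Hr; pose proof (nu_gt_1 n) as Hn.
  pose proof (limit_points_enumerate n x w Hx E Hw) as HL; set (W := limit_points x w) in *.
  destruct (boundary_zero_moves_inside n (ln x)) as [r1 [d1 [Hr1 [Hd1 In]]]].
  destruct (interior_radius (2 * n) (fun j => W (S (S j)))) as [r2 [Hr2 R2]].
  { intros j Hj; unfold W; simpl limit_points; apply Im_clog_slit, slit_nonreal.
    assert (Z : nonreal_zero n (w j)) by (apply Hw; exists j; auto); apply Z. }
  set (r0 := Rmin (Rmin 1 r) (Rmin r1 r2)).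
  assert (Hr0 : 0 < r0) by (repeat apply Rmin_pos; auto; lra).
  (* This keeps each of the two boundary zeros away from the opposite edge of the strip. *)
  assert (B0 : r0 <= 1) by (eapply Rle_trans; [apply Rmin_l | apply Rmin_l]).
  assert (B1 : r0 <= r) by (eapply Rle_trans; [apply Rmin_l | apply Rmin_r]).
  assert (B2 : r0 <= r1) by (eapply Rle_trans; [apply Rmin_r | apply Rmin_l]).
  assert (B3 : r0 <= r2) by (eapply Rle_trans; [apply Rmin_r | apply Rmin_r]).
  destruct (strip_zeros_transfer (nu_ n) _ W r0 Hn Hr0 HL) as [rho [d [Hrho [Hd T]]]].
  exists rho, (Rmin d d1); split; auto; split; [apply Rmin_pos; auto|]; intros nu Hnu.
  pose proof (Rmin_l d d1); pose proof (Rmin_r d d1).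
  destruct (T nu ltac:(rewrite Rabs_pos_eq; lra)) as [w' [I' [Z' C']]].
  exists w'; split.
  - split; auto; intros s; split; auto; intros [i [Hi ->]].
    destruct (Z' i Hi) as [Ez [Ed _]]; split; auto.
    destruct i as [|[|j]].
    + assert (A : Im (w' 0%nat) < PI) by (apply (In nu); auto; [lra | unfold W in Ed; simpl in Ed; lra]).
      pose proof (im_le_Cmod (w' 0%nat - W 0%nat)%C) as B.
      replace (Im (w' 0%nat - W 0%nat)%C) with (Im (w' 0%nat) - PI) in B
        by (unfold W; destruct (w' 0%nat); simpl; ring).
      assert (B' : Rabs (Im (w' 0%nat) - PI) <= 1) by lra.
      apply Rabs_le_between in B'; apply Rabs_le; pose proof PI_RGT_0; pose proof PI2_1; lra.
    + assert (Ec : Cconj (w' 1%nat - W 1%nat) = (Cconj (w' 1%nat) - (RtoC (ln x) + RtoC PI * Ci))%C)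
        by (apply C_eq; unfold W; destruct (w' 1%nat); simpl; ring).
      assert (A : Im (Cconj (w' 1%nat)) < PI).
      { apply (In nu); [lra | | apply kt_zero_conj; auto; lra].
        rewrite <- Ec, Cmod_conj; lra. }
      rewrite im_conj in A.
      pose proof (im_le_Cmod (w' 1%nat - W 1%nat)%C) as B.
      replace (Im (w' 1%nat - W 1%nat)%C) with (Im (w' 1%nat) + PI) in B
        by (unfold W; destruct (w' 1%nat); simpl; ring).
      assert (B' : Rabs (Im (w' 1%nat) + PI) <= 1) by lra.
      apply Rabs_le_between in B'; apply Rabs_le; pose proof PI_RGT_0; pose proof PI2_1; lra.
    + apply (R2 j); [lia | lra].
  - intros i Hi; destruct (Z' i Hi) as [_ [A B]]; split; [lra | auto].
Qed.

(** * Return to the variable z *)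

Lemma filterlim_at_right (f : R -> C) (a : R) (l : C) :
  (forall eps, 0 < eps -> exists d, 0 < d /\ forall y, a < y < a + d -> Cmod (f y - l)%C < eps) ->
  filterlim f (at_right a) (locally l).
Proof.
  intros H P [eps HP]; destruct (H eps (cond_pos eps)) as [d [Hd HD]].
  exists (mkposreal d Hd); intros y Hy Hay; apply HP.
  change (Rabs (y - a) < d) in Hy; apply Rabs_lt_between in Hy.
  apply C_NormedModule_mixin_compat1, HD; lra.
Qed.

Lemma besselK_zero_iff (nu : R) (z : C) : 1 < nu ->
  besselK_zero nu z <-> exists s, open_strip_zero nu s /\ z = cexp s.
Proof.
  intros Hnu; destruct (besselK_kt nu Hnu) as [g [Hg HK]]; split.
  - intros [Hz E]; exists (clog z); split.
    + split; [apply Im_clog_slit; auto|].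
      rewrite HK in E by auto.
      replace (kt nu (clog z)) with (RtoC (/ g) * (RtoC g * kt nu (clog z)))%C.
      * rewrite E; ring.
      * rewrite Cmult_assoc, <- RtoC_mult, Rinv_l by auto; ring.
    + symmetry; apply cexp_clog, slit_neq_0; auto.
  - intros [s [[Hs E] ->]]; split; [apply slit_cexp; auto|].
    rewrite HK by (apply slit_cexp; auto); rewrite clog_cexp, E by auto; ring.
Qed.

Lemma enumerates_cexp (n m : nat) (nu : R) (v : nat -> C) : nu_ n < nu < nu_ n + 2 ->
  enumerates m (strip_zero nu) v -> enumerates m (besselK_zero nu) (fun i => cexp (v i)).
Proof.
  intros Hnu [Iv Hv]; pose proof (nu_gt_1 n).
  assert (Ho : forall i, (i < m)%nat -> open_strip_zero nu (v i)).
  { intros i Hi; apply (strip_zero_open n); auto; apply Hv; exists i; auto. }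
  split.
  - intros i j Hi Hj E; apply Iv; auto; apply (f_equal clog) in E.
    rewrite !clog_cexp in E by (apply Ho; auto); auto.
  - intros z; rewrite besselK_zero_iff by lra; split.
    + intros [s [Hs ->]]; apply (strip_zero_open n) in Hs; auto.
      apply Hv in Hs; destruct Hs as [i [Hi ->]]; exists i; auto.
    + intros [i [Hi ->]]; exists (v i); auto.
Qed.

Theorem theorem3 (n : nat) (x : R) (w : nat -> C)
  (hx : 0 < x)
  (hKI : besselK (nu_ n) (RtoC x) = (RtoC PI * besselI (nu_ n) (RtoC x))%C)
  (hw : enumerates (2 * n) (nonreal_zero n) w) :
  exists z : R -> nat -> C,
    (forall nu : R, nu_ n < nu < nu_ n + 2 ->
       enumerates (2 * n + 2) (besselK_zero nu) (z nu)) /\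
    filterlim (fun nu => z nu 0%nat) (at_right (nu_ n)) (locally (RtoC (- x))) /\
    filterlim (fun nu => z nu 1%nat) (at_right (nu_ n)) (locally (RtoC (- x))) /\
    (forall j : nat, (j < 2 * n)%nat ->
       filterlim (fun nu => z nu (j + 2)%nat) (at_right (nu_ n)) (locally (w j))).
Proof.
  pose proof (nu_gt_1 n) as Hn.
  (* The enumeration must be chosen before any accuracy is prescribed. This rho is fixed once;
     within it the zero near each limit point is unique, which determines the labels. *)
  destruct (zeros_near_nu_n n x w hx hKI hw 1 Rlt_0_1) as [rho [d [Hrho [Hd Near]]]].
  assert (Count : forall nu, nu_ n < nu < nu_ n + 2 ->
    exists v, enumerates (2 * n + 2) (strip_zero nu) v).
  { apply (strip_zero_count n (2 * n + 2) d Hd); intros nu Hnu.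
    destruct (Near nu Hnu) as [v [Hv _]]; exists v; auto. }
  (* Near nu_n the labels follow the limit points, on the rest of the interval any enumeration
     serves, and elsewhere the value is a dummy. *)
  assert (Ch : forall nu, exists v,
    (nu_ n < nu < nu_ n + 2 -> enumerates (2 * n + 2) (strip_zero nu) v) /\
    (nu_ n < nu < nu_ n + Rmin d 2 -> forall i, (i < 2 * n + 2)%nat ->
      forall s, kt nu s = 0%C -> Cmod (s - limit_points x w i)%C < rho -> s = v i)).
  { intros nu; destruct (classic (nu_ n < nu < nu_ n + Rmin d 2)) as [Hnu|Hnu].
    - pose proof (Rmin_l d 2); destruct (Near nu ltac:(lra)) as [v [Hv Hu]]; exists v; split; auto.
      intros _ i Hi; apply (Hu i Hi).
    - destruct (classic (nu_ n < nu < nu_ n + 2)) as [Hnu2|Hnu2].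
      + destruct (Count nu Hnu2) as [v Hv]; exists v; split; [auto | easy].
      + exists (fun _ => 0%C); split; easy. }
  apply choice in Ch; destruct Ch as [S HS].
  exists (fun nu i => cexp (S nu i)).
  assert (Lim : forall i, (i < 2 * n + 2)%nat ->
    filterlim (fun nu => cexp (S nu i)) (at_right (nu_ n)) (locally (cexp (limit_points x w i)))).
  { intros i Hi; apply filterlim_at_right; intros eps He.
    destruct (is_cderive_continuous cexp _ _ (is_cderive_cexp (limit_points x w i)) eps He)
      as [e [He0 Cont]].
    (* For the prescribed accuracy the zeros are found anew; being within rho of the limit points,
       they coincide with those already chosen. *)
    destruct (zeros_near_nu_n n x w hx hKI hw (Rmin e rho)) as [rho' [d' [_ [Hd' Near']]]];
      [apply Rmin_pos; auto|].
    exists (Rmin d' (Rmin d 2)); split; [repeat apply Rmin_pos; lra|]; intros nu Hnu.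
    pose proof (Rmin_l d' (Rmin d 2)); pose proof (Rmin_r d' (Rmin d 2)).
    destruct (Near' nu ltac:(lra)) as [v [Hv Hu]]; destruct (Hu i Hi) as [Hdist _].
    assert (Ev : v i = S nu i).
    { apply (proj2 (HS nu) ltac:(lra) i Hi).
      - assert (Z : strip_zero nu (v i)) by (apply Hv; exists i; auto); apply Z.
      - eapply Rlt_le_trans; [exact Hdist | apply Rmin_r]. }
    apply Cont; rewrite <- Ev; eapply Rlt_le_trans; [exact Hdist | apply Rmin_l]. }
  (* exp glues the two edges of the strip along the cut, so both boundary limits become the same
     point. *)
  assert (Neg : forall c, c = PI \/ c = - PI -> cexp (RtoC (ln x) + RtoC c * Ci) = RtoC (- x)).
  { intros c Hc; rewrite cexp_plus, cexp_RtoC, exp_ln, cexp_pi by auto.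
    assert (E : cos c = -1 /\ sin c = 0).
    { destruct Hc as [-> | ->]; rewrite ?cos_neg, ?sin_neg, cos_PI, sin_PI; split; lra. }
    destruct E as [-> ->]; apply C_eq; simpl; ring. }
  split; [|split; [|split]].
  - intros nu Hnu; apply (enumerates_cexp n); auto; apply HS; auto.
  - rewrite <- (Neg PI) by auto; apply (Lim 0%nat); lia.
  - rewrite <- (Neg (- PI)) by auto.
    replace (RtoC (ln x) + RtoC (- PI) * Ci)%C with (limit_points x w 1)
      by (simpl; rewrite RtoC_opp; ring).
    apply (Lim 1%nat); lia.
  - intros j Hj; assert (E : cexp (limit_points x w (j + 2)) = w j).
    { replace (j + 2)%nat with (Datatypes.S (Datatypes.S j)) by lia; apply cexp_clog, slit_neq_0, slit_nonreal.
      assert (Z : nonreal_zero n (w j)) by (apply hw; exists j; auto); apply Z. }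
    pose proof (Lim (j + 2)%nat ltac:(lia)) as L; rewrite E in L; exact L.
Qed.
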